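(* (Necessary Legendre condition.) Let $a,b\in\widetilde{\mathbb R}$ with $a<b$, let $F\in\mathcal{GC}^\infty([a,b]\times\widetilde{\mathbb R}^d\times\widetilde{\mathbb R}^d,\widetilde{\mathbb R})$, let $I(u)=\int_a^bF(t,u,\dot u)\,dt$, and let $u\in\mathcal{GC}^\infty([a,b],\widetilde{\mathbb R}^d)$ be a (local) minimizer of the functional $I$ in $\mathcal{GC}^\infty_{\mathrm{bd}}(u(a),u(b))$. Then $F_{\dot u\dot u}(t,u(t),\dot u(t))$ is positive semidefinite for all $t\in[a,b]$, i.e. $$\sum_{i,j=1}^dF_{\dot u^i\dot u^j}(t,u(t),\dot u(t))\lambda^i\lambda^j\ge0\quad\forall\lambda=(\lambda^1,\ldots,\lambda^d)\in\widetilde{\mathbb R}^d.$$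
   Context: Generalized numbers. Let $I_0=(0,1]\subseteq\mathbb R$; ''for $\varepsilon$ small'' means for all $\varepsilon\in(0,\varepsilon_0]$ for some $\varepsilon_0\in I_0$. Fix a net $\rho=(\rho_\varepsilon)_{\varepsilon\in I_0}$ of reals with $\rho_\varepsilon\to0^+$ as $\varepsilon\to0^+$. A net $(x_\varepsilon)$ in $\mathbb R^n$ is moderate if $|x_\varepsilon|=O(\rho_\varepsilon^{-N})$ for some $N\in\mathbb R_{>0}$; $(x_\varepsilon)\sim(y_\varepsilon)$ if $|x_\varepsilon-y_\varepsilon|=O(\rho_\varepsilon^{N})$ for every $N\in\mathbb R_{>0}$. $\widetilde{\mathbb R}$ is the ring of moderate real nets modulo $\sim$, with classes $[x_\varepsilon]$; $\widetilde{\mathbb R}^n$ is defined analogously. $\mathbb R\subseteq\widetilde{\mathbb R}$ via constant nets. $x\le y$ iff there are representatives with $x_\varepsilon\le y_\varepsilon$ for all $\varepsilon$; $x<y$ iff $y-x\ge0$ and $y-x$ is invertible; $|[x_\varepsilon]|=[|x_\varepsilon|]$ (Euclidean norm); $\max([x_\varepsilon],[y_\varepsilon])=[\max(x_\varepsilon,y_\varepsilon)]$. $[a,b]=\{x\in\widetilde{\mathbb R}:a\le x\le b\}$. The sharp topology on $\widetilde{\mathbb R}^n$ has as base the balls $B_r(c)=\{x:|x-c|<r\}$, $r\in\widetilde{\mathbb R}_{>0}$. Generalized smooth functions (GSF). For open $\Omega_\varepsilon\subseteq\mathbb R^n$, $\langle\Omega_\varepsilon\rangle$ is the set of $[x_\varepsilon]\in\widetilde{\mathbb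 R}^n$ such that for every representative $x_\varepsilon\in\Omega_\varepsilon$ for $\varepsilon$ small. For $X\subseteq\widetilde{\mathbb R}^n$, $Y\subseteq\widetilde{\mathbb R}^k$, $\mathcal{GC}^\infty(X,Y)$ is the set of maps $f:X\to Y$ for which there are $f_\varepsilon\in C^\infty(\Omega_\varepsilon,\mathbb R^k)$ with $X\subseteq\langle\Omega_\varepsilon\rangle$, $f([x_\varepsilon])=[f_\varepsilon(x_\varepsilon)]$ and $(\partial^\alpha f_\varepsilon(x_\varepsilon))$ moderate for all $[x_\varepsilon]\in X$ and all multi-indices $\alpha$. Derivatives are $\partial^\alpha f([x_\varepsilon])=[\partial^\alpha f_\varepsilon(x_\varepsilon)]$ at sharply interior points and one-sided limits at endpoints of intervals. $\int_a^bf(t)\,dt=[\int_{a_\varepsilon}^{b_\varepsilon}f_\varepsilon(t)\,dt]$. $F_{\dot u^i\dot u^j}$ is the second partial derivative of $F$ with respect to the $i$-th and $j$-th components of its third variable. Variational notions. $\mathcal{GC}^\infty_{\mathrm{bd}}(p,q)=\{v\in\mathcal{GC}^\infty([a,b],\widetilde{\mathbb R}^d):v(a)=p,\ v(b)=q\}$. For $m\in\mathbb N$ ($0\in\mathbb N$) and $v\in\mathcal{GC}^\infty([a,b],\widetilde{\mathbb R}^d)$, $\|v\|_m=\max_{n\le m,\,1\le i\le d}\max\left(\left|\frac{d^nv^i}{dt^n}(M_{ni})\right|,\left|\frac{d^nv^i}{dt^n}(m_{ni})\right|\right)\in\widetilde{\mathbb R}$, where $m_{ni},M_{ni}\in[a,b]$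 are points at which $\frac{d^nv^i}{dt^n}$ attains its minimum resp. maximum over $[a,b]$ (they exist, and the value does not depend on their choice). $B^m_r(u)=\{v\in\mathcal{GC}^\infty([a,b],\widetilde{\mathbb R}^d):\|v-u\|_m<r\}$. $u$ is a local minimizer of $I$ in $\mathcal{GC}^\infty_{\mathrm{bd}}(p,q)$ if $u\in\mathcal{GC}^\infty_{\mathrm{bd}}(p,q)$ and there are $r\in\widetilde{\mathbb R}_{>0}$, $m\in\mathbb N$ with $I(v)\ge I(u)$ for all $v\in B^m_r(u)\cap\mathcal{GC}^\infty_{\mathrm{bd}}(p,q)$. *)

(* Defs.v *)
From HB Require Import structures.
From mathcomp Require Import all_boot all_order all_algebra.
From mathcomp Require Import all_classical all_reals all_analysis.
From mathcomp Require Import lra.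

Set Implicit Arguments.
Unset Strict Implicit.
Unset Printing Implicit Defensive.

Import Order.TTheory GRing.Theory Num.Theory.
Import numFieldNormedType.Exports.

Local Open Scope classical_set_scope.
Local Open Scope quotient_scope.
Local Open Scope ring_scope.

Record gauge (R : realType) := Gauge {
  gauge_net :> R -> R;
  gauge_cvg : gauge_net e @[e --> (0 : R)^'+] --> (0 : R)^'+ }.

(* A net is a total function R -> R of which only the values on (0, 1] matter;
   "for epsilon small" is \near 0^'+ , so that the values elsewhere affect none
   of the notions below. *)
Section Nets.
Context {R : realType} (rho : gauge R).
Implicit Types x y : R -> R.

Definition moderate x := exists2 N : R, 0 < N &
  (x : R -> R^o) =O_ ((0 : R)^'+) (fun e => (rho e `^ (- N) : R^o)).

Definition negligible x := forall N : R, 0 < N ->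
  (x : R -> R^o) =O_ ((0 : R)^'+) (fun e => (rho e `^ N : R^o)).

Lemma gauge_gt0 : \forall e \near (0 : R)^'+, 0 < rho e.
Proof. by exact: (gauge_cvg rho (nbhs_right_gt 0)). Qed.

Lemma gauge_lt (c : R) : 0 < c -> \forall e \near (0 : R)^'+, rho e < c.
Proof. by move=> c0; exact: (gauge_cvg rho (nbhs_right_lt c0)). Qed.

Lemma bigO_absorb x (M N : R) : N < M ->
  (x : R -> R^o) =O_ ((0 : R)^'+) (fun e => (rho e `^ M : R^o)) ->
  \forall e \near (0 : R)^'+, `|x e| <= rho e `^ N.
Proof.
move=> NM /eqO_exP[k k0 xk].
have k10 : 0 < k^-1 `^ (M - N)^-1 by rewrite powR_gt0// invr_gt0.
near=> e.
have e0 : 0 < rho e by near: e; exact: gauge_gt0.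
have MN0 : 0 < M - N by rewrite subr_gt0.
apply: (@le_trans _ _ (k * rho e `^ M)).
  rewrite -[X in _ <= _ * X]ger0_norm ?powR_ge0//.
  by near: e.
rewrite -[in leLHS](subrK N M) powRD; last by rewrite (gt_eqF e0) implybT.
rewrite mulrA ler_piMl ?powR_ge0//.
rewrite -ler_pdivlMl// mulr1.
have -> : k^-1 = (k^-1 `^ (M - N)^-1) `^ (M - N).
  by rewrite -powRrM mulVf ?gt_eqF// powRr1// invr_ge0 ltW.
rewrite ge0_ler_powR ?nnegrE ?powR_ge0 ?(ltW MN0)//; first exact: ltW.
by apply: ltW; near: e; exact: gauge_lt.
Unshelve. all: by end_near. Qed.

Lemma le_bigO x (N : R) : (\forall e \near (0 : R)^'+, `|x e| <= rho e `^ N) ->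
  (x : R -> R^o) =O_ ((0 : R)^'+) (fun e => (rho e `^ N : R^o)).
Proof.
move=> xN; apply/eqO_exP; exists 1 => //.
near=> e; rewrite mul1r [leRHS]ger0_norm ?powR_ge0//.
by near: e.
Unshelve. all: by end_near. Qed.

Lemma moderateP x : moderate x <-> exists2 N : R, 0 < N &
  \forall e \near (0 : R)^'+, `|x e| <= rho e `^ (- N).
Proof.
split=> [[N N0 xN]|[N N0 xN]]; last by exists N => //; exact: le_bigO.
exists (N + 1); first by rewrite addr_gt0.
by apply: bigO_absorb xN; rewrite ltrN2 ltrDl.
Qed.

Lemma negligibleP x : negligible x <-> forall N : R, 0 < N ->
  \forall e \near (0 : R)^'+, `|x e| <= rho e `^ N.
Proof.
split=> xN N N0; last by apply: le_bigO; exact: xN.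
apply: (@bigO_absorb _ (N + 1)); first by rewrite ltrDl.
by apply: xN; rewrite addr_gt0.
Qed.

Lemma le_gauge_powR (M N : R) : M <= N ->
  \forall e \near (0 : R)^'+, rho e `^ N <= rho e `^ M.
Proof.
move=> MN; near=> e; apply: ger_powR => //; apply/andP; split.
  by near: e; exact: gauge_gt0.
by apply: ltW; near: e; exact: gauge_lt.
Unshelve. all: by end_near. Qed.

Definition moderate_pred : {pred (R -> R)} := [pred x | `[< moderate x >]].

Lemma moderate_subring : subring_closed moderate_pred.
Proof.
split=> [|x y|x y].
- apply/asboolP/moderateP; exists 1 => //.
  have := @le_gauge_powR (- 1) 0 (lerN10 R).
  by apply: filterS => e; rewrite powRr0 normr1.
- move=> /asboolP/moderateP[M M0 xM] /asboolP/moderateP[N N0 yN].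
  apply/asboolP; exists (M + N); first by rewrite addr_gt0.
  have leM := @le_gauge_powR (- (M + N)) (- M) ltac:(lra).
  have leN := @le_gauge_powR (- (M + N)) (- N) ltac:(lra).
  apply/eqO_exP; exists 2 => //; near=> e.
  rewrite [X in _ <= _ * X]ger0_norm ?powR_ge0//.
  apply: le_trans (ler_normB _ _) _; rewrite mulr_natl mulr2n lerD//.
    by apply: (@le_trans _ _ (rho e `^ (- M))); near: e.
  by apply: (@le_trans _ _ (rho e `^ (- N))); near: e.
- move=> /asboolP/moderateP[M M0 xM] /asboolP/moderateP[N N0 yN].
  apply/asboolP/moderateP; exists (M + N); first by rewrite addr_gt0.
  near=> e; rewrite normrM opprD powRD; last first.
    apply/implyP => _; rewrite gt_eqF//; near: e; exact: gauge_gt0.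
  by rewrite ler_pM//; near: e.
Unshelve. all: by end_near. Qed.

HB.instance Definition _ :=
  GRing.isSubringClosed.Build (R -> R) moderate_pred moderate_subring.

Record mnet := MNet { mnet_val :> R -> R; _ : mnet_val \in moderate_pred }.

HB.instance Definition _ := [isSub for mnet_val].
HB.instance Definition _ := [Choice of mnet by <:].
HB.instance Definition _ := [SubChoice_isSubComNzRing of mnet by <:].

Definition negligible_pred : {pred mnet} :=
  [pred x | `[< negligible (val x) >]].

Lemma negligible_ideal : idealr_closed negligible_pred.
Proof.
split.
- apply/asboolP/negligibleP => N N0; near=> e.
  by rewrite normr0 powR_ge0.
- apply/negP => /asboolP/negligibleP/(_ 1 ltr01) h.
  have [e []] : exists e, 1 <= rho e /\ rho e < 1; last first.
    by move=> /le_lt_trans/[apply]; rewrite ltxx.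
  near (0 : R)^'+ => e; exists e; split; last by near: e; exact: gauge_lt.
  rewrite -[leRHS]powRr1; last by apply: ltW; near: e; exact: gauge_gt0.
  rewrite -[leLHS]normr1; near: e; exact: h.
- move=> [x xm] u v /asboolP/negligibleP un /asboolP/negligibleP vn.
  have /asboolP/moderateP[M M0 xM] := xm.
  apply/asboolP => N N0; apply/eqO_exP; exists 2 => //.
  have uN := un (N + M) ltac:(lra).
  have vN := vn N N0.
  near=> e.
  rewrite [X in _ <= _ * X]ger0_norm ?powR_ge0//.
  apply: le_trans (ler_normD _ _) _; rewrite mulr_natl mulr2n.
  rewrite lerD//; last by near: e.
  rewrite normrM -[N](addKr M) powRD; last first.
    apply/implyP => _; rewrite gt_eqF//; near: e; exact: gauge_gt0.
  by rewrite ler_pM// 1?addrC; near: e.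
Unshelve. all: by end_near. Qed.

HB.instance Definition _ :=
  isIdealr.Build mnet negligible_pred negligible_ideal.

Definition gnum := {ideal_quot negligible_pred}.

HB.instance Definition _ := GRing.ComNzRing.on gnum.

End Nets.

Section GeneralizedNumbers.
Context {R : realType} {rho : gauge R}.
Local Notation K := (gnum rho).
Implicit Types x y : K.

(* The class of a net, with the junk value 0 when the net is not moderate. *)
Definition gclass (xe : R -> R) : K := \pi_(K) (insubd (0 : mnet rho) xe).

Definition grep x : R -> R := val (repr x).

Definition represents x (xe : R -> R) := moderate rho xe /\ gclass xe = x.

Definition gle x y := exists xe ye,
  [/\ represents x xe, represents y ye &
      forall e, 0 < e <= 1 -> xe e <= ye e].

Definition glt x y := gle 0 (y - x) /\ exists z, z * (y - x) = 1.

Definition gabs x : K := gclass (fun e => `|grep x e|).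

Definition gmax x y : K := gclass (fun e => Num.max (grep x e) (grep y e)).

Definition gitv (a b : K) : set K := [set x | gle a x /\ gle x b].

End GeneralizedNumbers.

Notation "x <=~ y" := (gle x y) (at level 70, no associativity) : ring_scope.
Notation "x <~ y" := (glt x y) (at level 70, no associativity) : ring_scope.

(* The Euclidean norm; the library norm on 'rV[R]_n is the maximum norm. *)
Definition enorm (R : realType) n (x : 'rV[R]_n) : R :=
  Num.sqrt (\sum_i x 0 i ^+ 2).

(* Generalized points of R^n are the rows of generalized numbers: a net of
   vectors is moderate, resp. negligible, iff all its components are. *)
Section GeneralizedPoints.
Context {R : realType} {rho : gauge R}.
Local Notation K := (gnum rho).
Implicit Types n : nat.

Definition vrepresents n (x : 'rV[K]_n) (xe : R -> 'rV[R]_n) :=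
  forall i, represents (x 0 i) (fun e => xe e 0 i).

Definition gnorm n (x : 'rV[K]_n) : K :=
  gclass (fun e => enorm (\row_i grep (x 0 i) e)).

Definition gball n (c : 'rV[K]_n) (r : K) : set 'rV[K]_n :=
  [set x | gnorm (x - c) <~ r].

Definition sharp_interior n (X : set 'rV[K]_n) : set 'rV[K]_n :=
  [set x | exists2 r : K, 0 <~ r & gball x r `<=` X].

Definition strong_interior n (Omega : R -> set 'rV[R]_n) : set 'rV[K]_n :=
  [set x | forall xe, vrepresents x xe ->
     \forall e \near (0 : R)^'+, Omega e (xe e)].

End GeneralizedPoints.

(* A multi-index is given as a word of coordinates: for s = [:: i1; ...; im],
   this is d_i1 (... (d_im f)). *)
Definition iter_partial (R : realType) n k (s : seq 'I_n)
    (f : 'rV[R]_n -> 'rV[R]_k) : 'rV[R]_n -> 'rV[R]_k :=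
  foldr (fun i g => 'D_(delta_mx 0 i) g) f s.

(* Differentiability (in the sense of Frechet) of all the iterated partial
   derivatives also yields their continuity. *)
Definition smooth_on (R : realType) n k (Omega : set 'rV[R]_n)
    (f : 'rV[R]_n -> 'rV[R]_k) :=
  forall s x, Omega x -> differentiable (iter_partial s f) x.

Section GeneralizedSmoothFunctions.
Context {R : realType} {rho : gauge R}.
Local Notation K := (gnum rho).
Implicit Types n k : nat.

Definition defines n k (X : set 'rV[K]_n) (Omega : R -> set 'rV[R]_n)
    (fe : R -> 'rV[R]_n -> 'rV[R]_k) (f : 'rV[K]_n -> 'rV[K]_k) :=
  [/\ forall e, 0 < e <= 1 -> open (Omega e) /\ smooth_on (Omega e) (fe e),
      X `<=` strong_interior Omega &
      forall x xe, X x -> vrepresents x xe ->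
        vrepresents (f x) (fun e => fe e (xe e)) /\
        forall s, moderate rho (fun e => enorm (iter_partial s (fe e) (xe e)))].

(* Maps on X are total functions whose values outside X are irrelevant. *)
Definition GCinf n k (X : set 'rV[K]_n) (Y : set 'rV[K]_k)
    (f : 'rV[K]_n -> 'rV[K]_k) :=
  f @` X `<=` Y /\ exists Omega fe, defines X Omega fe f.

Definition is_interior_gderivative n k (X : set 'rV[K]_n)
    (f : 'rV[K]_n -> 'rV[K]_k) (s : seq 'I_n) x (y : 'rV[K]_k) :=
  sharp_interior X x /\
  exists Omega fe xe, [/\ defines X Omega fe f, vrepresents x xe &
    vrepresents y (fun e => iter_partial s (fe e) (xe e))].

(* At the points of X which are not sharply interior (for an interval these are
   the two endpoints, but also the points which agree with an endpoint only
   along a set of parameters accumulating at 0), the derivative is the sharp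
   limit of the derivatives at the interior points of X. *)
Definition is_gderivative n k (X : set 'rV[K]_n)
    (f : 'rV[K]_n -> 'rV[K]_k) (s : seq 'I_n) x (y : 'rV[K]_k) :=
  is_interior_gderivative X f s x y \/
  ~ sharp_interior X x /\
  forall r : K, 0 <~ r -> exists2 q : K, 0 <~ q &
    forall z w, gball x q z -> is_interior_gderivative X f s z w ->
      gball y r w.

Definition gderivative n k (X : set 'rV[K]_n) (f : 'rV[K]_n -> 'rV[K]_k)
    (s : seq 'I_n) (x : 'rV[K]_n) : 'rV[K]_k :=
  xget 0 [set y | is_gderivative X f s x y].

End GeneralizedSmoothFunctions.

Section OneVariable.
Context {R : realType} {rho : gauge R}.
Local Notation K := (gnum rho).
Implicit Types (k m : nat) (a b : K).

Definition gitv1 a b : set 'rV[K]_1 := [set x | gitv a b (x 0 0)].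

Definition of_curve k (u : K -> 'rV[K]_k) : 'rV[K]_1 -> 'rV[K]_k :=
  fun x => u (x 0 0).

Definition GCinf_curve k a b (u : K -> 'rV[K]_k) :=
  GCinf (gitv1 a b) setT (of_curve u).

Definition curve_derivative k a b m (u : K -> 'rV[K]_k) (t : K) : 'rV[K]_k :=
  gderivative (gitv1 a b) (of_curve u) (nseq m 0) (const_mx t).

(* Meant for a < b, so that ae e < be e for e small. *)
Definition is_gintegral a b (f : K -> K) (y : K) :=
  exists Omega fe ae be,
    [/\ defines (gitv1 a b) Omega fe
          (of_curve (fun t => const_mx (f t) : 'rV[K]_1)),
        represents a ae, represents b be &
        represents y (fun e =>
          \int[lebesgue_measure]_(t in `[ae e, be e])
            (fe e (const_mx t) 0 0 : R))].

Definition gintegral a b (f : K -> K) : K :=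
  xget 0 [set y | is_gintegral a b f y].

Definition attains_max a b (f : K -> K) (M : K) :=
  gitv a b M /\ forall t, gitv a b t -> f t <=~ f M.

Definition attains_min a b (f : K -> K) (M : K) :=
  gitv a b M /\ forall t, gitv a b t -> f M <=~ f t.

Definition is_Cnorm k a b m (v : K -> 'rV[K]_k) (N : K) :=
  let dv n i t := curve_derivative a b n v t 0 i in
  exists M1 M2 : nat -> 'I_k -> K,
    [/\ forall n i, (n <= m)%N -> attains_max a b (dv n i) (M1 n i),
        forall n i, (n <= m)%N -> attains_min a b (dv n i) (M2 n i) &
        N = \big[gmax/0]_(n < m.+1) \big[gmax/0]_(i < k)
              gmax (gabs (dv n i (M1 n i))) (gabs (dv n i (M2 n i)))].

Definition Cnorm k a b m (v : K -> 'rV[K]_k) : K :=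
  xget 0 [set N | is_Cnorm a b m v N].

Definition GCbd k a b (p q : 'rV[K]_k) : set (K -> 'rV[K]_k) :=
  [set v | [/\ GCinf_curve a b v, v a = p & v b = q]].

Definition Cball k a b m (u : K -> 'rV[K]_k) (r : K) : set (K -> 'rV[K]_k) :=
  [set v | GCinf_curve a b v /\ Cnorm a b m (v - u) <~ r].

Definition local_minimizer k a b (I : (K -> 'rV[K]_k) -> K)
    (p q : 'rV[K]_k) (u : K -> 'rV[K]_k) :=
  GCbd a b p q u /\ exists r m, 0 <~ r /\
    forall v, Cball a b m u r v -> GCbd a b p q v -> I u <=~ I v.

End OneVariable.

Section Lagrangians.
Context {R : realType} {rho : gauge R}.
Local Notation K := (gnum rho).
Variable d : nat.
Implicit Types (a b : K) (F : K -> 'rV[K]_d -> 'rV[K]_d -> K).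

(* The triple (t, u, u') as a point of R^(1 + (d + d)). *)
Definition jet (t : K) (u u' : 'rV[K]_d) : 'rV[K]_(1 + (d + d)) :=
  row_mx (const_mx t) (row_mx u u').

Definition lagrangian_domain a b : set 'rV[K]_(1 + (d + d)) :=
  [set z | exists t u u', gitv a b t /\ z = jet t u u'].

Definition of_lagrangian F : 'rV[K]_(1 + (d + d)) -> 'rV[K]_1 :=
  fun z => const_mx (F (lsubmx z 0 0) (lsubmx (rsubmx z)) (rsubmx (rsubmx z))).

Definition GCinf_lagrangian a b F :=
  GCinf (lagrangian_domain a b) setT (of_lagrangian F).

Definition action_functional a b F (u : K -> 'rV[K]_d) : K :=
  gintegral a b (fun t => F t (u t) (curve_derivative a b 1 u t)).

Definition velocity_index (i : 'I_d) : 'I_(1 + (d + d)) :=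
  rshift 1 (rshift d i).

Definition velocity_hessian a b F (i j : 'I_d) (t : K) (u u' : 'rV[K]_d) : K :=
  gderivative (lagrangian_domain a b) (of_lagrangian F)
    [:: velocity_index i; velocity_index j] (jet t u u') 0 0.

End Lagrangians.

(* Main.v *)
(* Suppose that the Legendre form is below -rho^N0 at points t0 for arbitrarily
   small e.  Perturb u by sg A exp(-((t - c) k)^2) cos(w (t - c)) lambda and by the
   same with sin, for sg = 1 and sg = -1, where c is close to t0 but not too close to
   the endpoints, and k, w and 1/A are powers of 1/rho, each much larger than the
   previous one.  All four perturbations are admissible: the Gaussian is negligible
   at the endpoints, so that the boundary values are unchanged as generalized
   numbers, and A is small enough for any C^m norm.  Since cos^2 + sin^2 = 1, the sum
   of the two second differences of the Lagrangian is, up to lower order terms,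
   A^2 w^2 exp(-2((t - c) k)^2) times the Legendre form, with no oscillation left.
   It is negative near t0, and elsewhere the Gaussian is negligible, so its integral
   is below -rho^X for some X, whereas minimality makes it greater than -rho^P for
   every P. *)
From HB Require Import structures.
Require Import Defs.
From mathcomp Require Import all_boot all_order all_algebra.
From mathcomp Require Import all_classical all_reals all_analysis.
From mathcomp Require Import lra ring.
Import Defs.
Set Implicit Arguments.
Unset Strict Implicit.
Unset Printing Implicit Defensive.
Import Order.TTheory GRing.Theory Num.Theory.
Import numFieldNormedType.Exports.
Local Open Scope classical_set_scope.
Local Open Scope quotient_scope.
Local Open Scope ring_scope.

(** * Representatives of generalized numbers *)

Section GnumApi.
Context {R : realType} {rho : gauge R}.
Local Notation K := (gnum rho).
Local Notation small := ((0 : R)^'+).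
Implicit Types (x y z : K) (xe ye : R -> R).

(** The obstacle is that the order is not total and that [gderivative], [gintegral] and [Cnorm] are
    defined by choice, so every notion has to be reduced to real nets before analysis can start. Two
    facts carry this reduction. A bound that holds along every net of points of moderate size holds
    uniformly, with one exponent. A net of smooth functions that is negligible at all points of a
    slab has negligible partial derivatives there, so derivatives can be computed from any defining
    net, also at points that are not sharply interior.

    The signs 1 and -1 cancel the first variation and leave a second difference. The frequency [w]
    exceeds [k^2], so that the velocity of the perturbation dominates its position and only the
    velocity block of the Hessian survives.

    Minimality compares whole nets, so the perturbations are built for all [e] at once, and the
    contradiction is drawn at each [e] separately. The order of the choices matters: the admissible
    size of [A] depends on the derivatives of the bumps up to the order [m] of the norm, so [c], [k]
    and [w] are fixed before [A]. *)

Lemma moderate_in xe : moderate rho xe -> xe \in moderate_pred rho.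
Proof. by move=> h; apply/asboolP. Qed.

Lemma gclassE xe (h : moderate rho xe) :
  gclass xe = \pi_(K) (MNet (moderate_in h)).
Proof.
rewrite /gclass; congr (\pi_(K) _); apply: val_inj; rewrite val_insubd.
by rewrite moderate_in.
Qed.

Lemma represents_gclass xe : moderate rho xe -> represents (gclass xe : K) xe.
Proof. by []. Qed.

Lemma moderate_grep x : moderate rho (grep x).
Proof. by rewrite /grep; case: (repr x) => u /= /asboolP. Qed.

Lemma represents_grep x : represents x (grep x).
Proof.
split; first exact: moderate_grep.
rewrite (gclassE (moderate_grep x)) -[RHS](@reprK _ K).
by congr (\pi_(K) _); apply: val_inj.
Qed.

Lemma representsP x xe (m : mnet rho) :
  val m = xe -> x = \pi_(K) m -> represents x xe.
Proof.
move=> <- ->; have mm : moderate rho (val m) by case: m => u /= /asboolP.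
by split => //; rewrite (gclassE mm); congr (\pi_(K) _); apply: val_inj.
Qed.

Lemma representsE x xe : represents x xe ->
  exists2 m : mnet rho, val m = xe & x = \pi_(K) m.
Proof.
by move=> [m <-]; exists (MNet (moderate_in m)) => //; rewrite (gclassE m).
Qed.

Lemma represents_negligible x xe ye : represents x xe -> represents x ye ->
  negligible rho (fun e => xe e - ye e).
Proof.
move=> /representsE[m <- ->] /representsE[n <-] /eqP.
by rewrite -Quotient.idealrBE => /asboolP.
Qed.

Lemma negligible_moderate xe : negligible rho xe -> moderate rho xe.
Proof.
move=> /negligibleP/(_ 1 ltr01) h; apply/moderateP; exists 1 => //.
have := @le_gauge_powR R rho (-1) 1 ltac:(lra).
by apply: filterS2 h => e; exact: le_trans.
Qed.

Lemma moderateD xe ye : moderate rho xe -> moderate rho ye ->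
  moderate rho (fun e => xe e + ye e).
Proof.
move=> /moderate_in hx /moderate_in hy; apply/asboolP.
exact: (rpredD hx hy).
Qed.

Lemma moderateM xe ye : moderate rho xe -> moderate rho ye ->
  moderate rho (fun e => xe e * ye e).
Proof.
move=> /moderate_in hx /moderate_in hy; apply/asboolP.
exact: (rpredM hx hy).
Qed.

Lemma moderateN xe : moderate rho xe -> moderate rho (fun e => - xe e).
Proof.
move=> /moderate_in hx; rewrite -(rpredN (moderate_pred rho)) in hx.
by apply/asboolP; exact: hx.
Qed.

Lemma represents_congr x xe ye : represents x xe ->
  negligible rho (fun e => ye e - xe e) -> represents x ye.
Proof.
move=> [xm <-] h.
have ym : moderate rho ye.
  have := moderateD (negligible_moderate h) xm.
  by congr (moderate _ _); apply/funext => e; rewrite subrK.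
split=> //; rewrite (gclassE xm) (gclassE ym); apply/eqP.
by rewrite -Quotient.idealrBE; apply/asboolP.
Qed.

Lemma eq_represents x xe ye : represents x xe ->
  (\forall e \near small, xe e = ye e) -> represents x ye.
Proof.
move=> h xy; apply: represents_congr h _; apply/negligibleP => N N0.
by apply: filterS xy => e ->; rewrite subrr normr0 powR_ge0.
Qed.

Lemma represents_inj x y xe : represents x xe -> represents y xe -> x = y.
Proof. by move=> [_ <-] [_ <-]. Qed.

Lemma represents_eq x y xe ye : represents x xe -> represents y ye ->
  negligible rho (fun e => xe e - ye e) -> x = y.
Proof.
move=> hx hy /(represents_congr hy); exact: represents_inj.
Qed.

Lemma representsD x y xe ye : represents x xe -> represents y ye ->
  represents (x + y) (fun e => xe e + ye e).
Proof.
move=> /representsE[m <- ->] /representsE[n <- ->].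
by apply: (@representsP _ _ (m + n)) => //; rewrite -rmorphD.
Qed.

Lemma representsM x y xe ye : represents x xe -> represents y ye ->
  represents (x * y) (fun e => xe e * ye e).
Proof.
move=> /representsE[m <- ->] /representsE[n <- ->].
by apply: (@representsP _ _ (m * n)) => //; rewrite -rmorphM.
Qed.

Lemma representsN x xe : represents x xe -> represents (- x) (fun e => - xe e).
Proof.
move=> /representsE[m <- ->].
by apply: (@representsP _ _ (- m)) => //; rewrite -rmorphN.
Qed.

Lemma representsB x y xe ye : represents x xe -> represents y ye ->
  represents (x - y) (fun e => xe e - ye e).
Proof. by move=> hx hy; exact: representsD hx (representsN hy). Qed.

Lemma represents0 : represents (0 : K) (fun=> 0).
Proof. by apply: (@representsP _ _ 0) => //; rewrite rmorph0. Qed.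

Lemma represents1 : represents (1 : K) (fun=> 1).
Proof. by apply: (@representsP _ _ 1) => //; rewrite rmorph1. Qed.

Lemma represents_sum n (x : 'I_n -> K) (xe : 'I_n -> R -> R) :
  (forall i, represents (x i) (xe i)) ->
  represents (\sum_i x i) (fun e => \sum_i xe i e).
Proof.
elim: n x xe => [|n IH] x xe h.
  rewrite big_ord0 (_ : (fun _ => _) = fun=> 0); first exact: represents0.
  by apply/funext => e; rewrite big_ord0.
rewrite big_ord_recl (_ : (fun _ => _) = fun e => xe ord0 e +
  \sum_i xe (lift ord0 i) e); first by apply: representsD => //; exact: IH.
by apply/funext => e; rewrite big_ord_recl.
Qed.


Lemma moderate_le xe ye : moderate rho ye ->
  (\forall e \near small, `|xe e| <= `|ye e|) -> moderate rho xe.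
Proof.
move=> /moderateP[N N0 yN] xy; apply/moderateP; exists N => //.
by apply: filterS2 xy yN => e; exact: le_trans.
Qed.

Lemma moderate_powR (N : R) : moderate rho (fun e => rho e `^ N).
Proof.
apply/moderateP; exists (`|N| + 1); first by rewrite ltr_wpDl.
have h : - (`|N| + 1) <= N.
  by rewrite lerNl; apply: (@le_trans _ _ `|N|); [rewrite -normrN ler_norm|rewrite lerDl].
by apply: filterS (le_gauge_powR rho h) => e; rewrite (ger0_norm (powR_ge0 _ _)).
Qed.

Lemma ev_gauge01 : \forall e \near small, 0 < rho e < 1.
Proof. by apply: filterS2 (gauge_gt0 rho) (gauge_lt rho ltr01) => e -> ->. Qed.

Lemma ev_powR_le (N c : R) : 0 < N -> 0 < c ->
  \forall e \near small, rho e `^ N <= c.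
Proof.
move=> N0 c0; have c1 : 0 < c `^ N^-1 by rewrite powR_gt0.
apply: filterS2 (gauge_gt0 rho) (gauge_lt rho c1) => e e0 /ltW ec.
rewrite -[leRHS](powRr1 (ltW c0)) -(mulVf (lt0r_neq0 N0)) powRrM.
by apply: ge0_ler_powR; rewrite ?nnegrE ?powR_ge0 ?(ltW N0) ?(ltW e0).
Qed.

Lemma moderate_cst (c : R) : moderate rho (fun=> c).
Proof.
apply/moderateP; exists 1 => //; have [->|c0] := eqVneq c 0.
  by apply: nearW => e; rewrite normr0 powR_ge0.
have := @ev_powR_le 1 `|c|^-1 ltr01 _; rewrite invr_gt0 normr_gt0 => /(_ c0).
apply: filterS2 (gauge_gt0 rho) => e e0.
rewrite powRN (powRr1 (ltW e0)) => h.
by rewrite -[leLHS]invrK lef_pV2// posrE invr_gt0 normr_gt0.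
Qed.

Lemma moderate_sum n (xe : 'I_n -> R -> R) : (forall i, moderate rho (xe i)) ->
  moderate rho (fun e => \sum_i xe i e).
Proof.
move=> h.
by have [] := @represents_sum n (fun i => gclass (xe i)) xe (fun i => represents_gclass (h i)).
Qed.

Lemma represents_moderate x xe : represents x xe -> moderate rho xe.
Proof. by case. Qed.

Lemma negligibleMl xe ye : moderate rho xe -> negligible rho ye ->
  negligible rho (fun e => xe e * ye e).
Proof.
move=> hx hy; have h0 : represents (0 : K) ye.
  apply: (represents_congr represents0); congr (negligible _ _): hy.
  by apply/funext => e; rewrite subr0.
have := represents_negligible (representsM (represents_gclass hx) h0)
  (representsM (represents_gclass hx) represents0).
by congr (negligible _ _); apply/funext => e; rewrite mulr0 subr0.
Qed.

Lemma negligibleD xe ye : negligible rho xe -> negligible rho ye ->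
  negligible rho (fun e => xe e + ye e).
Proof.
move=> hx hy.
have h (ze : R -> R) : negligible rho ze -> represents (0 : K) ze.
  move=> hz; apply: (represents_congr represents0); congr (negligible _ _): hz.
  by apply/funext => e; rewrite subr0.
have := represents_negligible (representsD (h _ hx) (h _ hy)) (representsD represents0 represents0).
by congr (negligible _ _); apply/funext => e; rewrite addr0 subr0.
Qed.

Lemma negligible_le xe ye : negligible rho ye ->
  (\forall e \near small, `|xe e| <= `|ye e|) -> negligible rho xe.
Proof.
move=> /negligibleP h xy; apply/negligibleP => N N0.
by apply: filterS2 xy (h N N0) => e; exact: le_trans.
Qed.

Lemma negligible0 : negligible rho (fun=> 0).
Proof.
by apply/negligibleP => N N0; apply: nearW => e; rewrite normr0 powR_ge0.
Qed.

Lemma negligible_sum n (xe : 'I_n -> R -> R) : (forall i, negligible rho (xe i)) ->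
  negligible rho (fun e => \sum_i xe i e).
Proof.
elim: n xe => [|n IH] xe h.
  by apply: (negligible_le negligible0); apply: nearW => e; rewrite big_ord0.
apply: (negligible_le (negligibleD (h ord0) (IH _ (fun i => h (lift ord0 i))))).
by apply: nearW => e; rewrite big_ord_recl.
Qed.

Lemma negligible_abs xe : negligible rho xe -> negligible rho (fun e => `|xe e|).
Proof. by move=> h; apply: (negligible_le h); apply: nearW => e; rewrite normr_id. Qed.

Lemma powRD_small (M N : R) :
  \forall e \near small, rho e `^ (M + N) = rho e `^ M * rho e `^ N.
Proof.
by apply: filterS (gauge_gt0 rho) => e e0; rewrite powRD// (gt_eqF e0) implybT.
Qed.

(** How constants are disposed of throughout: a spare unit in the exponent absorbs them once [rho e]
    is small. *)
Lemma powR2_small (N : R) :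
  \forall e \near small, 2 * rho e `^ (N + 1) <= rho e `^ N.
Proof.
near=> e; have -> : rho e `^ (N + 1) = rho e `^ N * rho e `^ 1.
  by near: e; exact: powRD_small.
have : rho e `^ 1 <= 2^-1 by near: e; apply: ev_powR_le; rewrite // invr_gt0.
move=> h; rewrite mulrCA ler_piMr ?powR_ge0//.
by move: h; set y := _ `^ _; lra.
Unshelve. all: by end_near. Qed.

Lemma add1_powR_small (M : R) : 0 < M ->
  \forall e \near small, 1 + rho e `^ (- M) <= rho e `^ (- (M + 1)).
Proof.
move=> M0; near=> e; apply: (@le_trans _ _ (2 * rho e `^ (- M))).
  suff : 1 <= rho e `^ (- M) by lra.
  by rewrite -(powRr0 (rho e)); near: e; apply: le_gauge_powR; rewrite oppr_le0 ltW.
rewrite (_ : - M = - (M + 1) + 1); last by lra.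
by near: e; exact: powR2_small.
Unshelve. all: by end_near. Qed.

(** The defining pair of representatives differs from any other pair by negligible nets, whence the
    defect [rho e ^ N]. Conversely, the maximum of [xe] and [ye] is again a representative of [y],
    and it lies above [xe] for every [e]. *)
Lemma gle_ev x y xe ye : represents x xe -> represents y ye ->
  x <=~ y <-> forall N, 0 < N ->
    \forall e \near small, xe e <= ye e + rho e `^ N.
Proof.
move=> hx hy; split=> [[ue [ve [hu hv uv]]] N N0|h].
- have /negligibleP/(_ (N + 1) ltac:(lra)) xu := represents_negligible hx hu.
  have /negligibleP/(_ (N + 1) ltac:(lra)) vy := represents_negligible hv hy.
  near=> e.
  have e01 : 0 < e <= 1.
    by apply/andP; split; near: e; [exact: nbhs_right_gt|exact: nbhs_right_le].
  have := uv e e01.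
  have : `|xe e - ue e| <= rho e `^ (N + 1) by near: e.
  have : `|ve e - ye e| <= rho e `^ (N + 1) by near: e.
  have : 2 * rho e `^ (N + 1) <= rho e `^ N by near: e; exact: powR2_small.
  by rewrite !ler_norml; lra.
- exists xe, (fun e => Num.max (xe e) (ye e)); split=> //; last first.
    by move=> e _; rewrite le_max lexx.
  apply: (represents_congr hy); apply/negligibleP => N N0.
  apply: filterS (h N N0) => e; have := powR_ge0 (rho e) N.
  by rewrite /Num.max; case: ifPn; rewrite ?subrr ?normr0// -?leNgt ler_norml; lra.
Unshelve. all: by end_near. Qed.

Lemma gle_ev0 x xe : represents x xe ->
  0 <=~ x <-> forall N, 0 < N -> \forall e \near small, - rho e `^ N <= xe e.
Proof.
move=> hx; rewrite (gle_ev represents0 hx).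
by split=> h N N0; apply: filterS (h N N0) => e; lra.
Qed.

(** Invertibility produces the power: the inverse is at most [rho^-M], so the difference cannot be
    smaller than [rho^(M + 1)] in absolute value, and non-negativity up to that same power decides
    its sign. Conversely, a lower bound by a power makes the pointwise inverse moderate. *)
Lemma glt_ev x y xe ye : represents x xe -> represents y ye ->
  x <~ y <-> exists2 N, 0 < N &
    \forall e \near small, xe e + rho e `^ N <= ye e.
Proof.
move=> hx hy; have hyx := representsB hy hx; split.
- move=> [/(gle_ev0 hyx) h0 [z zyx]].
  have hz := represents_grep z.
  have := representsM hz hyx; rewrite zyx => /(represents_negligible represents1).
  move=> /negligibleP/(_ 1 ltr01) h1.
  have /moderateP[M M0 zM] := represents_moderate hz.
  exists (M + 1); first lra.
  near=> e; rewrite -lerBrDl.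
  have r0 : 0 < rho e by near: e; exact: gauge_gt0.
  have k1 : `|1 - grep z e * (ye e - xe e)| <= rho e `^ 1 by near: e.
  rewrite (powRr1 (ltW r0)) in k1.
  have r4 : rho e < 4^-1 by near: e; apply: gauge_lt; lra.
  have k2 : `|grep z e| <= rho e `^ (- M) by near: e.
  have k3 : - rho e `^ (M + 1) <= ye e - xe e.
    by near: e; apply: h0; lra.
  have k4 : rho e `^ (M + 1) = rho e `^ M * rho e.
    by rewrite powRD ?(gt_eqF r0) ?implybT// (powRr1 (ltW r0)).
  have k5 : rho e `^ M * rho e `^ (- M) = 1.
    by rewrite powRN divff// gt_eqF// powR_gt0.
  have p0 : 0 < rho e `^ M by rewrite powR_gt0.
  move: k1 k2 k3; rewrite powRN k4.
  move: p0 (ye e - xe e) (grep z e); set p := _ `^ _ => p0 w ze k1 k2 k3.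
    rewrite leNgt; apply/negP => wlt.
  have : `|ze * w| <= p^-1 * (p * 4^-1).
    rewrite normrM ler_pM// ler_norml; nra.
  rewrite mulKf ?gt_eqF//; move: k1; rewrite !ler_norml; lra.
- move=> [N N0 h]; split.
    apply/(gle_ev0 hyx) => M M0; apply: filterS h => e.
    by have := powR_ge0 (rho e) N; have := powR_ge0 (rho e) M; lra.
  have m : moderate rho (fun e => (ye e - xe e)^-1).
    apply/moderateP; exists N => //.
    apply: filterS2 (gauge_gt0 rho) h => e e0 h.
    have p0 : 0 < rho e `^ N by rewrite powR_gt0.
    by rewrite powRN normfV lef_pV2 ?posrE ?normr_gt0// ?gtr0_norm; lra.
  exists (gclass (fun e => (ye e - xe e)^-1)).
  apply: represents_inj represents1.
  apply: eq_represents (representsM (represents_gclass m) hyx) _.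
  apply: filterS2 (gauge_gt0 rho) h => e e0 h.
  have p0 : 0 < rho e `^ N by rewrite powR_gt0.
  by rewrite mulVf//; lra.
Unshelve. all: by end_near. Qed.

Lemma represents_abs x xe : represents x xe ->
  represents (gabs x) (fun e => `|xe e|).
Proof.
move=> hx; have hg := represents_grep x.
have m : moderate rho (fun e => `|grep x e|).
  by apply: (moderate_le (represents_moderate hg)); apply: nearW => e; rewrite normr_id.
apply: (represents_congr (represents_gclass m)).
apply: (negligible_le (represents_negligible hx hg)).
by apply: nearW => e; exact: ler_dist_dist.
Qed.

Lemma represents_max x y xe ye : represents x xe -> represents y ye ->
  represents (gmax x y) (fun e => Num.max (xe e) (ye e)).
Proof.
have h (ue ve : R -> R) : moderate rho ue -> moderate rho ve ->
    moderate rho (fun e => Num.max (ue e) (ve e)).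
  move=> mu mv.
  have mu' : moderate rho (fun e => `|ue e|).
    by apply: (moderate_le mu); apply: nearW => e; rewrite normr_id.
  have mv' : moderate rho (fun e => `|ve e|).
    by apply: (moderate_le mv); apply: nearW => e; rewrite normr_id.
  apply: (moderate_le (moderateD mu' mv')); apply: nearW => e.
  rewrite (ger0_norm (addr_ge0 (normr_ge0 _) (normr_ge0 _))) /Num.max.
  by case: ifP; rewrite ?lerDl ?lerDr ?normr_ge0.
move=> hx hy.
have m := h _ _ (moderate_grep x) (moderate_grep y).
apply: (represents_congr (represents_gclass m)).
have n1 := represents_negligible hx (represents_grep x).
have n2 := represents_negligible hy (represents_grep y).
apply/negligibleP => N N0.
move: n1 => /negligibleP/(_ _ N0) n1; move: n2 => /negligibleP/(_ _ N0) n2.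
apply: filterS2 n1 n2 => e; rewrite !ler_norml => /andP[a1 a2] /andP[b1 b2].
by rewrite /Num.max; do 2 (case: ifPn; rewrite -?leNgt => ?); apply/andP; split; lra.
Qed.

Lemma gmax_lt x y z : x <~ z -> y <~ z -> gmax x y <~ z.
Proof.
have hx := represents_grep x; have hy := represents_grep y.
have hz := represents_grep z.
move=> /(glt_ev hx hz)[M M0 xM] /(glt_ev hy hz)[N N0 yN].
apply/(glt_ev (represents_max hx hy) hz); exists (M + N); first exact: addr_gt0.
have h1 := @le_gauge_powR R rho M (M + N) ltac:(lra).
have h2 := @le_gauge_powR R rho N (M + N) ltac:(lra).
near=> e.
have : grep x e + rho e `^ M <= grep z e by near: e.
have : grep y e + rho e `^ N <= grep z e by near: e.
have : rho e `^ (M + N) <= rho e `^ M by near: e.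
have : rho e `^ (M + N) <= rho e `^ N by near: e.
by rewrite /Num.max; case: ifP => _; lra.
Unshelve. all: by end_near. Qed.

Lemma big_gmax_lt n (x : 'I_n -> K) z : 0 <~ z -> (forall i, x i <~ z) ->
  \big[@gmax R rho/0]_(i < n) x i <~ z.
Proof.
move=> z0 h; apply: (big_ind (fun y => y <~ z)) => // ? ?; exact: gmax_lt.
Qed.

Lemma vrepresents_grep n (x : 'rV[K]_n) :
  vrepresents x (fun e => \row_i grep (x 0 i) e).
Proof.
move=> i; rewrite (_ : (fun _ => _) = grep (x 0 i)); first exact: represents_grep.
by apply/funext => e; rewrite mxE.
Qed.

Lemma enorm_ge n (v : 'rV[R]_n) i : `|v 0 i| <= enorm v.
Proof.
rewrite /enorm -sqrtr_sqr ler_sqrt; last by apply: sumr_ge0 => j _; exact: sqr_ge0.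
by rewrite (bigD1 i)//= lerDl; apply: sumr_ge0 => j _; exact: sqr_ge0.
Qed.


Lemma enorm_le_sum n (v : 'rV[R]_n) : enorm v <= \sum_i `|v 0 i|.
Proof.
have s0 : 0 <= \sum_i `|v 0 i| by apply: sumr_ge0.
rewrite -[leRHS]ger0_norm// -sqrtr_sqr ler_sqrt ?sqr_ge0//.
rewrite expr2 mulr_suml; apply: ler_sum => i _.
rewrite -real_normK ?num_real// expr2 ler_wpM2l//.
by rewrite (bigD1 i)//= lerDl; apply: sumr_ge0.
Qed.

Lemma moderate_enorm n (v : R -> 'rV[R]_n) :
  moderate rho (fun e => enorm (v e)) <->
  forall i, moderate rho (fun e => v e 0 i).
Proof.
split=> [h i|h].
  apply: (moderate_le h); apply: nearW => e; apply: (le_trans (enorm_ge _ i)).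
  exact: ler_norm.
have h' : forall i, moderate rho (fun e => `|v e 0 i|).
  by move=> i; apply: (moderate_le (h i)); apply: nearW => e; rewrite normr_id.
apply: (moderate_le (moderate_sum h')); apply: nearW => e.
rewrite ger0_norm ?sqrtr_ge0//; apply: (le_trans (enorm_le_sum _)).
exact: ler_norm.
Qed.

Lemma moderate_gnorm n (x : 'rV[K]_n) :
  moderate rho (fun e => enorm (\row_i grep (x 0 i) e)).
Proof.
apply/moderate_enorm => i; have [+ _] := vrepresents_grep x i.
by [].
Qed.


Lemma vrepresentsB n (x y : 'rV[K]_n) (xe ye : R -> 'rV[R]_n) :
  vrepresents x xe -> vrepresents y ye ->
  vrepresents (x - y) (fun e => xe e - ye e).
Proof.
move=> hx hy i; rewrite !mxE (_ : (fun e => _) = fun e => xe e 0 i - ye e 0 i).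
  exact: representsB.
by apply/funext => e; rewrite !mxE.
Qed.

Lemma vrepresents_congr n (x : 'rV[K]_n) (xe ye : R -> 'rV[R]_n) :
  vrepresents x xe ->
  (forall i, negligible rho (fun e => ye e 0 i - xe e 0 i)) ->
  vrepresents x ye.
Proof. by move=> hx h i; exact: represents_congr (hx i) (h i). Qed.

Lemma vrepresents_inj n (x y : 'rV[K]_n) (xe : R -> 'rV[R]_n) :
  vrepresents x xe -> vrepresents y xe -> x = y.
Proof. by move=> hx hy; apply/rowP => i; exact: represents_inj (hx i) (hy i). Qed.

Lemma vrepresents_class n (xe : R -> 'rV[R]_n) :
  (forall i, moderate rho (fun e => xe e 0 i)) ->
  vrepresents (\row_i (gclass (fun e => xe e 0 i) : K)) xe.
Proof. by move=> h i; rewrite mxE; exact: represents_gclass. Qed.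

Lemma gball_lt n (c x : 'rV[K]_n) r (xe ce : R -> 'rV[R]_n) re : gball c r x ->
  vrepresents x xe -> vrepresents c ce -> represents r re ->
  \forall e \near small, forall i, `|xe e 0 i - ce e 0 i| <= re e.
Proof.
move=> h hx hc hr.
have [N N0 h1] := (glt_ev (represents_gclass (moderate_gnorm (x - c))) hr).1 h.
apply: filter_forall => i.
have := represents_negligible (vrepresentsB hx hc i) (vrepresents_grep (x - c) i).
move=> /negligibleP/(_ N N0); apply: filterS2 h1 => e h1; rewrite [X in `|X - _|]mxE [X in `|_ + X - _|]mxE.
have := enorm_ge (\row_j grep ((x - c) 0 j) e) i.
move: h1; set A := enorm _; set B := (\row_j _) 0 i; rewrite !ler_norml; lra.
Qed.

Lemma powR_absorb (c N : R) : 0 <= c ->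
  \forall e \near small, c * rho e `^ (N + 1) <= rho e `^ N.
Proof.
move=> c0; have c1 : 0 < (c + 1)^-1 by rewrite invr_gt0; lra.
near=> e; have -> : rho e `^ (N + 1) = rho e `^ N * rho e `^ 1.
  by near: e; exact: powRD_small.
have h : rho e `^ 1 <= (c + 1)^-1 by near: e; apply: ev_powR_le.
rewrite mulrCA ler_piMr ?powR_ge0//.
apply: (@le_trans _ _ ((c + 1) * rho e `^ 1)).
  by rewrite ler_wpM2r ?powR_ge0//; lra.
by rewrite -ler_pdivlMl ?mulr1//; lra.
Unshelve. all: by end_near. Qed.

(** Of the two extra powers of [rho], one pays for passing to the representatives chosen in [gnorm],
    the other for the factor [n] between the Euclidean norm and the coordinates. *)
Lemma gball_of n (c x : 'rV[K]_n) r (xe ce : R -> 'rV[R]_n) re N : 0 < N ->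
  vrepresents x xe -> vrepresents c ce -> represents r re ->
  (\forall e \near small, rho e `^ N <= re e) ->
  (\forall e \near small, forall i, `|xe e 0 i - ce e 0 i| <= rho e `^ (N + 1 + 1)) ->
  gball c r x.
Proof.
move=> N0 hx hc hr rN h.
apply/(glt_ev (represents_gclass (moderate_gnorm (x - c))) hr).
exists (N + 1 + 1); first by rewrite !addr_gt0.
have hn : \forall e \near small, forall i,
    `|(xe e - ce e) 0 i - (\row_j grep ((x - c) 0 j) e) 0 i| <= rho e `^ (N + 1 + 1).
  apply: filter_forall => i.
  have := represents_negligible (vrepresentsB hx hc i) (vrepresents_grep (x - c) i).
  by move=> /negligibleP; apply; rewrite !addr_gt0.
near=> e.
have h1 : forall i, `|xe e 0 i - ce e 0 i| <= rho e `^ (N + 1 + 1) by near: e.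
have h2 : forall i, `|(xe e - ce e) 0 i - (\row_j grep ((x - c) 0 j) e) 0 i| <= rho e `^ (N + 1 + 1).
  by near: e.
have h3 : rho e `^ N <= re e by near: e.
have h4 : 2 * rho e `^ (N + 1 + 1) <= rho e `^ (N + 1).
  by near: e; exact: powR2_small.
have h5 : (n%:R + 1) * rho e `^ (N + 1) <= rho e `^ N.
  by near: e; apply: powR_absorb; rewrite addr_ge0.
have hb i : `|(\row_j grep ((x - c) 0 j) e) 0 i| <= rho e `^ (N + 1).
  have := h1 i; have := h2 i; rewrite [X in `|X - _|]mxE [X in `|_ + X - _|]mxE.
  by set B := (\row_j _) 0 i; rewrite !ler_norml; move: h4; lra.
have := enorm_le_sum (\row_j grep ((x - c) 0 j) e); set A := enorm _ => hA.
have : A <= n%:R * rho e `^ (N + 1).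
  apply: (le_trans hA); apply: (le_trans (ler_sum _ (fun i _ => hb i))).
  by rewrite sumr_const card_ord mulr_natl.
have := powR_ge0 (rho e) (N + 1 + 1).
by move: h3 h4 h5; rewrite mulrDl mul1r; lra.
Unshelve. all: by end_near. Qed.

Lemma glt_gt0 (r : K) re : represents r re -> 0 <~ r ->
  exists2 N, 0 < N & \forall e \near small, rho e `^ N <= re e.
Proof.
move=> hr /(glt_ev represents0 hr)[N N0 h]; exists N => //.
by apply: filterS h => e; rewrite add0r.
Qed.

(** The Hausdorff property of the sharp topology, in the form used for the uniqueness of limits. *)
Lemma gball_sym_eq n (x y : 'rV[K]_n) :
  (forall r, 0 <~ r -> exists2 z, gball x r z & gball y r z) -> x = y.
Proof.
move=> h; have hx := vrepresents_grep x; have hy := vrepresents_grep y.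
apply/rowP => i; apply: (represents_eq (hx i) (hy i)).
apply/negligibleP => N N0.
have hr := represents_gclass (moderate_powR (N + 1)).
have r0 : 0 <~ (gclass (fun e => rho e `^ (N + 1)) : K).
  apply/(glt_ev represents0 hr); exists (N + 1); first lra.
  by apply: nearW => e; rewrite add0r.
have [z xz yz] := h _ r0; have hz := vrepresents_grep z.
have h1 := gball_lt xz hz hx hr; have h2 := gball_lt yz hz hy hr.
near=> e.
have h3 : 2 * rho e `^ (N + 1) <= rho e `^ N by near: e; exact: powR2_small.
have : forall i, `|(\row_i grep (z 0 i) e) 0 i - (\row_i grep (x 0 i) e) 0 i| <= rho e `^ (N + 1) by near: e.
have : forall i, `|(\row_i grep (z 0 i) e) 0 i - (\row_i grep (y 0 i) e) 0 i| <= rho e `^ (N + 1) by near: e.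
move=> /(_ i) + /(_ i); move: h3; set A := (\row_j _) 0 i; set B := (\row_j _) 0 i.
by set C := (\row_j _) 0 i; rewrite !ler_norml; lra.
Unshelve. all: by end_near. Qed.

End GnumApi.

(* Overspill: a bound along every selection of the sets B is uniform on B. *)
Lemma uniform_near (R : realType) (T : Type) (B : R -> set T) (x0 : R -> T)
    (P : R -> T -> Prop) :
  (forall z : R -> T, (forall e, B e (z e) \/ z e = x0 e) ->
    \forall e \near (0 : R)^'+, P e (z e)) ->
  \forall e \near (0 : R)^'+, forall y, B e y -> P e y.
Proof.
move=> h.
have /choice[z hz] : forall e, exists z, (B e z \/ z = x0 e) /\
    (P e z -> forall y, B e y -> P e y).
  move=> e; have [[y [By nPy]]|no] := pselect (exists y, B e y /\ ~ P e y).
    by exists y; split; [left|].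
  exists (x0 e); split; first by right.
  by move=> _ y By; apply: contrapT => nP; apply: no; exists y.
have := h z (fun e => (hz e).1); apply: filterS => e; exact: (hz e).2.
Qed.

(** Overspill for an exponent that may depend on the selection. At each [e] the selection takes a
    point where the largest bad exponent fails. If exponent [n] works along this selection, then by
    monotonicity no exponent from [n] on can be bad, so [n] works on all of [B]. *)
Lemma uniform_nat_near (R : realType) (T : Type) (B : R -> set T) (x0 : R -> T)
    (P : nat -> R -> T -> Prop) :
  (\forall e \near (0 : R)^'+, forall n y, P n e y -> P n.+1 e y) ->
  (forall z : R -> T, (forall e, B e (z e) \/ z e = x0 e) ->
    exists n, \forall e \near (0 : R)^'+, P n e (z e)) ->
  exists n, \forall e \near (0 : R)^'+, forall y, B e y -> P n e y.
Proof.
move=> mono h.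
(* The cap [Num.truncn e^-1] guarantees a largest bad exponent; as it grows without bound when [e]
   tends to 0, it eventually exceeds any fixed exponent. *)
pose bad (e : R) n := (n <= Num.truncn e^-1)%N &&
  `[< exists y, B e y /\ ~ P n e y >].
have /choice[z hz] : forall e, exists z, (B e z \/ z = x0 e) /\
    forall n y, (n <= Num.truncn e^-1)%N ->
      (forall k, P k e z -> P k.+1 e z) -> P n e z -> B e y -> P n e y.
  move=> e.
  have [ex|no] := pselect (exists n, bad e n); last first.
    exists (x0 e); split; first by right.
    move=> n y ne _ _ By; apply: contrapT => nP; apply: no; exists n.
    by rewrite /bad ne; apply/asboolP; exists y.
  have ub n : bad e n -> (n <= Num.truncn e^-1)%N by case/andP.
  case: (ex_maxnP ex ub) => m /andP[mk /asboolP[z [Bz nPz]]] mmax.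
  exists z; split; first by left.
  move=> n y nk mono_z Pnz By; apply: contrapT => nPy; apply: nPz.
  have nm : (n <= m)%N by apply: mmax; rewrite /bad nk; apply/asboolP; exists y.
  rewrite -(subnK nm); elim: (m - n)%N => // j IH; exact: mono_z.
have [n hn] := h z (fun e => (hz e).1); exists n; near=> e => y By.
have nk : (n <= Num.truncn e^-1)%N.
  have e0 : 0 < e by near: e; exact: nbhs_right_gt.
  rewrite truncn_ge_nat ?invr_ge0 ?(ltW e0)//.
  have : e <= n.+1%:R^-1 by near: e; apply: nbhs_right_le; rewrite invr_gt0.
  rewrite -[e in X in X -> _]invrK lef_pV2 ?posrE ?invr_gt0// => h1.
  by apply: le_trans h1; rewrite ler_nat.
apply: ((hz e).2 n y nk _ _ By); last by near: e.
move=> k; have : forall n y, P n e y -> P n.+1 e y by near: e.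
by apply.
Unshelve. all: by end_near. Qed.

Lemma common_power (R : realType) (I : finType) (P : I -> R -> R -> Prop) :
  (\forall e \near (0 : R)^'+, forall i M N, M <= N -> P i M e -> P i N e) ->
  (forall i, exists2 N, 0 < N & \forall e \near (0 : R)^'+, P i N e) ->
  exists2 N, 0 < N & \forall e \near (0 : R)^'+, forall i, P i N e.
Proof.
move=> mono h.
have /choice[N hN] : forall i, exists N, 0 < N /\ \forall e \near (0 : R)^'+, P i N e.
  by move=> i; have [N N0 hN] := h i; exists N.
exists (1 + \sum_i N i).
  by rewrite ltr_pwDl// sumr_ge0// => i _; apply: ltW; have [] := hN i.
apply: filter_forall => i; apply: filterS2 mono (hN i).2 => e; apply.
rewrite (bigD1 i)//= addrCA lerDl addr_ge0// sumr_ge0// => j _.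
by apply: ltW; have [] := hN j.
Qed.

(** * Differentiation in coordinates and along lines *)

Section LocalCalculus.
Context {R : realType}.
Local Notation small := ((0 : R)^'+).

Lemma near_eq_differentiable (V W : normedModType R) (f g : V -> W) (x : V) :
  (\forall y \near x, f y = g y) -> differentiable f x -> differentiable g x.
Proof.
move=> fg df.
have fgx : f x = g x by exact: nbhs_singleton fg.
have dgx : g \o shift x = cst (g x) + 'd f x +o_ 0 id.
  have := diff_locally df; move=> /eqaddoP h; apply/eqaddoP => e e0.
  have := h e e0.
  have : \forall y \near 0, f (y + x) = g (y + x).
    by move: fg; rewrite (near_shift 0 x)/=; apply: filterS => y; rewrite subr0.
  apply: filterS2 => y fgy.
  by rewrite /= -![(_ - _ : _ -> _) _]/(_ - _) -![(_ + _ : _ -> _) _]/(_ + _)/= /cst/= fgy fgx.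
have dc : continuous ('d f x) by exact: diff_continuous.
apply/diff_locallyP; rewrite (diff_unique dc dgx); by split.
Qed.

Lemma deriveMs (V : normedModType R) (f g : V -> R) (x v : V) :
  differentiable f x -> differentiable g x ->
  'D_v (fun y => f y * g y) x = f x * 'D_v g x + g x * 'D_v f x.
Proof.
move=> df dg.
rewrite (_ : (fun y => f y * g y) = f * g) // deriveM; [by []| exact: diff_derivable..].
Qed.

Lemma deriveDs (V : normedModType R) (f g : V -> R) (x v : V) :
  differentiable f x -> differentiable g x ->
  'D_v (fun y => f y + g y) x = 'D_v f x + 'D_v g x.
Proof.
move=> df dg.
rewrite (_ : (fun y => f y + g y) = f + g) // deriveD; [by []| exact: diff_derivable..].
Qed.

Lemma derive_partial n (g : 'rV[R]_n -> R) (x v : 'rV[R]_n) :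
  differentiable g x -> 'D_v g x = \sum_i v 0 i * 'D_(delta_mx 0 i) g x.
Proof.
move=> dg; rewrite deriveE// {1}(row_sum_delta v) linear_sum; apply: eq_bigr => i _.
by rewrite linearZ/= deriveE.
Qed.

Lemma derive_coord n m (G : 'rV[R]_n -> 'rV[R]_m) (x v : 'rV[R]_n) j :
  differentiable G x -> 'D_v (fun y => G y 0 j) x = 'D_v G x 0 j.
Proof.
by move=> dG; rewrite derive_mx ?mxE//; exact: diff_derivable.
Qed.

Lemma differentiable_coords n m (G : 'rV[R]_n -> 'rV[R]_m) (x : 'rV[R]_n) :
  (forall j, differentiable (fun y => G y 0 j) x) <-> differentiable G x.
Proof.
split=> [h|dG j]; last first.
  have := @differentiable_comp _ _ _ _ G (fun M : 'rV[R]_m => M 0 j : R) x dG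
    (differentiable_coord _ 0 j).
  by [].
rewrite (_ : G = \sum_j (fun y => G y 0 j *: (delta_mx 0 j : 'rV[R]_m))).
  apply: differentiable_sum => j; exact: differentiableZl.
by apply/funext => y; rewrite {1}(row_sum_delta (G y)) fct_sumE.
Qed.

Lemma derive_chain n m (F : 'rV[R]_m -> R) (G : 'rV[R]_n -> 'rV[R]_m)
    (x v : 'rV[R]_n) :
  (forall j, differentiable (fun y => G y 0 j) x) -> differentiable F (G x) ->
  'D_v (fun y => F (G y)) x =
  \sum_j 'D_v (fun y => G y 0 j) x * 'D_(delta_mx 0 j) F (G x).
Proof.
move=> /differentiable_coords dG dF.
rewrite (_ : (fun y => F (G y)) = F \o G)// deriveE; last exact: differentiable_comp.
rewrite diff_comp//= -deriveE// derive_partial//; apply: eq_bigr => j _.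
by rewrite (derive_coord v j dG) (deriveE v dG).
Qed.

(* Along a line, the derivative of a restriction is a directional derivative by
   the very definition of the latter. *)
Lemma is_derive_line n (g : 'rV[R]_n -> R) (x v : 'rV[R]_n) (s : R) :
  differentiable g (x + s *: v) ->
  is_derive s 1 (fun s => g (x + s *: v)) ('D_v g (x + s *: v)).
Proof.
move=> dg.
have dl : differentiable (fun s : R => x + s *: v) s.
  by apply: differentiableD => //; apply: differentiableZl.
have dc : differentiable (g \o (fun s : R => x + s *: v)) s.
  exact: differentiable_comp.
apply: DeriveDef; first exact: diff_derivable.
rewrite /derive; apply: (congr1 (fun q => lim (q @ 0^'))); apply/funext => h /=.
by rewrite [h%:A]mulr1 scalerDl addrCA.
Qed.

End LocalCalculus.

(** * Smooth moderate nets *)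

(* Nets of functions on open sets Om all of whose partial derivatives of order
   at most m are differentiable on Om and moderate at the points of X. *)
Section SmoothNets.
Context {R : realType} {rho : gauge R}.
Local Notation K := (gnum rho).
Local Notation small := ((0 : R)^'+).

Section Fixed.
Context {n : nat} (X : set 'rV[K]_n) (Om : R -> set 'rV[R]_n).
Implicit Types g h : R -> 'rV[R]_n -> R.

Definition tame g :=
  (forall e, 0 < e <= 1 -> forall x, Om e x -> differentiable (g e) x) /\
  (forall x (xe : R -> 'rV[R]_n), X x -> vrepresents x xe ->
     moderate rho (fun e => g e (xe e))).

Fixpoint smooth_net m g := tame g /\
  if m is m'.+1 then forall i, smooth_net m' (fun e => 'D_(delta_mx 0 i) (g e))
  else True.

Lemma smooth_net_tame m g : smooth_net m g -> tame g.
Proof. by case: m => [|m] []. Qed.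

Definition snet g := forall m, smooth_net m g.

Definition word_der (s : seq 'I_n) (g : 'rV[R]_n -> R) : 'rV[R]_n -> R :=
  foldr (fun i q => 'D_(delta_mx 0 i) q) g s.

Lemma snet_tame g : snet g -> tame g.
Proof. by move=> /(_ 0%N)[]. Qed.

Lemma snet_diff g e x : snet g -> 0 < e <= 1 -> Om e x -> differentiable (g e) x.
Proof. by move=> /snet_tame[h _] e01; exact: h. Qed.

Lemma snet_mod g x (xe : R -> 'rV[R]_n) : snet g -> X x -> vrepresents x xe ->
  moderate rho (fun e => g e (xe e)).
Proof. by move=> /snet_tame[_ h]; exact: h. Qed.

Lemma snetD1 g i : snet g -> snet (fun e => 'D_(delta_mx 0 i) (g e)).
Proof. by move=> h m; exact: (h m.+1).2. Qed.

Lemma snet_word g s : snet g -> snet (fun e => word_der s (g e)).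
Proof. by move=> h; elim: s => //= i s IH; exact: snetD1. Qed.

Lemma word_der_rcons s i (g : 'rV[R]_n -> R) :
  word_der (rcons s i) g = word_der s ('D_(delta_mx 0 i) g).
Proof. by rewrite /word_der foldr_rcons. Qed.

Lemma snetP g : (forall s, tame (fun e => word_der s (g e))) -> snet g.
Proof.
move=> h m; elim: m g h => [|m IH] g h; split=> //; try exact: (h [::]).
by move=> i; apply: IH => s; have := h (rcons s i); congr tame; apply/funext => e;
  rewrite word_der_rcons.
Qed.

Hypothesis oOm : forall e, 0 < e <= 1 -> open (Om e).
Hypothesis XOm : X `<=` strong_interior Om.

Lemma ev_le1 : \forall e \near small, 0 < e <= 1.
Proof.
by apply: filterS2 (nbhs_right_gt 0) (nbhs_right_le ltr01) => e -> ->.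
Qed.

Lemma near_Om (P : 'rV[R]_n -> Prop) e x : 0 < e <= 1 -> Om e x ->
  (forall y, Om e y -> P y) -> \forall y \near x, P y.
Proof. by move=> e01 ex h; apply: filterS h _; apply: open_nbhs_nbhs; split => //; exact: oOm. Qed.

Lemma tame_congr g h : (forall e, 0 < e <= 1 -> forall x, Om e x -> g e x = h e x) ->
  tame g -> tame h.
Proof.
move=> gh [dg mg]; split=> [e e01 x ex|x xe Xx hx].
  apply: near_eq_differentiable (dg e e01 x ex).
  by apply: near_Om ex _ => // y; exact: gh.
have hO := XOm Xx hx.
apply: (moderate_le (mg x xe Xx hx)); apply: filterS2 ev_le1 hO => e e01 ex.
by rewrite gh.
Qed.

Lemma smooth_net_congr m g h :
  (forall e, 0 < e <= 1 -> forall x, Om e x -> g e x = h e x) ->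
  smooth_net m g -> smooth_net m h.
Proof.
elim: m g h => [|m IH] g h gh [tg Dg]; split; try exact: tame_congr tg.
  by [].
move=> i; apply: IH (Dg i) => e e01 x ex; apply: near_eq_derive.
by apply: near_Om ex _ => // y; exact: gh.
Qed.

Lemma smooth_netS m g : smooth_net m.+1 g -> smooth_net m g.
Proof. by elim: m g => [|m IH] g [tg h]; split=> // i; exact: IH. Qed.

Lemma smooth_net_cst m (c : R -> R) : moderate rho c -> smooth_net m (fun e _ => c e).
Proof.
elim: m c => [|m IH] c mc; split=> //; try by split=> // *; exact: differentiable_cst.
move=> i; have := IH _ (moderate_cst 0); congr smooth_net.
by apply/funext => e; apply/funext => x; rewrite derive_cst.
Qed.

Lemma smooth_net_coord m j : smooth_net m (fun e x => x 0 j).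
Proof.
have t : tame (fun e x => x 0 j).
  split=> [e _ x _|x xe _ hx]; first exact: differentiable_coord.
  exact: represents_moderate (hx j).
case: m => [|m]; split=> // i.
have := @smooth_net_cst m (fun=> (delta_mx 0 i : 'rV[R]_n) 0 j) (moderate_cst _).
congr smooth_net; apply/funext => e; apply/funext => x.
by rewrite (@derive_coord _ _ _ id)// derive_id.
Qed.

Lemma smooth_netD m g h : smooth_net m g -> smooth_net m h ->
  smooth_net m (fun e x => g e x + h e x).
Proof.
elim: m g h => [|m IH] g h [[dg mg] Dg] [[dh mh] Dh]; split=> //.
- split=> [e e01 x ex|x xe Xx hx]; last exact: moderateD (mg _ _ Xx hx) (mh _ _ Xx hx).
  exact: differentiableD (dg _ e01 _ ex) (dh _ e01 _ ex).
- split=> [e e01 x ex|x xe Xx hx]; last exact: moderateD (mg _ _ Xx hx) (mh _ _ Xx hx).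
  exact: differentiableD (dg _ e01 _ ex) (dh _ e01 _ ex).
- move=> i; apply: smooth_net_congr (IH _ _ (Dg i) (Dh i)) => e e01 x ex.
  by rewrite deriveDs//; [exact: dg|exact: dh].
Qed.

Lemma smooth_netM m g h : smooth_net m g -> smooth_net m h ->
  smooth_net m (fun e x => g e x * h e x).
Proof.
elim: m g h => [|m IH] g h hg hh; have [[dg mg] Dg] := hg; have [[dh mh] Dh] := hh.
  split=> //.
  split=> [e e01 x ex|x xe Xx hx]; last exact: moderateM (mg _ _ Xx hx) (mh _ _ Xx hx).
  exact: differentiableM (dg _ e01 _ ex) (dh _ e01 _ ex).
split.
  split=> [e e01 x ex|x xe Xx hx]; last exact: moderateM (mg _ _ Xx hx) (mh _ _ Xx hx).
  exact: differentiableM (dg _ e01 _ ex) (dh _ e01 _ ex).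
move=> i; apply: smooth_net_congr (smooth_netD (IH _ _ (smooth_netS hg) (Dh i))
  (IH _ _ (smooth_netS hh) (Dg i))) => e e01 x ex.
by rewrite deriveMs//; [exact: dg|exact: dh].
Qed.

Lemma smooth_net_sum m p (g : 'I_p -> R -> 'rV[R]_n -> R) :
  (forall j, smooth_net m (g j)) -> smooth_net m (fun e x => \sum_j g j e x).
Proof.
elim: p g => [|p IH] g hg.
  apply: smooth_net_congr (smooth_net_cst m (moderate_cst 0)) => e _ x _.
  by rewrite big_ord0.
apply: smooth_net_congr (smooth_netD (hg ord0) (IH _ (fun j => hg (lift ord0 j)))) => e _ x _.
by rewrite big_ord_recl.
Qed.

End Fixed.

(** Induction on the order, over all [F] at once: by the chain rule a partial derivative of the
    composite is a sum of products of a derivative of a coordinate of [G] with a partial derivative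
    of [F] composed with [G], to which the induction hypothesis applies. *)
Lemma smooth_net_comp n p (X : set 'rV[K]_n) (Om : R -> set 'rV[R]_n)
    (Y : set 'rV[K]_p) (Om' : R -> set 'rV[R]_p)
    (G : R -> 'rV[R]_n -> 'rV[R]_p) m (F : R -> 'rV[R]_p -> R) :
  (forall e, 0 < e <= 1 -> open (Om e)) -> X `<=` strong_interior Om ->
  (forall j, snet X Om (fun e x => G e x 0 j)) ->
  (forall e x, 0 < e <= 1 -> Om e x -> Om' e (G e x)) ->
  (forall x xe, X x -> vrepresents x xe ->
     exists2 y, Y y & vrepresents y (fun e => G e (xe e))) ->
  snet Y Om' F -> smooth_net X Om m (fun e x => F e (G e x)).
Proof.
move=> oOm XOm sG GOm GY; elim: m F => [|m IH] F sF.
  split=> //; split=> [e e01 x ex|x xe Xx hx].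
    apply: (@differentiable_comp _ _ _ _ (G e) (F e)).
      by apply/differentiable_coords => j; exact: (snet_diff (sG j) e01 ex).
    by apply: (snet_diff sF e01); exact: GOm.
  by have [y Yy hy] := GY _ _ Xx hx; exact: snet_mod sF Yy hy.
split=> [|i].
  exact: smooth_net_tame (IH F sF).
have h : smooth_net X Om m (fun e x => \sum_j 'D_(delta_mx 0 i) (fun y => G e y 0 j) x *
    'D_(delta_mx 0 j) (F e) (G e x)).
  apply: smooth_net_sum => // j; apply: smooth_netM => //.
    exact: snetD1.
  by apply: (IH (fun e => 'D_(delta_mx 0 j) (F e))); exact: snetD1.
apply: smooth_net_congr h => // e e01 x ex.
rewrite [RHS]derive_chain//.
  by move=> j; exact: (snet_diff (sG j) e01 ex).
by apply: (snet_diff sF e01); exact: GOm.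
Qed.

Lemma snet_comp n p (X : set 'rV[K]_n) (Om : R -> set 'rV[R]_n)
    (Y : set 'rV[K]_p) (Om' : R -> set 'rV[R]_p)
    (G : R -> 'rV[R]_n -> 'rV[R]_p) (F : R -> 'rV[R]_p -> R) :
  (forall e, 0 < e <= 1 -> open (Om e)) -> X `<=` strong_interior Om ->
  (forall j, snet X Om (fun e x => G e x 0 j)) ->
  (forall e x, 0 < e <= 1 -> Om e x -> Om' e (G e x)) ->
  (forall x xe, X x -> vrepresents x xe ->
     exists2 y, Y y & vrepresents y (fun e => G e (xe e))) ->
  snet Y Om' F -> snet X Om (fun e x => F e (G e x)).
Proof. by move=> h1 h2 h3 h4 h5 h6 m; exact: (@smooth_net_comp n p X Om Y Om' G m F). Qed.

Lemma snet_sub n (X X' : set 'rV[K]_n) (Om Om' : R -> set 'rV[R]_n) g :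
  X `<=` X' -> (forall e, 0 < e <= 1 -> Om e `<=` Om' e) ->
  snet X' Om' g -> snet X Om g.
Proof.
move=> XX OO; have t h : tame X' Om' h -> tame X Om h.
  move=> [dh mh]; split=> [e e01 x /(OO e e01)|x xe /XX]; [exact: dh|exact: mh].
move=> sg; apply: snetP => s; apply: t; exact: snet_tame (snet_word s sg).
Qed.

Lemma iter_partial_coord n k (Om : set 'rV[R]_n) (f : 'rV[R]_n -> 'rV[R]_k) s j :
  open Om -> smooth_on Om f -> forall x, Om x ->
  iter_partial s f x 0 j = word_der s (fun y => f y 0 j) x.
Proof.
move=> oO sf; elim: s => //= i s IH x Ox.
rewrite -(derive_coord (delta_mx 0 i) j (sf s x Ox)).
apply: near_eq_derive; apply: filterS IH _; exact: open_nbhs_nbhs.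
Qed.


Lemma smooth_on_coord n k (Om : set 'rV[R]_n) (f : 'rV[R]_n -> 'rV[R]_k) :
  open Om -> smooth_on Om f -> forall j s x, Om x ->
    differentiable (word_der s (fun y => f y 0 j)) x.
Proof.
move=> oO sf j s x Ox.
have /differentiable_coords/(_ j) := sf s x Ox; apply: near_eq_differentiable.
apply: (@filterS _ (nbhs x) _ Om) => [y Oy|]; first exact: (iter_partial_coord _ _ oO sf).
exact: open_nbhs_nbhs.
Qed.

(** Differentiability of the iterated partials and their coordinatewise formula are proved in one
    induction, since the derivative of a vector-valued map is computed by coordinates only where
    that map is differentiable. *)
Lemma smooth_on_coords n k (Om : set 'rV[R]_n) (f : 'rV[R]_n -> 'rV[R]_k) :
  open Om -> (forall j s x, Om x ->
    differentiable (word_der s (fun y => f y 0 j)) x) -> smooth_on Om f.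
Proof.
move=> oO h; have nO x : Om x -> nbhs x Om by move=> Ox; exact: open_nbhs_nbhs.
suff : forall s x, Om x -> differentiable (iter_partial s f) x /\
    forall j, iter_partial s f x 0 j = word_der s (fun y => f y 0 j) x.
  by move=> hs s x Ox; exact: (hs s x Ox).1.
elim=> [x Ox|i s IH x Ox]; first by split=> //; apply/differentiable_coords => j; exact: (h j [::]).
have e y j : Om y -> iter_partial (i :: s) f y 0 j = word_der (i :: s) (fun y => f y 0 j) y.
  move=> Oy; rewrite /= -(derive_coord (delta_mx 0 i) j (IH y Oy).1).
  by apply: near_eq_derive; apply: filterS (nO y Oy) => z /IH[].
split=> [|j]; last exact: e.
apply/differentiable_coords => j; apply: near_eq_differentiable (h j (i :: s) x Ox).
by apply: filterS (nO x Ox) => y Oy; rewrite e.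
Qed.

(** Splits a vector-valued defining net into scalar smooth nets, one for each coordinate; the
    estimates below are all made on these. *)
Lemma definesE n k (X : set 'rV[K]_n) (Om : R -> set 'rV[R]_n)
    (fe : R -> 'rV[R]_n -> 'rV[R]_k) (f : 'rV[K]_n -> 'rV[K]_k) :
  defines X Om fe f <->
  [/\ forall e, 0 < e <= 1 -> open (Om e), X `<=` strong_interior Om,
      forall j, snet X Om (fun e x => fe e x 0 j) &
      forall x xe, X x -> vrepresents x xe ->
        vrepresents (f x) (fun e => fe e (xe e))].
Proof.
split=> [[oO XO h]|[oO XO sf h]].
- split=> //; [by move=> e /oO[]| |by move=> x xe Xx /(h _ _ Xx)[]].
  move=> j; apply: snetP => s; split=> [e e01 x Ox|x xe Xx hx].
    by have [opn smo] := oO e e01; exact: (smooth_on_coord opn smo).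
  have [_ /(_ s)/moderate_enorm/(_ j) m] := h _ _ Xx hx.
  apply: (moderate_le m); apply: filterS2 ev_le1 (XO _ Xx _ hx) => e e01 Ox.
  by have [opn smo] := oO e e01; rewrite (iter_partial_coord s j opn smo Ox).
- have sm e : 0 < e <= 1 -> smooth_on (Om e) (fe e).
    move=> e01; apply: smooth_on_coords; first exact: oO.
    by move=> j s x Ox; exact: snet_diff (snet_word s (sf j)) e01 Ox.
  split=> // [e e01|x xe Xx hx]; first by split; [exact: oO|exact: sm].
  split=> [|s]; first exact: h.
  apply/moderate_enorm => j.
  apply: (moderate_le (snet_mod (snet_word s (sf j)) Xx hx)).
  apply: filterS2 ev_le1 (XO _ Xx _ hx) => e e01 Ox.
  by rewrite (iter_partial_coord s j (oO e e01) (sm e e01) Ox).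
Qed.

Lemma defines_deriv n k (X : set 'rV[K]_n) (Om : R -> set 'rV[R]_n)
    (fe : R -> 'rV[R]_n -> 'rV[R]_k) (f : 'rV[K]_n -> 'rV[K]_k) x xe s :
  defines X Om fe f -> X x -> vrepresents x xe ->
  \forall e \near small, forall j,
    iter_partial s (fe e) (xe e) 0 j = word_der s (fun y => fe e y 0 j) (xe e).
Proof.
move=> [oO XO _] Xx hx; apply: filterS2 ev_le1 (XO _ Xx _ hx) => e e01 Ox j.
by have [opn smo] := oO e e01; rewrite (iter_partial_coord s j opn smo Ox).
Qed.

End SmoothNets.

Lemma mean_value_segment (R : realType) n (g : 'rV[R]_n -> R) (x z : 'rV[R]_n) C :
  0 <= C ->
  (forall s, 0 <= s <= 1 -> differentiable g (x + s *: (z - x))) ->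
  (forall s i, 0 <= s <= 1 -> `|'D_(delta_mx 0 i) g (x + s *: (z - x))| <= C) ->
  `|g z - g x| <= C * \sum_i `|z 0 i - x 0 i|.
Proof.
move=> C0 dg hC.
have [|s|c c01] := @MVT_segment R (fun s => g (x + s *: (z - x)))
  (fun s => 'D_(z - x) g (x + s *: (z - x))) 0 1 ler01.
- by move=> s /[!in_itv]/andP[s0 s1]; apply: is_derive_line; apply: dg; rewrite !ltW.
- apply: derivable_within_continuous => t /[!in_itv] t01.
  have := @is_derive_line R n g x (z - x) t (dg t t01).
  by move=> [].
rewrite scale1r scale0r addr0 [x + _]addrC subrK subr0 mulr1 => ->.
have c01' : 0 <= c <= 1 by move: c01; rewrite in_itv.
rewrite (derive_partial (z - x) (dg c c01')) mulr_sumr.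
apply: (le_trans (ler_norm_sum _ _ _)); apply: ler_sum => i _.
by rewrite normrM !mxE mulrC ler_wpM2r// hC.
Qed.

(** * Uniform bounds on slabs *)

Section Slab.
Context {R : realType} {rho : gauge R}.
Local Notation K := (gnum rho).
Local Notation small := ((0 : R)^'+).

(** The interval is the case [n = 0] and the domain of the Lagrangian is the case [n = d + d], so
    that one theory of derivatives serves both. *)
Definition slab (a b : K) (n : nat) : set 'rV[K]_n.+1 := [set x | gitv a b (x 0 0)].

(** The cap [rho^-M] makes every net picked in the boxes moderate, so that it represents a point of
    the slab ([box_select]). This is what turns statements about generalized points into uniform
    ones. *)
Definition box (ae be : R -> R) n (M : R) (e : R) : set 'rV[R]_n.+1 :=
  [set y | ae e <= y 0 0 <= be e /\ forall i, `|y 0 i| <= rho e `^ (- M)].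

Arguments slab : clear implicits.
Arguments box : clear implicits.

Context {a b : K} {ae be : R -> R}.
Hypotheses (ha : represents a ae) (hb : represents b be).
Hypothesis ab : forall e, ae e <= be e.
Context {gap : R}.
Hypotheses (gap0 : 0 < gap)
  (hgap : \forall e \near small, ae e + rho e `^ gap <= be e).

Definition clamp (e t : R) := Num.max (ae e) (Num.min (be e) t).

Lemma clamp_itv e t : ae e <= clamp e t <= be e.
Proof.
rewrite /clamp le_max lexx/= ge_max ab/= ge_min lexx //.
Qed.

(** A representative of a point of the interval leaves [[ae e, be e]] by a negligible amount at
    most, so that clamping it changes it by as little. *)
Lemma represents_clamp t te : gitv a b t -> represents t te ->
  represents t (fun e => clamp e (te e)).
Proof.
move=> [hat htb] ht; apply: (represents_congr ht); apply/negligibleP => N N0.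
have h1 := (gle_ev ha ht).1 hat N N0; have h2 := (gle_ev ht hb).1 htb N N0.
apply: filterS2 h1 h2 => e; have := ab e; have := powR_ge0 (rho e) N.
rewrite /clamp /Num.max /Num.min => ? ? ? ?.
by repeat case: ifPn; rewrite -?leNgt ler_norml => *; lra.
Qed.

Lemma gitv_of t te : represents t te ->
  (\forall e \near small, ae e <= te e <= be e) -> gitv a b t.
Proof.
move=> ht h; split.
  apply/(gle_ev ha ht) => N N0; apply: filterS h => e /andP[? ?].
  by have := powR_ge0 (rho e) N; lra.
apply/(gle_ev ht hb) => N N0; apply: filterS h => e /andP[? ?].
by have := powR_ge0 (rho e) N; lra.
Qed.

Section Dim.
Variable n : nat.
Local Notation X := (slab a b n).
Implicit Types g : R -> 'rV[R]_n.+1 -> R.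

Definition vclamp (xe : R -> 'rV[R]_n.+1) : R -> 'rV[R]_n.+1 :=
  fun e => \row_i (if i == 0 then clamp e (xe e 0 0) else xe e 0 i).

Lemma vrepresents_vclamp (x : 'rV[K]_n.+1) xe : X x -> vrepresents x xe -> vrepresents x (vclamp xe).
Proof.
move=> Xx hx i; have [->|i0] := eqVneq i 0.
  rewrite (_ : (fun e => _) = fun e => clamp e (xe e 0 0)).
    exact: represents_clamp.
  by apply/funext => e; rewrite mxE eqxx.
rewrite (_ : (fun e => _) = fun e => xe e 0 i)//.
by apply/funext => e; rewrite mxE (negbTE i0).
Qed.

Lemma vclamp_itv xe e : ae e <= vclamp xe e 0 0 <= be e.
Proof. by rewrite mxE eqxx clamp_itv. Qed.

Lemma slab_of (x : 'rV[K]_n.+1) xe : vrepresents x xe ->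
  (\forall e \near small, ae e <= xe e 0 0 <= be e) -> X x.
Proof. by move=> hx h; exact: gitv_of (hx 0) h. Qed.

Lemma box_select M (z : R -> 'rV[R]_n.+1) : 0 < M ->
  (forall e, box ae be n M e (z e) \/ z e = const_mx (ae e)) ->
  exists2 x, X x & vrepresents x z.
Proof.
move=> M0 hz.
have mz i : moderate rho (fun e => z e 0 i).
  have m := moderateD (moderate_powR (- M)) (represents_moderate (represents_abs ha)).
  apply: (moderate_le m); apply: nearW => e.
  rewrite (ger0_norm (addr_ge0 (powR_ge0 _ _) (normr_ge0 _))).
  case: (hz e) => [[_ /(_ i) h]|->]; first by rewrite (le_trans h)// lerDl.
  by rewrite mxE lerDr powR_ge0.
have h := vrepresents_class mz; eexists; last exact: h.
apply: (slab_of h); apply: nearW => e.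
by case: (hz e) => [[]//|->]; rewrite mxE lexx ab.
Qed.

Lemma box_near M (P : R -> 'rV[R]_n.+1 -> Prop) : 0 < M ->
  (forall x xe, X x -> vrepresents x xe -> \forall e \near small, P e (xe e)) ->
  \forall e \near small, forall y, box ae be n M e y -> P e y.
Proof.
move=> M0 h; apply: (@uniform_near _ _ _ (fun e => const_mx (ae e))) => z hz.
by have [x Xx xz] := box_select M0 hz; exact: h Xx xz.
Qed.

Lemma box_Om Om M : 0 < M -> X `<=` strong_interior Om ->
  \forall e \near small, box ae be n M e `<=` Om e.
Proof. by move=> M0 XOm; apply: box_near => // x xe /XOm; apply. Qed.

Lemma uniform_moderate (T : Type) (B : R -> set T) (x0 : R -> T) (g : R -> T -> R) :
  (forall z : R -> T, (forall e, B e (z e) \/ z e = x0 e) ->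
    moderate rho (fun e => g e (z e))) ->
  exists2 N, 0 < N & \forall e \near small, forall y, B e y -> `|g e y| <= rho e `^ (- N).
Proof.
move=> h.
have [||N hN] := @uniform_nat_near R T B x0 (fun n e y => `|g e y| <= rho e `^ (- n%:R)).
- near=> e => k y; move/le_trans; apply.
  apply: ger_powR; last by rewrite lerN2 ler_nat.
  have /andP[-> /ltW->//] : 0 < rho e < 1 by near: e; exact: ev_gauge01.
- move=> z /h/moderateP[N N0 hN]; exists (Num.truncn N).+1.
  have := @le_gauge_powR R rho (- (Num.truncn N).+1%:R) (- N).
  rewrite lerN2 (ltW (truncnS_gt _)) => /(_ isT).
  by apply: filterS2 hN => e; exact: le_trans.
exists (N.+1)%:R => //.
have hm := @le_gauge_powR R rho (- N.+1%:R) (- N%:R).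
rewrite lerN2 ler_nat in hm.
by apply: filterS2 hN (hm (leqnSn N)) => e h1 h2 y /h1/le_trans; apply.
Unshelve. all: by end_near. Qed.

Lemma box_bound Om g M : 0 < M -> snet X Om g ->
  exists2 N, 0 < N &
    \forall e \near small, forall y, box ae be n M e y -> `|g e y| <= rho e `^ (- N).
Proof.
move=> M0 sg; apply: (@uniform_moderate _ _ (fun e => const_mx (ae e))) => z hz.
by have [x Xx xz] := box_select M0 hz; exact: snet_mod sg Xx xz.
Qed.

Lemma common_exponent (I : finType) (T : Type) (B : R -> set T) (g : I -> R -> T -> R) :
  (forall i, exists2 N, 0 < N &
    \forall e \near small, forall y, B e y -> `|g i e y| <= rho e `^ (- N)) ->
  exists2 N, 0 < N &
    \forall e \near small, forall y, B e y -> forall i, `|g i e y| <= rho e `^ (- N).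
Proof.
move=> h.
have [|i|N N0 hN] := @common_power R I
  (fun i N e => forall y, B e y -> `|g i e y| <= rho e `^ (- N)); last 2 first.
- exact: h.
- by exists N => //; apply: filterS hN => e he y By i; exact: he.
apply: filterS (ev_gauge01 (rho := rho)) => e /andP[r0 r1] i M N MN hM y By.
apply: (le_trans (hM y By)); apply: ger_powR; last by rewrite lerN2.
by rewrite r0 ltW.
Qed.

Lemma box_negligible g M N : 0 < M -> 0 < N ->
  (forall x xe, X x -> vrepresents x xe -> negligible rho (fun e => g e (xe e))) ->
  \forall e \near small, forall y, box ae be n M e y -> `|g e y| <= rho e `^ N.
Proof.
move=> M0 N0 g0; apply: (@box_near M (fun e y => `|g e y| <= rho e `^ N)) => // x xe Xx hx.
by have /negligibleP := g0 x xe Xx hx; apply.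
Qed.

Lemma box_convex M e (x z : 'rV[R]_n.+1) s : 0 <= s <= 1 ->
  box ae be n M e x -> box ae be n M e z -> box ae be n M e (x + s *: (z - x)).
Proof.
move=> /andP[s0 s1] [xi xM] [zi zM]; split=> [|i]; rewrite !mxE.
  by apply/andP; split; nra.
have := xM i; have := zM i; move: (rho e `^ _) => c.
by rewrite !ler_norml => /andP[? ?] /andP[? ?]; apply/andP; split; nra.
Qed.

Lemma box_lipschitz Om g M : 0 < M -> X `<=` strong_interior Om -> snet X Om g ->
  exists2 N, 0 < N & \forall e \near small, forall x z,
    box ae be n M e x -> box ae be n M e z ->
    `|g e z - g e x| <= rho e `^ (- N) * \sum_i `|z 0 i - x 0 i|.
Proof.
move=> M0 XOm sg.
have [N N0 hN] := @common_exponent 'I_n.+1 _ (box ae be n M)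
  (fun i e => 'D_(delta_mx 0 i) (g e)) (fun i => box_bound M0 (snetD1 i sg)).
exists N => //.
apply: filterS3 ev_le1 hN (box_Om M0 XOm) => e e01 he hO x z Bx Bz.
apply: mean_value_segment; first exact: powR_ge0.
  move=> s s01; apply: (snet_diff sg e01); apply: hO; exact: box_convex.
by move=> s i s01; apply: he; exact: box_convex.
Qed.

(** Overspill on the segment between the two representatives: every net picked in the segments
    represents the same point [x], so the partial derivatives are bounded there by one power of
    [rho], and the mean value theorem multiplies this power by a negligible distance. *)
Lemma snet_rep_change Om g x (xe ye : R -> 'rV[R]_n.+1) :
  X `<=` strong_interior Om -> snet X Om g -> X x ->
  vrepresents x xe -> vrepresents x ye ->
  negligible rho (fun e => g e (ye e) - g e (xe e)).
Proof.
move=> XOm sg Xx hx hy.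
pose B e : set 'rV[R]_n.+1 := [set xe e + s *: (ye e - xe e) | s in [set s | 0 <= s <= 1]].
have selB z : (forall e, B e (z e) \/ z e = xe e) -> vrepresents x z.
  move=> hz; apply: (vrepresents_congr hx) => i.
  have := represents_negligible (hy i) (hx i); move/negligible_le; apply.
  apply: nearW => e; case: (hz e) => [[s /andP[s0 s1] <-]|->]; last by rewrite subrr normr0.
  by rewrite !mxE addrAC subrr add0r normrM ger0_norm// ler_piMl.
have [N N0 hN] : exists2 N, 0 < N & \forall e \near small, forall y, B e y ->
    forall i, `|'D_(delta_mx 0 i) (g e) y| <= rho e `^ (- N).
  apply: common_exponent => i; apply: (@uniform_moderate _ _ xe) => z /selB hz.
  exact: snet_mod (snetD1 i sg) Xx hz.
have hO : \forall e \near small, forall y, B e y -> Om e y.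
  apply: (@uniform_near _ _ _ xe) => z /selB hz; exact: XOm Xx _ hz.
have n0 : negligible rho (fun e => rho e `^ (- N) * \sum_i `|ye e 0 i - xe e 0 i|).
  apply: negligibleMl; first exact: moderate_powR.
  apply: negligible_sum => i; apply: negligible_abs.
  exact: represents_negligible (hy i) (hx i).
apply: (negligible_le n0); apply: filterS3 ev_le1 hN hO => e e01 he hOe.
rewrite [leRHS]ger0_norm ?mulr_ge0 ?powR_ge0 ?sumr_ge0//.
have inB s : 0 <= s <= 1 -> B e (xe e + s *: (ye e - xe e)) by move=> s01; exists s.
apply: mean_value_segment; first exact: powR_ge0.
  by move=> s /inB s01; apply: (snet_diff sg e01); exact: hOe.
by move=> s i /inB s01; exact: he.
Qed.


Lemma in_box x xe : X x -> vrepresents x xe ->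
  exists2 M0, 0 < M0 & forall M, M0 <= M ->
    \forall e \near small, ae e <= xe e 0 0 <= be e -> box ae be n M e (xe e).
Proof.
move=> Xx hx.
have /choice[N hN] : forall i, exists N, 0 < N /\
    \forall e \near small, `|xe e 0 i| <= rho e `^ (- N).
  by move=> i; have /moderateP[N N0 hN] := represents_moderate (hx i); exists N.
exists (1 + \sum_i N i).
  by rewrite ltr_pwDl// sumr_ge0// => i _; apply: ltW; have [] := hN i.
move=> M hM; suff : \forall e \near small, forall i, `|xe e 0 i| <= rho e `^ (- M).
  by apply: filterS => e he aeb; split.
apply: filter_forall => i; have [_ hi] := hN i.
have hm := @le_gauge_powR R rho (- M) (- N i).
have NM : - M <= - N i.
  rewrite lerN2; apply: le_trans hM; rewrite (bigD1 i)//= addrCA lerDl.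
  by rewrite addr_ge0// sumr_ge0// => j _; apply: ltW; have [] := hN j.
by apply: filterS2 hi (hm NM) => e; exact: le_trans.
Qed.

(* The sign for which a step from x in direction i stays in the slab. *)
Definition inward (e : R) (x : 'rV[R]_n.+1) (i : 'I_n.+1) : R :=
  if (i != 0) || (x 0 0 <= (ae e + be e) / 2) then 1 else -1.

Lemma box_inward M e x i s : 0 <= s <= 1 -> s <= (be e - ae e) / 2 ->
  1 + rho e `^ (- M) <= rho e `^ (- (M + 1)) ->
  box ae be n M e x -> box ae be n (M + 1) e (x + s *: (inward e x i *: delta_mx 0 i)).
Proof.
move=> /andP[s0 s1] sab h [/andP[xa xb] xM]; split=> [|j].
  rewrite !mxE /inward; case: (eqVneq i 0) => [_|_] /=; last first.
    by rewrite !mulr0 addr0 xa.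
  rewrite mulr1; case: ifPn => [hm|]; first by apply/andP; split; lra.
  by rewrite -ltNge => hm; apply/andP; split; lra.
apply: le_trans h; rewrite !mxE addrC; apply: (le_trans (ler_normD _ _)).
apply: lerD (xM j); rewrite !normrM (ger0_norm s0).
apply: mulr_ile1 => //.
apply: mulr_ile1 => //.
  by rewrite /inward; case: ifP; rewrite ?normrN1 ?normr1.
by rewrite ger0_norm ?ler0n// lern1 leq_b1.
Qed.

(* Two applications of the mean value theorem at a point x, with a step h equal
   to a large power of rho: h D_i g(x) differs from g(x + h) - g(x) by O(h^2). *)
Lemma null_partial Om g i : X `<=` strong_interior Om -> snet X Om g ->
  (forall x xe, X x -> vrepresents x xe -> negligible rho (fun e => g e (xe e))) ->
  forall x xe, X x -> vrepresents x xe ->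
    negligible rho (fun e => 'D_(delta_mx 0 i) (g e) (xe e)).
Proof.
move=> XOm sg g0 x xe0 Xx hx0.
have hx := vrepresents_vclamp Xx hx0.
suff h : negligible rho (fun e => 'D_(delta_mx 0 i) (g e) (vclamp xe0 e)).
  have := negligibleD h (snet_rep_change XOm (snetD1 i sg) Xx hx hx0).
  by congr negligible; apply/funext => e; rewrite addrC subrK.
move: hx (vclamp_itv xe0); move: (vclamp xe0) => xe hx xab.
have [M M0 hM] := in_box Xx hx.
have [N N0 hN] := box_lipschitz (addr_gt0 M0 ltr01) XOm (snetD1 i sg).
apply/negligibleP => Q Q0.
(* The step will be [rho^P]. The part [gap + 1] keeps it within half the length of the slab, and
   [N + Q + 1] makes the Lipschitz error [rho^(- N + P)] at most [rho^(Q + 1)]. As [g] is below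
   [rho^(P + Q + 2)], dividing its increment by the step also leaves at most [rho^(Q + 1)]. *)
have [P PE] : exists P, P = N + Q + 1 + gap + 1 by eexists.
have P0 : 0 < P by rewrite PE !addr_gt0.
have PQ0 : 0 < P + Q + 1 + 1 by lra.
have QP : Q + 1 <= - N + P.
  have -> : - N + P = Q + 1 + (gap + 1) by rewrite PE; lra.
  by rewrite lerDl addr_ge0// ltW.
have gsmall := box_negligible (addr_gt0 M0 ltr01) PQ0 g0.
have hOm := box_Om (addr_gt0 M0 ltr01) XOm.
near=> e.
have r01 : 0 < rho e < 1 by near: e; exact: ev_gauge01.
have /andP[r0 r1] := r01.
have e01 : 0 < e <= 1 by near: e; exact: ev_le1.
have h0 : 0 < rho e `^ P by rewrite powR_gt0.
have hh1 : rho e `^ P <= 1 by near: e; exact: ev_powR_le.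
have h2 : 2 * rho e `^ P <= rho e `^ gap.
  apply: (@le_trans _ _ (2 * rho e `^ (gap + 1))); last by near: e; exact: powR2_small.
  by rewrite ler_pM2l//; near: e; apply: le_gauge_powR; rewrite PE; lra.
have hab : ae e + rho e `^ gap <= be e by near: e.
have hb1 : 1 + rho e `^ (- M) <= rho e `^ (- (M + 1)) by near: e; exact: add1_powR_small.
have xB : box ae be n M e (xe e).
  have : ae e <= xe e 0 0 <= be e -> box ae be n M e (xe e) by near: e; exact: hM.
  by apply; exact: xab.
set h := rho e `^ P in h0 hh1 h2 *.
pose v : 'rV[R]_n.+1 := inward e (xe e) i *: delta_mx 0 i.
have inB s : 0 <= s <= h -> box ae be n (M + 1) e (xe e + s *: v).
  move=> /andP[s0 sh]; apply: box_inward => //; first by rewrite s0 (le_trans sh).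
  by move: sh h2 hab; lra.
have dg s : 0 <= s <= h -> differentiable (g e) (xe e + s *: v).
  move=> /inB sB; apply: (snet_diff sg e01).
  have : box ae be n (M + 1) e `<=` Om e by near: e.
  by apply.
have [|s /[!in_itv]/andP[s0 s1]||c] := @MVT_segment R (fun s => g e (xe e + s *: v))
  (fun s => 'D_v (g e) (xe e + s *: v)) 0 h.
- exact: ltW.
- by apply: is_derive_line; apply: dg; rewrite !ltW.
- apply: derivable_within_continuous => t /[!in_itv] t01.
  by have := @is_derive_line R _ (g e) (xe e) v t (dg t t01); move=> [].
rewrite in_itv/= => c01; rewrite scale0r addr0 subr0 => hc.
have sv : 'D_v (g e) (xe e + c *: v) =
    inward e (xe e) i * 'D_(delta_mx 0 i) (g e) (xe e + c *: v).
  by rewrite !(deriveE _ (dg c c01)) {1}/v linearZ.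
have i1 : `|inward e (xe e) i| = 1.
  by rewrite /inward; case: ifP; rewrite ?normrN1 ?normr1.
set d0 := 'D_(delta_mx 0 i) (g e) (xe e).
set dc := 'D_(delta_mx 0 i) (g e) (xe e + c *: v) in sv *.
have k1 : `|dc| * h <= 2 * rho e `^ (P + Q + 1 + 1).
  have -> : `|dc| * h = `|g e (xe e + h *: v) - g e (xe e)|.
    by rewrite hc sv !normrM i1 mul1r (gtr0_norm h0).
  apply: (le_trans (ler_normB _ _)).
  have gB : forall y, box ae be n (M + 1) e y -> `|g e y| <= rho e `^ (P + Q + 1 + 1).
    by near: e.
  have := gB _ (inB h _); rewrite lexx (ltW h0) => /(_ isT).
  have := gB (xe e + 0 *: v) (inB 0 _); rewrite lexx (ltW h0) => /(_ isT).
  by rewrite scale0r addr0; lra.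
have k2 : `|dc - d0| <= rho e `^ (- N) * h.
  have hL : forall x z, box ae be n (M + 1) e x -> box ae be n (M + 1) e z ->
    `|'D_(delta_mx 0 i) (g e) z - 'D_(delta_mx 0 i) (g e) x|
      <= rho e `^ (- N) * \sum_j `|z 0 j - x 0 j| by near: e.
  have := hL (xe e) (xe e + c *: v) _ (inB c c01).
  have xB1 : box ae be n (M + 1) e (xe e).
    by have := inB 0; rewrite scale0r addr0; apply; rewrite lexx ltW.
  move=> /(_ xB1) /le_trans; apply.
  rewrite ler_wpM2l ?powR_ge0// (bigD1 i)//= big1 ?addr0.
    rewrite !mxE addrAC subrr add0r !eqxx mulr1 normrM i1 mulr1.
    by have /andP[c0 ch] := c01; rewrite ger0_norm.
  move=> j ji; rewrite !mxE addrAC subrr add0r eqxx (negbTE ji) !mulr0 normr0//.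
have k3 : 2 * rho e `^ (P + Q + 1 + 1) <= rho e `^ (Q + 1) * h.
  have -> : rho e `^ (Q + 1) * h = rho e `^ (P + Q + 1).
    rewrite /h -powRD ?(gt_eqF r0) ?implybT//; congr (_ `^ _); lra.
  by near: e; exact: powR2_small.
have k4 : `|dc| <= rho e `^ (Q + 1) by rewrite -(ler_pM2r h0); lra.
have k5 : rho e `^ (- N) * h <= rho e `^ (Q + 1).
  rewrite /h -powRD ?(gt_eqF r0) ?implybT//.
  by near: e; exact: le_gauge_powR.
have k6 : 2 * rho e `^ (Q + 1) <= rho e `^ Q by near: e; exact: powR2_small.
rewrite -(subKr dc d0); apply: (le_trans (ler_normB _ _)); lra.
Unshelve. all: by end_near. Qed.

End Dim.
End Slab.

Arguments slab {R rho} a b n _.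
Arguments box {R} rho ae be n M e _.
Arguments vclamp {R} ae be {n} xe e.
Arguments clamp {R} ae be e t.

(** * Derivatives on a slab *)

Section SlabDerivative.
Context {R : realType} {rho : gauge R}.
Local Notation K := (gnum rho).
Local Notation small := ((0 : R)^'+).
Context {a b : K} {ae be : R -> R}.
Hypotheses (ha : represents a ae) (hb : represents b be).
Hypothesis ab : forall e, ae e <= be e.
Context {gap : R}.
Hypotheses (gap0 : 0 < gap)
  (hgap : \forall e \near small, ae e + rho e `^ gap <= be e).
Variable n : nat.
Local Notation X := (slab a b n).

(** On the intersection of the two families of domains the difference of the two nets is a smooth
    net that is negligible at all points; [null_partial] preserves this, one letter of the word at a
    time. *)
Lemma word_der_unique Om Om' (f g : R -> 'rV[R]_n.+1 -> R) :
  (forall e, 0 < e <= 1 -> open (Om e)) -> X `<=` strong_interior Om ->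
  (forall e, 0 < e <= 1 -> open (Om' e)) -> X `<=` strong_interior Om' ->
  snet X Om f -> snet X Om' g ->
  (forall x xe, X x -> vrepresents x xe ->
    negligible rho (fun e => f e (xe e) - g e (xe e))) ->
  forall s x xe, X x -> vrepresents x xe ->
    negligible rho (fun e => word_der s (f e) (xe e) - word_der s (g e) (xe e)).
Proof.
move=> oO XO oO' XO' sf sg fg.
pose Oi e := Om e `&` Om' e.
have oOi e : 0 < e <= 1 -> open (Oi e).
  by move=> e01; apply: openI; [exact: oO|exact: oO'].
have XOi : X `<=` strong_interior Oi.
  by move=> x Xx xe hx; apply: filterS2 (XO x Xx xe hx) (XO' x Xx xe hx).
have sub h Om1 : (forall e, Oi e `<=` Om1 e) -> snet X Om1 h -> snet X Oi h.
  by move=> OO; apply: snet_sub => // e _; exact: OO.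
have sf' : snet X Oi f by apply: sub sf => e x [].
have sg' : snet X Oi g by apply: sub sg => e x [].
elim=> [//|i s IH] x xe Xx hx.
have sd : snet X Oi (fun e x => word_der s (f e) x + -1 * word_der s (g e) x).
  move=> m; apply: smooth_netD => //; first exact: snet_word.
  apply: smooth_netM => //; last exact: snet_word.
  by apply: smooth_net_cst; exact: moderate_cst.
have := null_partial ha hb ab gap0 hgap i XOi sd.
move=> /(_ _ x xe Xx hx); have IH' : forall x xe, X x -> vrepresents x xe ->
    negligible rho (fun e => word_der s (f e) (xe e) + -1 * word_der s (g e) (xe e)).
  move=> y ye Xy hy; have := IH y ye Xy hy; congr negligible; apply/funext => e.
  by rewrite mulN1r.
move=> /(_ IH'); move/negligible_le; apply.
apply: filterS2 ev_le1 (XOi x Xx xe hx) => e e01 Ox.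
rewrite deriveDs; last 2 first.
- exact: snet_diff (snet_word s sf') e01 Ox.
- apply: (@differentiableM _ _ (fun=> -1)); first exact: differentiable_cst.
  exact: snet_diff (snet_word s sg') e01 Ox.
rewrite (@deriveMs _ _ (fun=> -1)); last 2 first.
- exact: differentiable_cst.
- exact: snet_diff (snet_word s sg') e01 Ox.
by rewrite derive_cst mulr0 addr0 mulN1r.
Qed.

Lemma interior_in (x : 'rV[K]_n.+1) : sharp_interior X x -> X x.
Proof.
move=> [r r0]; apply.
have hr := represents_grep r; have [N N0 hN] := glt_gt0 hr r0.
apply: (gball_of N0 (vrepresents_grep x) (vrepresents_grep x) hr hN).
by apply: nearW => e i; rewrite subrr normr0 powR_ge0.
Qed.

Lemma represents_powR N : represents (gclass (fun e => rho e `^ N) : K)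
  (fun e => rho e `^ N).
Proof. by apply: represents_gclass; exact: moderate_powR. Qed.

Lemma powR_gt0K N : 0 < N -> 0 <~ (gclass (fun e => rho e `^ N) : K).
Proof.
move=> N0; apply/(glt_ev (represents0 (rho := rho)) (represents_powR N)).
by exists N => //; apply: nearW => e; rewrite add0r.
Qed.

(* Moving x towards the middle of the slab by a fraction rho^P. *)
Lemma interior_near (x : 'rV[K]_n.+1) xe : X x -> vrepresents x xe ->
  (forall e, ae e <= xe e 0 0 <= be e) ->
  forall N, 0 < N -> exists ze (z : 'rV[K]_n.+1),
  [/\ vrepresents z ze, sharp_interior X z &
      \forall e \near small, forall i, `|ze e 0 i - xe e 0 i| <= rho e `^ N].
Proof.
move=> Xx hx xab N N0.
have /moderateP[L L0 hL] := represents_moderate (representsB hb ha).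
(* The slab has length at most [rho^-L], so that moving by the fraction [rho^P] of the way to its
   middle displaces the point by at most [rho^N]. *)
pose P := N + L.
pose t e := rho e `^ P * ((ae e + be e) / 2 - xe e 0 0).
pose ze e : 'rV[R]_n.+1 := \row_i (if i == 0 then xe e 0 0 + t e else xe e 0 i).
have tN : \forall e \near small, `|t e| <= rho e `^ N.
  near=> e.
  have r0 : 0 < rho e by near: e; exact: gauge_gt0.
  have -> : rho e `^ N = rho e `^ P * rho e `^ (- L).
    by rewrite -powRD ?(gt_eqF r0) ?implybT// /P addrK.
  rewrite normrM (ger0_norm (powR_ge0 _ _)) ler_pM2l ?powR_gt0//.
  have : `|be e - ae e| <= rho e `^ (- L) by near: e.
  have /andP[x1 x2] := xab e; rewrite [X in X <= _ -> _]ger0_norm ?subr_ge0// => x3.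
  by rewrite ler_norml; lra.
have hz0 i : moderate rho (fun e => ze e 0 i).
  have mx j : moderate rho (fun e => xe e 0 j) by exact: represents_moderate (hx j).
  have mt : moderate rho t.
    by apply: (moderate_le (moderate_powR N)); apply: filterS tN => e /le_trans; apply; exact: ler_norm.
  have [->|i0] := eqVneq i 0.
    have := moderateD (mx 0) mt; congr moderate; apply/funext => e.
    by rewrite /ze mxE eqxx.
  have := mx i; congr moderate; apply/funext => e.
  by rewrite /ze mxE (negbTE i0).
have hz := vrepresents_class hz0.
exists ze; eexists; split; first exact: hz.
(* After the move the distance to each endpoint is at least half of [rho^P (be - ae)], hence at
   least half of [rho^(P + gap)], which leaves room for a ball of radius [rho^(P + gap + 1)]. *)
- have P0 : 0 < P + gap + 1 by rewrite /P !addr_gt0.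
  exists (gclass (fun e => rho e `^ (P + gap + 1))); first exact: powR_gt0K.
  move=> w zw; have hw := vrepresents_grep w.
  apply: (slab_of ha hb hw).
  have := gball_lt zw hw hz (represents_powR _) => hzw.
  near=> e.
  have r0 : 0 < rho e by near: e; exact: gauge_gt0.
  have : forall i, `|(\row_i grep (w 0 i) e) 0 i - ze e 0 i| <= rho e `^ (P + gap + 1).
    by near: e.
  move=> /(_ 0); rewrite [ze e 0 0]mxE eqxx /t.
  set W := (\row_i _) 0 0.
  have p0 : 0 < rho e `^ P by rewrite powR_gt0.
  have p1 : rho e `^ P <= 1 by near: e; apply: ev_powR_le => //; rewrite /P addr_gt0.
  have h1 : 2 * rho e `^ (P + gap + 1) <= rho e `^ P * rho e `^ gap.
    by rewrite -powRD ?(gt_eqF r0) ?implybT//; near: e; exact: powR2_small.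
  have h2 : ae e + rho e `^ gap <= be e by near: e.
  have /andP[h3 h4] := xab e.
  move: (rho e `^ (P + gap + 1)) (rho e `^ P) (rho e `^ gap) p0 p1 h1 h2 => A p q p0 p1 h1 h2.
  rewrite ler_norml => /andP[k1 k2]; apply/andP; split; nra.
- apply: filterS tN => e ht i; rewrite mxE; case: eqP => [->|_].
    by rewrite addrAC subrr add0r.
  by rewrite subrr normr0 powR_ge0.
Unshelve. all: by end_near. Qed.


Section Defining.
Context {k : nat} {Om : R -> set 'rV[R]_n.+1} {fe : R -> 'rV[R]_n.+1 -> 'rV[R]_k}.
Context {f : 'rV[K]_n.+1 -> 'rV[K]_k}.
Hypothesis hf : defines X Om fe f.

Lemma vrepresents_deriv x xe s : X x -> vrepresents x xe ->
  exists y : 'rV[K]_k, vrepresents y (fun e => iter_partial s (fe e) (xe e)).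
Proof.
move=> Xx hx; have [_ _ /(_ x xe Xx hx)[_ /(_ s)/moderate_enorm m]] := hf.
by eexists; exact: vrepresents_class.
Qed.

(** The definition allows another defining net and another representative of [x]. The change of net
    is negligible by [word_der_unique], the change of representative by [snet_rep_change]. *)
Lemma interior_gderivative_rep x xe s w : X x -> vrepresents x xe ->
  is_interior_gderivative X f s x w ->
  vrepresents w (fun e => iter_partial s (fe e) (xe e)).
Proof.
move=> Xx hx [_ [Om' [fe' [xe' [hf' hx' hw]]]]].
have [oO XO sf hfx] := (definesE X Om fe f).1 hf.
have [oO' XO' sf' hfx'] := (definesE X Om' fe' f).1 hf'.
move=> j; apply: (represents_congr (hw j)).
have d1 := defines_deriv s hf Xx hx.
have d2 := defines_deriv s hf' Xx hx'.
have n1 := snet_rep_change XO' (snet_word s (sf' j)) Xx hx' hx.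
have := word_der_unique oO XO oO' XO' (sf j) (sf' j) _ s Xx hx.
have h0 y ye : X y -> vrepresents y ye ->
    negligible rho (fun e => fe e (ye e) 0 j - fe' e (ye e) 0 j).
  by move=> Xy hy; exact: represents_negligible (hfx y ye Xy hy j) (hfx' y ye Xy hy j).
move=> /(_ h0) n2; apply: (negligible_le (negligibleD n2 n1)).
by apply: filterS2 d1 d2 => e -> ->; rewrite addrA subrK.
Qed.

Lemma interior_gderivative_of x xe s w : sharp_interior X x -> vrepresents x xe ->
  vrepresents w (fun e => iter_partial s (fe e) (xe e)) ->
  is_interior_gderivative X f s x w.
Proof. by move=> ix hx hw; split=> //; exists Om, fe, xe. Qed.

(** Sharp continuity of the derivatives, from their Lipschitz bounds on boxes; it gives the limits
    that define derivatives at points that are not sharply interior. *)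
Lemma deriv_continuous x xe s : X x -> vrepresents x xe ->
  (forall e, ae e <= xe e 0 0 <= be e) ->
  forall N, 0 < N -> exists2 Q, 0 < Q & forall z ze, X z -> vrepresents z ze ->
    (\forall e \near small, forall i, `|ze e 0 i - xe e 0 i| <= rho e `^ Q) ->
    \forall e \near small, forall j,
      `|iter_partial s (fe e) (ze e) 0 j - iter_partial s (fe e) (xe e) 0 j|
        <= rho e `^ N.
Proof.
move=> Xx hx xab N N0.
have [oO XO sf hfx] := (definesE X Om fe f).1 hf.
have [M M0 hM] := in_box (ae := ae) (be := be) Xx hx.
have M10 : 0 < M + 1 by rewrite addr_gt0.
have [|j|L L0 hL] := @common_power R 'I_k (fun j L e => forall y z,
    box rho ae be n (M + 1) e y -> box rho ae be n (M + 1) e z ->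
    `|word_der s (fun y => fe e y 0 j) z - word_der s (fun y => fe e y 0 j) y|
       <= rho e `^ (- L) * \sum_i `|z 0 i - y 0 i|); last 2 first.
- have := box_lipschitz ha hb ab M10 XO (snet_word s (sf j)); apply.
(* [L] compensates the Lipschitz constant. One of the two units absorbs the factor [2 (n + 1)] of
   the sum over the coordinates, the other the passage from [ze] to its clamped version. *)
- have [Q QE] : exists Q, Q = N + 1 + L + 1 by eexists.
  have Q0 : 0 < Q by rewrite QE !addr_gt0.
  exists Q => // z ze Xz hz hzx.
  have hzc := vrepresents_vclamp ha hb ab Xz hz.
  have d1 := defines_deriv s hf Xx hx.
  have d2 := defines_deriv s hf Xz hz.
  have n1 : \forall e \near small, forall j, `|word_der s (fun y => fe e y 0 j) (ze e) -
     word_der s (fun y => fe e y 0 j) (vclamp ae be ze e)| <= rho e `^ (N + 1).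
    apply: filter_forall => j.
    have := snet_rep_change XO (snet_word s (sf j)) Xz hzc hz.
    by move=> /negligibleP; apply; rewrite addr_gt0.
  have n2 : \forall e \near small, forall i, `|vclamp ae be ze e 0 i - ze e 0 i| <= rho e `^ Q.
    apply: filter_forall => i; have := represents_negligible (hzc i) (hz i).
    by move=> /negligibleP; apply.
  near=> e => j.
  have r0 : 0 < rho e by near: e; exact: gauge_gt0.
  have -> : iter_partial s (fe e) (ze e) 0 j = word_der s (fun y => fe e y 0 j) (ze e).
    by move: j; near: e.
  have -> : iter_partial s (fe e) (xe e) 0 j = word_der s (fun y => fe e y 0 j) (xe e).
    by move: j; near: e.
  have zx i : `|vclamp ae be ze e 0 i - xe e 0 i| <= 2 * rho e `^ Q.
    have : `|vclamp ae be ze e 0 i - ze e 0 i| <= rho e `^ Q by move: i; near: e.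
    have : `|ze e 0 i - xe e 0 i| <= rho e `^ Q by move: i; near: e.
    by rewrite !ler_norml; lra.
  have Q1 : 2 * rho e `^ Q <= 1.
    apply: (@le_trans _ _ (rho e `^ (N + 1 + L))); first by rewrite QE; near: e; exact: powR2_small.
    by near: e; apply: ev_powR_le; rewrite // !addr_gt0.
  have xM : ae e <= xe e 0 0 <= be e -> box rho ae be n M e (xe e) by near: e; exact: hM.
  have xM1 : ae e <= xe e 0 0 <= be e -> box rho ae be n (M + 1) e (xe e).
    by near: e; apply: hM; rewrite lerDl.
  have zM1 : box rho ae be n (M + 1) e (vclamp ae be ze e).
    split=> [|i]; first exact: vclamp_itv.
    have h1 : 1 + rho e `^ (- M) <= rho e `^ (- (M + 1)) by near: e; exact: add1_powR_small.
    have [_ /(_ i)] := xM (xab e); have := zx i.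
    by rewrite !ler_norml; lra.
  have hw : forall j y z, box rho ae be n (M + 1) e y -> box rho ae be n (M + 1) e z ->
    `|word_der s (fun y => fe e y 0 j) z - word_der s (fun y => fe e y 0 j) y|
       <= rho e `^ (- L) * \sum_i `|z 0 i - y 0 i| by near: e.
  have := hw j _ _ (xM1 (xab e)) zM1.
  have : `|word_der s (fun y => fe e y 0 j) (ze e) -
     word_der s (fun y => fe e y 0 j) (vclamp ae be ze e)| <= rho e `^ (N + 1).
    by move: j; near: e.
  have : rho e `^ (- L) * \sum_i `|vclamp ae be ze e 0 i - xe e 0 i| <= rho e `^ (N + 1).
    apply: (@le_trans _ _ (rho e `^ (- L) * (n.+1%:R * (2 * rho e `^ Q)))).
      rewrite ler_wpM2l ?powR_ge0//; apply: (le_trans (ler_sum _ (fun i _ => zx i))).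
      by rewrite sumr_const card_ord -[leLHS]mulr_natl.
    have -> : rho e `^ (- L) * (n.+1%:R * (2 * rho e `^ Q)) =
        (n.+1%:R * 2) * rho e `^ (N + 1 + 1).
      rewrite (_ : N + 1 + 1 = - L + Q); last by rewrite QE; lra.
      by rewrite powRD ?(gt_eqF r0) ?implybT//; ring.
    by near: e; apply: powR_absorb; rewrite mulr_ge0.
  have : 2 * rho e `^ (N + 1) <= rho e `^ N by near: e; exact: powR2_small.
  move: (word_der _ _ _) (word_der _ _ _) (word_der _ _ _) (_ * \sum_i _) => A B C D.
  by rewrite !ler_norml; lra.
- near=> e => j L L' LL' h y z yB zB; apply: (le_trans (h y z yB zB)).
  rewrite ler_wpM2r ?sumr_ge0//; apply: ger_powR; last by rewrite lerN2.
  have /andP[-> /ltW] : 0 < rho e < 1 by near: e; exact: ev_gauge01.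
  by [].
Unshelve. all: by end_near. Qed.

(** At a point that is not sharply interior, the limit is the value given by the defining net: by
    [interior_gderivative_rep] the nearby interior derivatives come from the same net, and
    [deriv_continuous] compares them with it. *)
Lemma is_gderivative_rep x xe s (y : 'rV[K]_k) : X x -> vrepresents x xe ->
  vrepresents y (fun e => iter_partial s (fe e) (xe e)) ->
  is_gderivative X f s x y.
Proof.
move=> Xx hx0 hy0.
have [ix|nix] := pselect (sharp_interior X x).
  by left; exact: interior_gderivative_of ix hx0 hy0.
right; split=> // r r0.
have hx := vrepresents_vclamp ha hb ab Xx hx0.
have xab := vclamp_itv ab xe.
have hy : vrepresents y (fun e => iter_partial s (fe e) (vclamp ae be xe e)).
  have [oO XO sf hfx] := (definesE X Om fe f).1 hf.
  move=> j; apply: (represents_congr (hy0 j)).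
  have := snet_rep_change XO (snet_word s (sf j)) Xx hx0 hx.
  move/negligible_le; apply.
  by apply: filterS2 (defines_deriv s hf Xx hx) (defines_deriv s hf Xx hx0) => e -> ->.
move: (vclamp ae be xe) hx xab hy => {hx0 hy0}xe' hx xab hy.
have hr := represents_grep r; have [N N0 hN] := glt_gt0 hr r0.
have N20 : 0 < N + 1 + 1 by rewrite !addr_gt0.
have [Q Q0 hQ] := deriv_continuous s Xx hx xab N20.
exists (gclass (fun e => rho e `^ Q)); first exact: powR_gt0K.
move=> z w zx iw.
have [iz _] := iw; have Xz : X z := interior_in iz.
have hz := vrepresents_grep z.
have hw := interior_gderivative_rep Xz hz iw.
apply: (gball_of N0 hw hy hr hN); apply: (hQ z _ Xz hz).
exact: gball_lt zx hz hx (represents_powR Q).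
Qed.

(** Two limits at a point that is not sharply interior agree because [interior_near] provides
    interior points in both neighbourhoods, and the derivative there is close to both limits. *)
Lemma is_gderivative_unique x xe s (y w : 'rV[K]_k) : X x -> vrepresents x xe ->
  vrepresents y (fun e => iter_partial s (fe e) (xe e)) ->
  is_gderivative X f s x w -> w = y.
Proof.
move=> Xx hx0 hy hw.
have hyd := is_gderivative_rep Xx hx0 hy.
case: hw => [iw|[nix lw]].
  exact: vrepresents_inj (interior_gderivative_rep Xx hx0 iw) hy.
case: hyd => [[]//|[_ ly]].
apply: gball_sym_eq => r r0.
have [q q0 hq] := lw r r0; have [p p0 hp] := ly r r0.
have hqe := represents_grep q; have [N N0 hN] := glt_gt0 hqe q0.
have hpe := represents_grep p; have [M M0 hM] := glt_gt0 hpe p0.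
have hx := vrepresents_vclamp ha hb ab Xx hx0.
have MN0 : 0 < M + N + 1 + 1 by rewrite !addr_gt0.
have [ze [z [hz iz hzx]]] := interior_near Xx hx (vclamp_itv ab xe) MN0.
have [v hv] := vrepresents_deriv s (interior_in iz) hz.
have iv := interior_gderivative_of iz hz hv.
exists v; [apply: hq iv|apply: hp iv].
- apply: (gball_of N0 hz hx hqe hN).
  have := @le_gauge_powR R rho (N + 1 + 1) (M + N + 1 + 1).
  rewrite !lerD2r lerDr (ltW M0) => /(_ isT).
  by apply: filterS2 hzx => e h1 h2 i; exact: le_trans (h1 i) h2.
- apply: (gball_of M0 hz hx hpe hM).
  have := @le_gauge_powR R rho (M + 1 + 1) (M + N + 1 + 1).
  rewrite !lerD2r lerDl (ltW N0) => /(_ isT).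
  by apply: filterS2 hzx => e h1 h2 i; exact: le_trans (h1 i) h2.
Qed.

(** Makes the choice in [gderivative] harmless: on the whole slab, endpoints included, the
    derivative is computed by any defining net at any representative. *)
Lemma gderivative_rep x xe s : X x -> vrepresents x xe ->
  vrepresents (gderivative X f s x) (fun e => iter_partial s (fe e) (xe e)).
Proof.
move=> Xx hx; have [y hy] := vrepresents_deriv s Xx hx.
rewrite /gderivative (_ : xget _ _ = y)//; apply: xget_unique.
  exact: is_gderivative_rep Xx hx hy.
by move=> w; exact: is_gderivative_unique Xx hx hy.
Qed.

End Defining.
End SlabDerivative.

(** * Integrals of continuous real functions *)

Section RealIntegral.
Context {R : realType}.
Local Notation mu := (@lebesgue_measure R).
Implicit Types (x y z : R) (f g : R -> R).

Lemma integrable_itv x y f : {within `[x, y], continuous f} ->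
  mu.-integrable `[x, y] (EFin \o f).
Proof.
by move=> cf; apply: continuous_compact_integrable => //; exact: segment_compact.
Qed.

Lemma Rintegral_chasles x y z f : x <= y -> y <= z ->
  {within `[x, z], continuous f} ->
  \int[mu]_(t in `[x, z]) f t =
  \int[mu]_(t in `[x, y]) f t + \int[mu]_(t in `[y, z]) f t.
Proof.
move=> xy yz cf.
have := @Rintegral_itvB R f (BLeft x) (BRight z) y (integrable_itv cf).
rewrite !bnd_simp => /(_ xy yz).
rewrite Rintegral_itv_obnd_cbnd => [<-|]; first by rewrite addrC subrK.
have sub : `]y, z] `<=` `[x, z].
  by move=> t /=; rewrite !in_itv/= => /andP[/ltW /(le_trans xy) -> ->].
exact: integrableS (integrable_itv cf).
Qed.

Lemma Rintegral_le_bound x y f C : x <= y -> {within `[x, y], continuous f} ->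
  (forall t, x <= t <= y -> `|f t| <= C) ->
  `|\int[mu]_(t in `[x, y]) f t| <= C * (y - x).
Proof.
move=> xy cf fC; have fi := integrable_itv cf.
apply: (le_trans (le_normr_Rintegral _ fi)) => //.
have -> : C * (y - x) = \int[mu]_(t in `[x, y]) C.
  rewrite Rintegral_cst//= lebesgue_measure_itv/= lte_fin; case: ltP => //= yx.
  have -> : y = x by apply/eqP; rewrite eq_le yx.
  by rewrite subrr.
apply: le_Rintegral => //.
- exact: integrable_norm.
- by apply: (@integrable_itv _ _ (fun=> C)); apply: continuous_subspaceT; exact: cst_continuous.
Qed.


Lemma Rintegral_shrink x x' y y' f C : x <= x' -> x' <= y' -> y' <= y ->
  {within `[x, y], continuous f} -> (forall t, x <= t <= y -> `|f t| <= C) ->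
  `|\int[mu]_(t in `[x, y]) f t - \int[mu]_(t in `[x', y']) f t|
    <= C * ((x' - x) + (y - y')).
Proof.
move=> xx' xy' yy' cf fC.
have sub u v : x <= u -> v <= y -> {within `[u, v], continuous f}.
  move=> xu vy; apply: continuous_subspaceW cf => t /=; rewrite !in_itv/= => /andP[ut tv].
  by rewrite (le_trans xu ut) (le_trans tv vy).
rewrite (@Rintegral_chasles x x' y) ?(le_trans xy')//.
rewrite (@Rintegral_chasles x' y' y)//; last exact: sub.
set A := Rintegral _ _ _; set B := Rintegral _ _ _; set D := Rintegral _ _ _.
have -> : A + (B + D) - B = A + D by ring.
rewrite mulrDr; apply: (le_trans (ler_normD _ _)); apply: lerD.
- apply: Rintegral_le_bound => //; first by apply: sub; rewrite ?(le_trans xy').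
  by move=> t /andP[xt tx]; apply: fC; rewrite xt (le_trans tx)// (le_trans xy').
- apply: Rintegral_le_bound => //; first by apply: sub; rewrite ?(le_trans xx').
  by move=> t /andP[yt ty]; apply: fC; rewrite ty (le_trans _ yt)// (le_trans xx').
Qed.

End RealIntegral.

(** * Integrals along curves *)

Section CurveIntegral.
Context {R : realType} {rho : gauge R}.
Local Notation K := (gnum rho).
Local Notation small := ((0 : R)^'+).
Local Notation mu := (@lebesgue_measure R).
Context {a b : K} {ae be : R -> R}.
Hypotheses (ha : represents a ae) (hb : represents b be).
Hypothesis ab : forall e, ae e <= be e.

Lemma itv_box : exists2 M, 0 < M & forall M', M <= M' ->
  \forall e \near small, forall t, ae e <= t <= be e ->
    box rho ae be 0 M' e (const_mx t).
Proof.
have /moderateP[M M0 hM] := represents_moderate ha.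
have /moderateP[N N0 hN] := represents_moderate hb.
exists (M + N); first exact: addr_gt0.
move=> M' MM'.
have h1 := @le_gauge_powR R rho (- M') (- M) ltac:(lra).
have h2 := @le_gauge_powR R rho (- M') (- N) ltac:(lra).
near=> e => t tab; split=> [|i]; rewrite mxE//.
have : `|ae e| <= rho e `^ (- M) by near: e.
have : `|be e| <= rho e `^ (- N) by near: e.
have : rho e `^ (- M) <= rho e `^ (- M') by near: e.
have : rho e `^ (- N) <= rho e `^ (- M') by near: e.
by rewrite !ler_norml; lra.
Unshelve. all: by end_near. Qed.

Lemma const_mx_line (t : R) : const_mx t = 0 + t *: const_mx 1 :> 'rV[R]_1.
Proof. by apply/matrixP => i j; rewrite !mxE add0r mulr1. Qed.

Lemma const_mx00 T (x : 'rV[T]_1) : const_mx (x 0 0) = x.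
Proof. by apply/rowP => i; rewrite mxE ord1. Qed.

Lemma curve_continuous (Om : R -> set 'rV[R]_1) g : slab a b 0 `<=` strong_interior Om ->
  snet (slab a b 0) Om g ->
  \forall e \near small, {within `[ae e, be e], continuous (fun t => g e (const_mx t))}.
Proof.
move=> XO sg; have [M M0 hM] := itv_box.
apply: filterS3 ev_le1 (hM M (lexx M)) (box_Om ha hb ab M0 XO) => e e01 hB hO.
apply: derivable_within_continuous => t /[!in_itv] tab.
have dg : differentiable (g e) (0 + t *: const_mx 1).
  by rewrite -const_mx_line; apply: (snet_diff sg e01); apply: hO; exact: hB.
have E : (fun s : R => g e (const_mx s)) = (fun s => g e (0 + s *: const_mx 1)).
  by apply/funext => s; rewrite -const_mx_line.
by rewrite E; have [] := is_derive_line dg.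
Qed.

Lemma curve_bound (Om : R -> set 'rV[R]_1) g : slab a b 0 `<=` strong_interior Om ->
  snet (slab a b 0) Om g -> exists2 N, 0 < N &
  \forall e \near small, forall t, ae e <= t <= be e -> `|g e (const_mx t)| <= rho e `^ (- N).
Proof.
move=> XO sg; have [M M0 hM] := itv_box.
have [N N0 hN] := box_bound ha hb ab M0 sg; exists N => //.
by apply: filterS2 (hM M (lexx M)) hN => e hB hN' t /hB/hN'.
Qed.

Lemma curve_negligible (g : R -> 'rV[R]_1 -> R) N : 0 < N ->
  (forall x xe, slab a b 0 x -> vrepresents x xe -> negligible rho (fun e => g e (xe e))) ->
  \forall e \near small, forall t, ae e <= t <= be e -> `|g e (const_mx t)| <= rho e `^ N.
Proof.
move=> N0 h; have [M M0 hM] := itv_box.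
by apply: filterS2 (hM M (lexx M)) (box_negligible ha hb ab M0 N0 h) => e hB hN' t /hB/hN'.
Qed.

Lemma moderate_integral (Om : R -> set 'rV[R]_1) g : slab a b 0 `<=` strong_interior Om ->
  snet (slab a b 0) Om g ->
  moderate rho (fun e => \int[mu]_(t in `[ae e, be e]) g e (const_mx t)).
Proof.
move=> XO sg; have [N N0 hN] := curve_bound XO sg.
have m := moderateM (moderate_powR (- N)) (represents_moderate (representsB hb ha)).
apply: (moderate_le m); apply: filterS2 hN (curve_continuous XO sg) => e hN' hc.
rewrite [leRHS]ger0_norm ?mulr_ge0 ?powR_ge0 ?subr_ge0//.
exact: Rintegral_le_bound.
Qed.

Lemma integral_shrink (Om : R -> set 'rV[R]_1) g (ae' be' : R -> R) :
  slab a b 0 `<=` strong_interior Om -> snet (slab a b 0) Om g ->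
  represents a ae' -> represents b be' ->
  (\forall e \near small, [/\ ae e <= ae' e, ae' e <= be' e & be' e <= be e]) ->
  negligible rho (fun e => \int[mu]_(t in `[ae e, be e]) g e (const_mx t) -
    \int[mu]_(t in `[ae' e, be' e]) g e (const_mx t)).
Proof.
move=> XO sg ha' hb' h; have [N N0 hN] := curve_bound XO sg.
have n0 := negligibleMl (moderate_powR (- N))
  (negligibleD (represents_negligible ha' ha) (represents_negligible hb hb')).
apply: (negligible_le n0).
apply: filterS3 h hN (curve_continuous XO sg) => e [h1 h2 h3] hN' hc.
rewrite [leRHS]ger0_norm; first exact: Rintegral_shrink.
by rewrite mulr_ge0 ?powR_ge0//; apply: addr_ge0; rewrite subr_ge0.
Qed.

Lemma integral_negligible (Om : R -> set 'rV[R]_1) (f g : R -> 'rV[R]_1 -> R) Om' :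
  slab a b 0 `<=` strong_interior Om -> snet (slab a b 0) Om f ->
  slab a b 0 `<=` strong_interior Om' -> snet (slab a b 0) Om' g ->
  (forall x xe, slab a b 0 x -> vrepresents x xe ->
     negligible rho (fun e => f e (xe e) - g e (xe e))) ->
  negligible rho (fun e => \int[mu]_(t in `[ae e, be e]) f e (const_mx t) -
    \int[mu]_(t in `[ae e, be e]) g e (const_mx t)).
Proof.
move=> XO sf XO' sg fg; have cf := curve_continuous XO sf; have cg := curve_continuous XO' sg.
have /moderateP[L L0 hL] := represents_moderate (representsB hb ha).
apply/negligibleP => N N0.
have hfg := @curve_negligible (fun e x => f e x - g e x) (N + L) (addr_gt0 N0 L0) fg.
near=> e.
have r0 : 0 < rho e by near: e; exact: gauge_gt0.
have cfe : {within `[ae e, be e], continuous (fun t => f e (const_mx t))} by near: e.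
have cge : {within `[ae e, be e], continuous (fun t => g e (const_mx t))} by near: e.
rewrite -RintegralB//; [|exact: integrable_itv..].
have cfg : {within `[ae e, be e], continuous (fun t => f e (const_mx t) - g e (const_mx t))}.
  by move=> t; apply: continuousB; [exact: cfe|exact: cge].
have hb1 : forall t, ae e <= t <= be e ->
  `|f e (const_mx t) - g e (const_mx t)| <= rho e `^ (N + L) by near: e.
apply: (le_trans (Rintegral_le_bound (ab e) cfg hb1)).
have hba : `|be e - ae e| <= rho e `^ (- L) by near: e.
have -> : rho e `^ N = rho e `^ (N + L) * rho e `^ (- L).
  by rewrite -powRD ?(gt_eqF r0) ?implybT// addrK.
by rewrite ler_wpM2l ?powR_ge0// (le_trans (ler_norm _)).
Unshelve. all: by end_near. Qed.

End CurveIntegral.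

Section Gintegral.
Context {R : realType} {rho : gauge R}.
Local Notation K := (gnum rho).
Local Notation small := ((0 : R)^'+).
Local Notation mu := (@lebesgue_measure R).
Context {a b : K} {ae be : R -> R}.
Hypotheses (ha : represents a ae) (hb : represents b be).
Hypothesis ab : forall e, ae e <= be e.
Context {gap : R}.
Hypotheses (gap0 : 0 < gap)
  (hgap : \forall e \near small, ae e + rho e `^ gap <= be e).

Lemma represents_min (x : K) xe ye : represents x xe -> represents x ye ->
  represents x (fun e => Num.min (xe e) (ye e)).
Proof.
move=> hx hy; apply: (represents_congr hx).
apply: (negligible_le (represents_negligible hx hy)); apply: nearW => e.
rewrite /Num.min; case: ifP => _; first by rewrite subrr normr0.
by rewrite distrC.
Qed.

Lemma represents_max2 (x : K) xe ye : represents x xe -> represents x ye ->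
  represents x (fun e => Num.max (xe e) (ye e)).
Proof.
move=> hx hy; apply: (represents_congr hx).
apply: (negligible_le (represents_negligible hx hy)); apply: nearW => e.
rewrite /Num.max; case: ifP => _; last by rewrite subrr normr0.
by rewrite distrC.
Qed.

(** The value depends neither on the defining net nor on the representatives of the endpoints: both
    intervals are enlarged to [[lo e, hi e]], which still represents the interval from [a] to [b],
    the integrands are exchanged there, and the intervals are cut back, each time with a negligible
    error. *)
Lemma gintegral_rep (f : K -> K) Om fe :
  defines (gitv1 a b) Om fe (of_curve (fun t => const_mx (f t) : 'rV[K]_1)) ->
  represents (gintegral a b f)
    (fun e => \int[mu]_(t in `[ae e, be e]) (fe e (const_mx t) 0 0 : R)).
Proof.
move=> hf; have [oO XO sf hfx] := (definesE _ _ _ _).1 hf.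
have hy := represents_gclass (rho := rho) (moderate_integral ha hb ab XO (sf 0)).
rewrite /gintegral (_ : xget _ _ = gclass (fun e => \int[mu]_(t in `[ae e, be e]) (fe e (const_mx t) 0 0 : R)))//.
apply: xget_unique; first by exists Om, fe, ae, be; split.
move=> w [Om' [fe' [ae' [be' [hf' ha' hb' hw]]]]].
have [oO' XO' sf' hfx'] := (definesE _ _ _ _).1 hf'.
pose lo e := Num.min (ae e) (ae' e); pose hi e := Num.max (be e) (be' e).
have hlo : represents a lo := represents_min ha ha'.
have hhi : represents b hi := represents_max2 hb hb'.
have lohi e : lo e <= hi e.
  by rewrite /lo /hi ge_min le_max ab.
have n1 := integral_shrink hlo hhi lohi XO (sf 0) ha hb.
have n2 := integral_shrink hlo hhi lohi XO' (sf' 0) ha' hb'.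
have n3 := integral_negligible hlo hhi lohi XO' (sf' 0) XO (sf 0).
apply: (represents_eq hw hy).
have h1 : \forall e \near small, [/\ lo e <= ae e, ae e <= be e & be e <= hi e].
  by apply: nearW => e; rewrite /lo /hi ge_min le_max ab !lexx.
(* Other representatives of the endpoints are in the right order only for [e] small, where the gap
   exceeds the negligible differences. *)
have h2 : \forall e \near small, [/\ lo e <= ae' e, ae' e <= be' e & be' e <= hi e].
  have /negligibleP/(_ (gap + 1) (addr_gt0 gap0 ltr01)) k1 := represents_negligible ha ha'.
  have /negligibleP/(_ (gap + 1) (addr_gt0 gap0 ltr01)) k2 := represents_negligible hb hb'.
  near=> e; rewrite /lo /hi ge_min le_max !lexx !orbT; split=> //.
  have : `|ae e - ae' e| <= rho e `^ (gap + 1) by near: e.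
  have : `|be e - be' e| <= rho e `^ (gap + 1) by near: e.
  have : ae e + rho e `^ gap <= be e by near: e.
  have : 2 * rho e `^ (gap + 1) <= rho e `^ gap by near: e; exact: powR2_small.
  by rewrite !ler_norml; lra.
have h3 x xe : slab a b 0 x -> vrepresents x xe ->
    negligible rho (fun e => fe' e (xe e) 0 0 - fe e (xe e) 0 0).
  by move=> Xx hx; exact: represents_negligible (hfx' x xe Xx hx 0) (hfx x xe Xx hx 0).
have m1 := n1 h1; have m2 := n2 h2; have m3 := n3 h3.
have opp (g : R -> R) : negligible rho g -> negligible rho (fun e => - g e).
  by move=> n; apply: (negligible_le n); apply: nearW => e; rewrite normrN.
apply: (negligible_le (negligibleD (opp _ m2) (negligibleD m3 m1))).
by apply: nearW => e; rewrite le_eqVlt; apply/orP; left; apply/eqP; congr (`|_|); ring.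
Unshelve. all: by end_near. Qed.

End Gintegral.

(** * The action functional on representatives *)

Section Action.
Context {R : realType} {rho : gauge R}.
Local Notation K := (gnum rho).
Local Notation small := ((0 : R)^'+).
Local Notation mu := (@lebesgue_measure R).
Context {a b : K} {ae be : R -> R}.
Hypotheses (ha : represents a ae) (hb : represents b be).
Hypothesis ab : forall e, ae e <= be e.
Context {gap : R}.
Hypotheses (gap0 : 0 < gap)
  (hgap : \forall e \near small, ae e + rho e `^ gap <= be e).
Variable d : nat.
Implicit Types (F : K -> 'rV[K]_d -> 'rV[K]_d -> K) (u v : K -> 'rV[K]_d).

Lemma lagrangian_domainE : lagrangian_domain (d := d) a b = slab a b (d + d).
Proof.
apply/seteqP; split=> z /=.
  move=> [t [v [v' [tab ->]]]]; rewrite /slab/= (_ : jet _ _ _ _ _ = t)//.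
  rewrite /jet (_ : 0 = lshift (d + d) (0 : 'I_1)); last exact: val_inj.
  by rewrite row_mxEl mxE.
move=> zab; exists (z 0 0), (lsubmx (rsubmx (z : 'rV_(1 + (d + d))))),
  (rsubmx (rsubmx (z : 'rV_(1 + (d + d))))).
split=> //; rewrite /jet hsubmxK -[LHS](@hsubmxK _ 1 1 (d + d)); congr row_mx.
apply/rowP => i; rewrite !mxE ord1; congr (z 0 _); exact: val_inj.
Qed.

Definition rjet (w : 'rV[R]_1 -> 'rV[R]_d) (x : 'rV[R]_1) : 'rV[R]_(1 + (d + d)) :=
  row_mx x (row_mx (w x) (iter_partial [:: 0] w x)).

Lemma of_lagrangian_jet F t (w w' : 'rV[K]_d) :
  of_lagrangian F (jet t w w') = const_mx (F t w w').
Proof. by rewrite /of_lagrangian /jet !(row_mxKl, row_mxKr) mxE. Qed.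

Section Curve.
Context {OmF : R -> set 'rV[R]_(1 + (d + d))} {Fe : R -> 'rV[R]_(1 + (d + d)) -> 'rV[R]_1}
  {F : K -> 'rV[K]_d -> 'rV[K]_d -> K}.
Hypothesis hF : defines (slab a b (d + d)) OmF Fe (of_lagrangian F).
Context {Ov : R -> set 'rV[R]_1} {ve : R -> 'rV[R]_1 -> 'rV[R]_d} {v : K -> 'rV[K]_d}.
Hypothesis hv : defines (slab a b 0) Ov ve (of_curve v).

Lemma jet_represents (x : 'rV[K]_1) xe : slab a b 0 x -> vrepresents x xe ->
  vrepresents (jet (x 0 0) (v (x 0 0)) (curve_derivative a b 1 v (x 0 0)))
    (fun e => rjet (ve e) (xe e)).
Proof.
move=> Xx hx i; rewrite /jet /rjet.
have [oO XO sf hvx] := (definesE _ _ _ _).1 hv.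
case: (split_ordP i) => [j ->|j ->].
  rewrite row_mxEl mxE (_ : (fun e => _) = fun e => xe e 0 0); first exact: hx.
  by apply/funext => e; rewrite row_mxEl ord1.
rewrite row_mxEr (_ : (fun e => _) = fun e =>
    row_mx (ve e (xe e)) (iter_partial [:: 0] (ve e) (xe e)) 0 j); last first.
  by apply/funext => e; rewrite row_mxEr.
case: (split_ordP j) => [l ->|l ->].
  rewrite row_mxEl (_ : (fun e => _) = fun e => ve e (xe e) 0 l).
    exact: hvx.
  by apply/funext => e; rewrite row_mxEl.
rewrite row_mxEr (_ : (fun e => _) = fun e => iter_partial [:: 0] (ve e) (xe e) 0 l).
  have := gderivative_rep ha hb ab gap0 hgap hv [:: 0] Xx hx l.
  by rewrite /curve_derivative const_mx00.
by apply/funext => e; rewrite row_mxEr.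
Qed.

Lemma jet_in (x : 'rV[K]_1) : slab a b 0 x ->
  slab a b (d + d) (jet (x 0 0) (v (x 0 0)) (curve_derivative a b 1 v (x 0 0))).
Proof.
move=> Xx; rewrite -lagrangian_domainE.
by exists (x 0 0), (v (x 0 0)), (curve_derivative a b 1 v (x 0 0)).
Qed.

Definition jet_dom e : set 'rV[R]_1 := [set x | Ov e x /\ OmF e (rjet (ve e) x)].

Lemma rjet_coord_diff e x i : 0 < e <= 1 -> Ov e x ->
  differentiable (fun y => rjet (ve e) y 0 i) x.
Proof.
move=> e01 Ox; have [dv _ _] := hv; have [opn smo] := dv e e01.
case: (split_ordP i) => [j ->|j ->].
  have -> : (fun y => rjet (ve e) y 0 (lshift (d + d) j)) = fun y : 'rV[R]_1 => y 0 j.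
    by apply/funext => y; rewrite /rjet row_mxEl.
  exact: differentiable_coord.
case: (split_ordP j) => [l ->|l ->].
  have -> : (fun y => rjet (ve e) y 0 (rshift 1 (lshift d l))) = fun y => ve e y 0 l.
    by apply/funext => y; rewrite /rjet row_mxEr row_mxEl.
  by have /differentiable_coords := smo [::] x Ox; apply.
have -> : (fun y => rjet (ve e) y 0 (rshift 1 (rshift d l))) =
    fun y => iter_partial [:: 0] (ve e) y 0 l.
  by apply/funext => y; rewrite /rjet row_mxEr row_mxEr.
by have /differentiable_coords := smo [:: 0] x Ox; apply.
Qed.

Lemma jet_dom_open e : 0 < e <= 1 -> open (jet_dom e).
Proof.
move=> e01; have [dv _ _] := hv; have [opn smo] := dv e e01.
have [dF _ _] := hF; have [opnF smoF] := dF e e01.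
rewrite openE => x [Ox OFx]; rewrite /interior.
have h1 : nbhs x (Ov e) by exact: open_nbhs_nbhs.
have h2 : nbhs x [set y | OmF e (rjet (ve e) y)].
  have /differentiable_continuous cj : differentiable (rjet (ve e)) x.
    by apply/differentiable_coords => i; exact: rjet_coord_diff.
  by apply: cj; exact: open_nbhs_nbhs.
by apply: filterS2 h1 h2 => y.
Qed.

Lemma jet_dom_strong : slab a b 0 `<=` strong_interior jet_dom.
Proof.
move=> x Xx xe hx; have [_ XO _] := hv; have [_ XF _] := hF.
apply: filterS2 (XO x Xx xe hx) (XF _ (jet_in Xx) _ (jet_represents Xx hx)) => e.
by split.
Qed.

Lemma snet_jet i : snet (slab a b 0) jet_dom (fun e x => rjet (ve e) x 0 i).
Proof.
have [oO XO sf hvx] := (definesE _ _ _ _).1 hv.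
have sub g : snet (slab a b 0) Ov g -> snet (slab a b 0) jet_dom g.
  by apply: snet_sub => // e _ x [].
move=> m.
case: (split_ordP i) => [j ->|j ->].
  apply: smooth_net_congr (smooth_net_coord _ _ m j) => [e e01||e _ x _];
    [exact: jet_dom_open|exact: jet_dom_strong|].
  by rewrite /rjet row_mxEl.
case: (split_ordP j) => [l ->|l ->].
  apply: smooth_net_congr (sub _ (sf l) m) => [e e01||e _ x _];
    [exact: jet_dom_open|exact: jet_dom_strong|].
  by rewrite /rjet row_mxEr row_mxEl.
apply: smooth_net_congr (sub _ (snet_word [:: 0] (sf l)) m) => [e e01||e e01 x [Ox _]].
- exact: jet_dom_open.
- exact: jet_dom_strong.
have [dv _ _] := hv; have [opn smo] := dv e e01.
by rewrite -(iter_partial_coord [:: 0] l opn smo Ox) /rjet row_mxEr row_mxEr.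
Qed.

Lemma snet_jet_comp (g : R -> 'rV[R]_(1 + (d + d)) -> R) :
  snet (slab a b (d + d)) OmF g ->
  snet (slab a b 0) jet_dom (fun e x => g e (rjet (ve e) x)).
Proof.
move=> sg; apply: (@snet_comp _ _ 1 (d + d).+1 _ _ (slab a b (d + d)) OmF) => //.
- exact: jet_dom_open.
- exact: jet_dom_strong.
- exact: snet_jet.
- by move=> e x _ [].
- by move=> x xe Xx hx; eexists; [exact: (jet_in Xx)|exact: jet_represents].
Qed.

(** The net of [F] composed with the real jets of [ve] is a defining net of the integrand, so that
    the action is the class of real integrals. *)
Lemma action_rep : represents (action_functional a b F v)
  (fun e => \int[mu]_(t in `[ae e, be e]) (Fe e (rjet (ve e) (const_mx t)) 0 0 : R)).
Proof.
have [oF XF sF hFx] := (definesE _ _ _ _).1 hF.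
apply: (@gintegral_rep _ _ _ _ _ _ ha hb ab _ gap0 hgap _ jet_dom
  (fun e x => Fe e (rjet (ve e) x))).
apply/definesE; split.
- exact: jet_dom_open.
- exact: jet_dom_strong.
- by move=> j; apply: (@snet_jet_comp (fun e y => Fe e y 0 j)); exact: sF.
- move=> x xe Xx hx; have := hFx _ _ (jet_in Xx) (jet_represents Xx hx).
  by rewrite of_lagrangian_jet.
Qed.

End Curve.
End Action.

(** * Perturbations of a minimizer *)

Section Perturbation.
Context {R : realType} {rho : gauge R}.
Local Notation K := (gnum rho).
Local Notation small := ((0 : R)^'+).
Local Notation mu := (@lebesgue_measure R).

Lemma definesD n k (X : set 'rV[K]_n) Om (fe ge : R -> 'rV[R]_n -> 'rV[R]_k) f g :
  defines X Om fe f -> defines X (fun=> setT) ge g ->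
  defines X Om (fun e x => fe e x + ge e x) (fun x => f x + g x).
Proof.
move=> /definesE[oO XO sf hf] /definesE[_ _ sg hg]; apply/definesE; split=> //.
- move=> j m; have sg' : snet X Om (fun e x => ge e x 0 j) by apply: snet_sub (sg j).
  apply: smooth_net_congr (smooth_netD oO XO (sf j m) (sg' m)) => // e _ x _.
  by rewrite mxE.
- move=> x xe Xx hx j; have := representsD (hf x xe Xx hx j) (hg x xe Xx hx j).
  rewrite mxE; congr (represents _ _); apply/funext => e; by rewrite mxE.
Qed.

Context {a b : K} {ae be : R -> R}.
Hypotheses (ha : represents a ae) (hb : represents b be).
Hypothesis ab : forall e, ae e <= be e.
Context {gap : R}.
Hypotheses (gap0 : 0 < gap)
  (hgap : \forall e \near small, ae e + rho e `^ gap <= be e).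
Variable d : nat.

(** Evaluated at the representative chosen by [grep]; by [curve_of_rep] any other representative of
    a point of the interval gives the same value when [he] is a smooth net. *)
Definition curve_of (he : R -> 'rV[R]_1 -> 'rV[R]_d) : K -> 'rV[K]_d :=
  fun t => \row_j gclass (fun e => he e (const_mx (grep t e)) 0 j).

Lemma vrepresents_const t te : represents t te ->
  vrepresents (const_mx t : 'rV[K]_1) (fun e => const_mx (te e)).
Proof.
move=> ht i; rewrite mxE (_ : (fun e => _) = te)//.
by apply/funext => e; rewrite mxE.
Qed.

Lemma slab_const t : gitv a b t -> slab a b 0 (const_mx t).
Proof. by move=> tab; rewrite /slab/= mxE. Qed.

Lemma curve_of_rep (he : R -> 'rV[R]_1 -> 'rV[R]_d) t te : (forall j, snet (slab a b 0) (fun=> setT) (fun e x => he e x 0 j)) ->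
  gitv a b t -> represents t te ->
  vrepresents (curve_of he t) (fun e => he e (const_mx (te e))).
Proof.
move=> sh tab ht j; rewrite mxE.
have hc := vrepresents_const (represents_grep t).
apply: (represents_congr (represents_gclass (snet_mod (sh j) (slab_const tab) hc))).
have XO : slab a b 0 `<=` strong_interior (fun=> setT) by move=> x _ xe _; exact: nearW.
exact: snet_rep_change XO (sh j) (slab_const tab) hc (vrepresents_const ht).
Qed.

Lemma defines_curve_of (he : R -> 'rV[R]_1 -> 'rV[R]_d) :
  (forall j, snet (slab a b 0) (fun=> setT) (fun e x => he e x 0 j)) ->
  defines (slab a b 0) (fun=> setT) he (of_curve (curve_of he)).
Proof.
move=> sh; apply/definesE; split=> //.
- by move=> e _; exact: openT.
- by move=> x _ xe _; exact: nearW.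
- move=> x xe Xx hx; have := curve_of_rep sh Xx (hx 0).
  by congr vrepresents; apply/funext => e; rewrite const_mx00.
Qed.

Lemma Cnorm_lt Ow (he : R -> 'rV[R]_1 -> 'rV[R]_d) w r re N m : defines (slab a b 0) Ow he (of_curve w) ->
  represents r re -> 0 < N -> (\forall e \near small, rho e `^ N <= re e) ->
  (forall n (j : 'I_d), (n <= m)%N -> \forall e \near small, forall t, ae e <= t <= be e ->
    `|word_der (nseq n 0) (fun x => he e x 0 j) (const_mx t)| <= rho e `^ (N + 1)) ->
  Cnorm a b m w <~ r.
Proof.
move=> hw hr N0 hN hd.
have r0 : 0 <~ r.
  apply/(glt_ev (represents0 (rho := rho)) hr); exists N => //.
  by apply: filterS hN => e; rewrite add0r.
(* If the set of norms is empty, [xget] returns the default 0, which is below [r] too. Otherwise the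
   norm is a finite maximum of absolute values taken at points of the interval, and each of them is
   small. *)
rewrite /Cnorm; case: xgetP => [y _|//]; move=> [M1 [M2 [h1 h2 ->]]].
have key n j t : (n <= m)%N -> gitv a b t ->
    gabs (curve_derivative a b n w t 0 j) <~ r.
  move=> nm tab.
  have ht := represents_clamp ha hb ab tab (represents_grep t).
  have hc := vrepresents_const ht.
  have hg := gderivative_rep ha hb ab gap0 hgap hw (nseq n 0) (slab_const tab) hc.
  apply/(glt_ev (represents_abs (hg j)) hr); exists (N + 1); first exact: addr_gt0.
  have d1 : \forall e \near small,
      iter_partial (nseq n 0) (he e) (const_mx (clamp ae be e (grep t e))) 0 j =
      word_der (nseq n 0) (fun x => he e x 0 j) (const_mx (clamp ae be e (grep t e))).
    by apply: filterS (defines_deriv (nseq n 0) hw (slab_const tab) hc) => e; apply.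
  have hk := hd n j nm.
  near=> e.
  have -> : iter_partial (nseq n 0) (he e) (const_mx (clamp ae be e (grep t e))) 0 j =
      word_der (nseq n 0) (fun x => he e x 0 j) (const_mx (clamp ae be e (grep t e))).
    by near: e.
  have k : forall t, ae e <= t <= be e ->
    `|word_der (nseq n 0) (fun x => he e x 0 j) (const_mx t)| <= rho e `^ (N + 1).
    by near: e; exact: hk.
  have := k _ (clamp_itv ab e (grep t e)).
  have : 2 * rho e `^ (N + 1) <= rho e `^ N by near: e; exact: powR2_small.
  have : rho e `^ N <= re e by near: e.
  by move: `|_| => A; lra.
apply: big_gmax_lt => // n; apply: big_gmax_lt => // j.
have nm : (n <= m)%N by rewrite -ltnS.
have [M1ab _] := h1 n j nm; have [M2ab _] := h2 n j nm.
by apply: gmax_lt; exact: key.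
Unshelve. all: by end_near. Qed.

(** Minimality read on real integrals. The neighbourhood of [u] enters through [m] and [N], which
    are fixed before the perturbation [he] is chosen. As [he] has to be admissible as a whole net,
    the inequality is available at every small [e], and not only along a selected sequence. *)
Lemma minimizer_perturb OmF Fe (F : K -> 'rV[K]_d -> 'rV[K]_d -> K) Ou ue u :
  defines (slab a b (d + d)) OmF Fe (of_lagrangian F) ->
  defines (slab a b 0) Ou ue (of_curve u) ->
  local_minimizer a b (action_functional a b F) (u a) (u b) u ->
  exists m N, 0 < N /\ forall he : R -> 'rV[R]_1 -> 'rV[R]_d,
    (forall j, snet (slab a b 0) (fun=> setT) (fun e x => he e x 0 j)) ->
    (forall j, negligible rho (fun e => he e (const_mx (ae e)) 0 j)) ->
    (forall j, negligible rho (fun e => he e (const_mx (be e)) 0 j)) ->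
    (forall n (j : 'I_d), (n <= m)%N -> \forall e \near small, forall t, ae e <= t <= be e ->
      `|word_der (nseq n 0) (fun x => he e x 0 j) (const_mx t)| <= rho e `^ N) ->
    forall P, 0 < P -> \forall e \near small,
      \int[mu]_(t in `[ae e, be e]) (Fe e (rjet (ue e) (const_mx t)) 0 0 : R) <=
      \int[mu]_(t in `[ae e, be e]) (Fe e (rjet (fun x => ue e x + he e x) (const_mx t)) 0 0 : R)
        + rho e `^ P.
Proof.
move=> hF hu [_ [r [m [r0 hmin]]]].
have hr := represents_grep r; have [N N0 hN] := glt_gt0 hr r0.
exists m, (N + 1); split=> [|he sh hea heb hd]; first exact: addr_gt0.
have hc := defines_curve_of sh.
have aab : gitv a b a.
  apply: (gitv_of ha hb ha); apply: nearW => e; by rewrite lexx ab.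
have bab : gitv a b b.
  apply: (gitv_of ha hb hb); apply: nearW => e; by rewrite lexx ab.
have cz t te : gitv a b t -> represents t te ->
    (forall j, negligible rho (fun e => he e (const_mx (te e)) 0 j)) -> curve_of he t = 0.
  move=> tab ht hn; apply/rowP => j; have := curve_of_rep sh tab ht j.
  rewrite [RHS]mxE => hj; apply: (represents_eq hj (represents0 (rho := rho))).
  by have := hn j; congr negligible; apply/funext => e; rewrite subr0.
pose v := u + curve_of he.
have hv : defines (slab a b 0) Ou (fun e x => ue e x + he e x) (of_curve v).
  exact: definesD hu hc.
have GCv : GCinf_curve a b v by split=> //; exists Ou, (fun e x => ue e x + he e x).
have Iuv : action_functional a b F u <=~ action_functional a b F v.
  apply: hmin.
    split=> //; have -> : v - u = curve_of he by rewrite /v addrC addKr.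
    exact: (Cnorm_lt hc hr N0 hN).
  split=> //.
    by rewrite /v -[LHS]/(u a + curve_of he a) (cz a ae)// addr0.
  by rewrite /v -[LHS]/(u b + curve_of he b) (cz b be)// addr0.
have hIu := action_rep ha hb ab gap0 hgap hF hu.
have hIv := action_rep ha hb ab gap0 hgap hF hv.
exact: (gle_ev hIu hIv).1 Iuv.
Qed.

End Perturbation.

(** * Oscillating bumps *)

Section RealEstimates.
Context {R : realType}.
Local Notation mu := (@lebesgue_measure R).
Implicit Types (x y z t s : R).

Lemma MVT_le (f df : R -> R) x y B : x <= y ->
  (forall t, x <= t <= y -> is_derive t 1 f (df t)) ->
  (forall t, x <= t <= y -> df t <= B) -> f y - f x <= B * (y - x).
Proof.
move=> xy fd fB.
have [|t /[!in_itv]/andP[/ltW xt /ltW ty]||c] := @MVT_segment R f df x y.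
- exact: xy.
- by apply: fd; rewrite xt ty.
- apply: derivable_within_continuous => t /[!in_itv] txy.
  by have [] := fd t txy.
rewrite in_itv => cxy ->; rewrite ler_wpM2r ?subr_ge0//; exact: fB.
Qed.

(** The auxiliary function [g] is non-increasing on [[0, 1]]: its derivative
    [df t - df (- t) - 2 B t] is at most 0 by the mean value theorem. The bound is one-sided in
    order to keep the sign of the Legendre form. *)
Lemma second_difference (f df ddf : R -> R) B :
  (forall t, -1 <= t <= 1 -> is_derive t 1 f (df t)) ->
  (forall t, -1 <= t <= 1 -> is_derive t 1 df (ddf t)) ->
  (forall t, -1 <= t <= 1 -> ddf t <= B) ->
  f 1 + f (-1) - 2 * f 0 <= B.
Proof.
move=> d1 d2 dB.
pose g t := f t + f (- t) - B * t ^+ 2.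
pose dg t := df t - df (- t) - B * (2 * t).
have gd t : 0 <= t <= 1 -> is_derive t 1 g (dg t).
  move=> /andP[t0 t1].
  have fd : is_derive t 1 f (df t) by apply: d1; lra.
  have fd' : is_derive (- t) 1 f (df (- t)) by apply: d1; lra.
  have h1 : is_derive t 1 (f \o -%R) (df (- t) * -1) by exact: is_derive1_comp.
  have h2 : is_derive t 1 (fun s => B * s ^+ 2) (B * (2 * t)).
    by apply: is_derive_eq; rewrite /GRing.scale/=; ring.
  rewrite (_ : g = f + (f \o -%R) - (fun s => B * s ^+ 2)); last exact/funext.
  by apply: is_derive_eq; rewrite /dg; ring.
have : g 1 - g 0 <= 0 * (1 - 0).
  apply: (@MVT_le g dg) => //.
  move=> t /andP[t0 t1].
  have : df t - df (- t) <= B * (t - - t).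
    apply: (@MVT_le df ddf); first lra.
      by move=> s /andP[s0 s1]; apply: d2; lra.
    by move=> s /andP[s0 s1]; apply: dB; lra.
  by rewrite /dg; lra.
by rewrite /g oppr0 expr0n/= expr1n; lra.
Qed.

Lemma Rintegral_le_cst x y (f : R -> R) B : x <= y ->
  {within `[x, y], continuous f} -> (forall t, x <= t <= y -> f t <= B) ->
  \int[mu]_(t in `[x, y]) f t <= B * (y - x).
Proof.
move=> xy cf fB.
have -> : B * (y - x) = \int[mu]_(t in `[x, y]) B.
  rewrite Rintegral_cst//= lebesgue_measure_itv/= lte_fin; case: ltP => //= yx.
  have -> : y = x by apply/eqP; rewrite eq_le yx.
  by rewrite subrr.
apply: le_Rintegral => //.
- exact: integrable_itv.
- by apply: (@integrable_itv _ _ _ (fun=> B)); apply: continuous_subspaceT; exact: cst_continuous.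
Qed.

Definition bump (c k t : R) := expR (- ((t - c) * k) ^+ 2).
Definition cos_bump c k w t := bump c k t * cos (w * (t - c)).
Definition sin_bump c k w t := bump c k t * sin (w * (t - c)).

Definition dcos_bump c k w t :=
  bump c k t * (- (2 * k ^+ 2 * (t - c)) * cos (w * (t - c)) - w * sin (w * (t - c))).
Definition dsin_bump c k w t :=
  bump c k t * (- (2 * k ^+ 2 * (t - c)) * sin (w * (t - c)) + w * cos (w * (t - c))).

Lemma bump_gt0 c k t : 0 < bump c k t.
Proof. exact: expR_gt0. Qed.

Lemma is_derive_bump c k t :
  is_derive t 1 (bump c k) (bump c k t * - (2 * k ^+ 2 * (t - c))).
Proof.
by rewrite /bump; apply: is_derive_eq; rewrite /GRing.scale/=; ring.
Qed.

Lemma is_derive_cos_bump c k w t :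
  is_derive t 1 (cos_bump c k w) (dcos_bump c k w t).
Proof.
have h := is_derive_bump c k t.
rewrite /cos_bump /dcos_bump; apply: is_derive_eq; rewrite /GRing.scale/=; ring.
Qed.

Lemma is_derive_sin_bump c k w t :
  is_derive t 1 (sin_bump c k w) (dsin_bump c k w t).
Proof.
have h := is_derive_bump c k t.
rewrite /sin_bump /dsin_bump; apply: is_derive_eq; rewrite /GRing.scale/=; ring.
Qed.

Lemma sum_sqr_bump c k w t :
  cos_bump c k w t ^+ 2 + sin_bump c k w t ^+ 2 = bump c k t ^+ 2.
Proof. by rewrite /cos_bump /sin_bump !exprMn -mulrDr cos2Dsin2 mulr1. Qed.

(** The cross terms [2 U w cos sin] of the two squares have opposite signs and cancel. *)
Lemma sum_sqr_dbump c k w t :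
  dcos_bump c k w t ^+ 2 + dsin_bump c k w t ^+ 2 =
  bump c k t ^+ 2 * (w ^+ 2 + (2 * k ^+ 2 * (t - c)) ^+ 2).
Proof.
rewrite /dcos_bump /dsin_bump; set U := 2 * k ^+ 2 * (t - c).
rewrite ![(bump c k t * _) ^+ 2]exprMn -mulrDr; congr (_ * _).
have := cos2Dsin2 (w * (t - c)); set C := cos _; set S := sin _ => CS.
by rewrite -[RHS]mulr1 -CS; ring.
Qed.

Lemma bump_le1 c k t : bump c k t <= 1.
Proof. by rewrite /bump -expR0 ler_expR oppr_le0 sqr_ge0. Qed.

Lemma cos_abs_le1 x : `|cos x| <= 1.
Proof. by rewrite ler_norml cos_geN1 cos_le1. Qed.

Lemma sin_abs_le1 x : `|sin x| <= 1.
Proof. by rewrite ler_norml sin_geN1 sin_le1. Qed.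

Lemma cos_bump_le c k w t : `|cos_bump c k w t| <= bump c k t.
Proof.
by rewrite /cos_bump normrM (gtr0_norm (bump_gt0 _ _ _)) ler_piMr ?cos_abs_le1// ltW ?bump_gt0.
Qed.

Lemma sin_bump_le c k w t : `|sin_bump c k w t| <= bump c k t.
Proof.
by rewrite /sin_bump normrM (gtr0_norm (bump_gt0 _ _ _)) ler_piMr ?sin_abs_le1// ltW ?bump_gt0.
Qed.

Lemma dcos_bump_le c k w t : 0 <= w -> `|2 * k ^+ 2 * (t - c)| <= w ->
  `|dcos_bump c k w t| <= 2 * w * bump c k t.
Proof.
move=> w0 hw; rewrite /dcos_bump; move: hw; set U := 2 * k ^+ 2 * (t - c) => hw.
rewrite normrM (gtr0_norm (bump_gt0 _ _ _)) mulrC.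
rewrite ler_wpM2r ?(ltW (bump_gt0 _ _ _))//; apply: (le_trans (ler_normB _ _)).
rewrite !normrM normrN mulr_natl mulr2n; apply: lerD.
  by rewrite -[leRHS]mulr1 ler_pM ?cos_abs_le1.
by rewrite (ger0_norm w0) ler_piMr ?sin_abs_le1.
Qed.

Lemma dsin_bump_le c k w t : 0 <= w -> `|2 * k ^+ 2 * (t - c)| <= w ->
  `|dsin_bump c k w t| <= 2 * w * bump c k t.
Proof.
move=> w0 hw; rewrite /dsin_bump; move: hw; set U := 2 * k ^+ 2 * (t - c) => hw.
rewrite normrM (gtr0_norm (bump_gt0 _ _ _)) mulrC.
rewrite ler_wpM2r ?(ltW (bump_gt0 _ _ _))//; apply: (le_trans (ler_normD _ _)).
rewrite !normrM normrN mulr_natl mulr2n; apply: lerD.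
  by rewrite -[leRHS]mulr1 ler_pM ?sin_abs_le1.
by rewrite (ger0_norm w0) ler_piMr ?cos_abs_le1.
Qed.

(* The integrand is negative close to c, by a definite amount for |t - c| <= 1/k,
   and the bump is smaller than tau away from c. *)
Lemma bump_integral_le (x0 x1 c k w A C E eta delta tau : R) (Q S : R -> R) :
  {within `[x0, x1], continuous S} ->
  0 < k -> x0 <= c - k^-1 -> c + k^-1 <= x1 -> k^-1 <= delta ->
  0 <= w -> 2 * k ^+ 2 * (x1 - x0) <= w ->
  0 <= C -> 0 <= eta <= 1 -> 0 <= tau -> 0 <= E <= eta * w ^+ 2 / 2 ->
  (forall t, x0 <= t <= x1 -> Q t <= C) ->
  (forall t, x0 <= t <= x1 -> `|t - c| <= delta -> Q t <= - eta) ->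
  (forall t, x0 <= t <= x1 -> delta <= `|t - c| -> bump c k t <= tau) ->
  (forall t, x0 <= t <= x1 -> S t <= A ^+ 2 * bump c k t ^+ 2 *
     ((w ^+ 2 + (2 * k ^+ 2 * (t - c)) ^+ 2) * Q t + E)) ->
  \int[mu]_(t in `[x0, x1]) S t <= A ^+ 2 * w ^+ 2 *
    ((2 * C + 1) * tau ^+ 2 * (x1 - x0) - eta * expR (-1) ^+ 2 / k).
Proof.
move=> cS k0 xc cx kd w0 kw C0 /andP[eta0 eta1] tau0 /andP[E0 Ew] QC Qn bt hS.
have ki0 : 0 < k^-1 by rewrite invr_gt0.
have AB0 t : 0 <= A ^+ 2 * bump c k t ^+ 2 by apply: mulr_ge0; exact: sqr_ge0.
have Aw0 : 0 <= A ^+ 2 * w ^+ 2 by apply: mulr_ge0; exact: sqr_ge0.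
have ew0 : 0 <= eta * w ^+ 2 / 2 by rewrite divr_ge0// mulr_ge0// sqr_ge0.
have CC0 : 0 <= 2 * C + 1 by rewrite addr_ge0// mulr_ge0.
have W t : x0 <= t <= x1 -> (2 * k ^+ 2 * (t - c)) ^+ 2 <= w ^+ 2.
  move=> /andP[t0 t1]; rewrite -[X in X <= _]real_normK ?num_real//.
  rewrite lerXn2r ?nnegrE//; apply: le_trans kw.
  have k20 : 0 <= 2 * k ^+ 2 by rewrite mulr_ge0 ?sqr_ge0.
  rewrite normrM (ger0_norm k20) ler_wpM2l//.
  by rewrite ler_norml; lra.
have near_le t : x0 <= t <= x1 -> `|t - c| <= delta ->
    S t <= - (A ^+ 2 * bump c k t ^+ 2 * (eta * w ^+ 2 / 2)).
  move=> tx tc; apply: (le_trans (hS t tx)).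
  rewrite -mulrN ler_wpM2l//.
  have := Qn t tx tc; have := W t tx; have := sqr_ge0 w; have := sqr_ge0 (2 * k ^+ 2 * (t - c)).
  move: (_ ^+ 2) (w ^+ 2) (Q t) Ew => V W2 q Ew V0 W0 VW qe.
  have : (W2 + V) * q <= (W2 + V) * - eta by rewrite ler_wpM2l ?addr_ge0.
  have : V * eta >= 0 by rewrite mulr_ge0.
  by lra.
(* Away from [c] the sum of the two squares is at most [2 w^2] and [E] is at most [w^2], whence the
   factor [2 C + 1]. Near [c] the integrand is non-positive, so that [T] bounds it as well. *)
set T := A ^+ 2 * w ^+ 2 * ((2 * C + 1) * tau ^+ 2).
have T0 : 0 <= T by rewrite /T mulr_ge0// mulr_ge0// sqr_ge0.
have all_le t : x0 <= t <= x1 -> S t <= T.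
  move=> tx; have [tc|/ltW tc] := leP `|t - c| delta.
    apply: (le_trans (near_le t tx tc)); apply: le_trans T0.
    by rewrite oppr_le0 mulr_ge0.
  have -> : T = A ^+ 2 * (tau ^+ 2 * (w ^+ 2 * (2 * C + 1))) by rewrite /T; ring.
  apply: (le_trans (hS t tx)); rewrite -(mulrA (A ^+ 2)) ler_wpM2l ?sqr_ge0//.
  have b2 : bump c k t ^+ 2 <= tau ^+ 2.
    by rewrite lerXn2r ?nnegrE ?(ltW (bump_gt0 _ _ _))// bt.
  have h1 : (w ^+ 2 + (2 * k ^+ 2 * (t - c)) ^+ 2) * Q t + E <= w ^+ 2 * (2 * C + 1).
    have := QC t tx; have := W t tx; have := sqr_ge0 w; have := sqr_ge0 (2 * k ^+ 2 * (t - c)).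
    move: (_ ^+ 2) (w ^+ 2) (Q t) Ew => V W2 q Ew V0 W0 VW qC.
    have : (W2 + V) * q <= (W2 + V) * C by rewrite ler_wpM2l ?addr_ge0.
    have : V * C <= W2 * C by rewrite ler_wpM2r.
    have : eta * W2 <= 1 * W2 by rewrite ler_wpM2r.
    by lra.
  apply: (@le_trans _ _ (bump c k t ^+ 2 * (w ^+ 2 * (2 * C + 1)))).
    by rewrite ler_wpM2l ?sqr_ge0.
  by rewrite ler_wpM2r// mulr_ge0 ?sqr_ge0.
(* On the core [|t - c| <= 1/k] the bump is at least [exp(-1)], and half of [eta w^2] remains after
   [E] is absorbed. The core has length [2/k], which compensates this half. *)
set m := A ^+ 2 * w ^+ 2 * (eta * expR (-1) ^+ 2 / 2).
have core_le t : c - k^-1 <= t <= c + k^-1 -> S t <= - m.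
  move=> /andP[t1 t2].
  have tx : x0 <= t <= x1 by apply/andP; split; lra.
  have tk : `|t - c| <= k^-1 by rewrite ler_norml; lra.
  apply: (le_trans (near_le t tx (le_trans tk kd))).
  have e1 : expR (-1) <= bump c k t.
    rewrite /bump ler_expR lerN2 -real_normK ?num_real// expr_le1// normrM.
    by rewrite (gtr0_norm k0) -ler_pdivlMr// mul1r.
  have e2 : expR (-1) ^+ 2 <= bump c k t ^+ 2.
    by rewrite lerXn2r ?nnegrE ?expR_ge0// ltW// bump_gt0.
  rewrite lerN2 /m; set B := bump _ _ _ in e2 *.
  rewrite (_ : A ^+ 2 * w ^+ 2 * _ = A ^+ 2 * (w ^+ 2 * (eta / 2)) * expR (-1) ^+ 2); last by ring.
  rewrite (_ : A ^+ 2 * B ^+ 2 * _ = A ^+ 2 * (w ^+ 2 * (eta / 2)) * B ^+ 2); last by ring.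
  by rewrite ler_wpM2l// mulr_ge0 ?sqr_ge0// mulrCA mulrA.
have sub u v : x0 <= u -> v <= x1 -> {within `[u, v], continuous S}.
  move=> xu vx; apply: continuous_subspaceW cS => t /=; rewrite !in_itv/= => /andP[ut tv].
  by rewrite (le_trans xu ut) (le_trans tv vx).
rewrite (@Rintegral_chasles _ x0 (c - k^-1) x1)//; last by lra.
rewrite (@Rintegral_chasles _ (c - k^-1) (c + k^-1) x1)//; [|lra|exact: sub].
have i1 : \int[mu]_(t in `[x0, (c - k^-1)%R]) S t <= T * (c - k^-1 - x0).
  apply: Rintegral_le_cst => //; first by apply: sub; lra.
  by move=> t /andP[? ?]; apply: all_le; apply/andP; split; lra.
have i2 : \int[mu]_(t in `[(c - k^-1)%R, (c + k^-1)%R]) S t <= - m * (c + k^-1 - (c - k^-1)).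
  apply: Rintegral_le_cst; [lra|exact: sub|exact: core_le].
have i3 : \int[mu]_(t in `[(c + k^-1)%R, x1]) S t <= T * (x1 - (c + k^-1)).
  apply: Rintegral_le_cst => //; first by apply: sub; lra.
  by move=> t /andP[? ?]; apply: all_le; apply/andP; split; lra.
apply: (@le_trans _ _ (T * (x1 - x0) - m * (2 * k^-1))).
  have := mulr_ge0 T0 (ltW ki0); move: i1 i2 i3.
  move: (Rintegral _ _ _) (Rintegral _ _ _) (Rintegral _ _ _) => I1 I2 I3.
  by clearbody T m; lra.
by rewrite /T /m le_eqVlt; apply/orP; left; apply/eqP; field; rewrite gt_eqF.
Qed.

End RealEstimates.

(** * Second differences of a function of the jet *)

Section Pointwise.
Context {R : realType}.

Lemma differentiable_lincomb m n (c : 'I_m -> R) (h : 'I_m -> 'rV[R]_n -> R) (x : 'rV[R]_n) :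
  (forall j, differentiable (h j) x) ->
  differentiable (fun y => \sum_j c j * h j y) x.
Proof.
move=> dh; rewrite (_ : (fun y => _) = \sum_j (fun y => c j * h j y)).
  apply: differentiable_sum => j; apply: (@differentiableM _ _ (fun=> c j)) => //.
by apply/funext => y; rewrite fct_sumE.
Qed.

Lemma derive_lincomb m n (c : 'I_m -> R) (h : 'I_m -> 'rV[R]_n -> R) (x v : 'rV[R]_n) :
  (forall j, differentiable (h j) x) ->
  'D_v (fun y => \sum_j c j * h j y) x = \sum_j c j * 'D_v (h j) x.
Proof.
move=> dh; rewrite (_ : (fun y => _) = \sum_j (fun y => c j * h j y)); last first.
  by apply/funext => y; rewrite fct_sumE.
rewrite derive_sum => [|j]; last first.
  apply: diff_derivable; apply: (@differentiableM _ _ (fun=> c j)) => //.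
apply: eq_bigr => j _; rewrite (@deriveMs _ _ (fun=> c j))//.
by rewrite derive_cst mulr0 addr0.
Qed.

Lemma second_difference_rV n (f : 'rV[R]_n -> R) (y w : 'rV[R]_n) B :
  (forall s, -1 <= s <= 1 -> differentiable f (y + s *: w)) ->
  (forall s j, -1 <= s <= 1 -> differentiable ('D_(delta_mx 0 j) f) (y + s *: w)) ->
  (forall s, -1 <= s <= 1 ->
     \sum_i \sum_j w 0 i * w 0 j * word_der [:: i; j] f (y + s *: w) <= B) ->
  f (y + w) + f (y - w) - 2 * f y <= B.
Proof.
move=> d1 d2 hB.
pose g x := \sum_j w 0 j * 'D_(delta_mx 0 j) f x.
have dg s : -1 <= s <= 1 -> differentiable g (y + s *: w).
  by move=> s1; apply: differentiable_lincomb => j; exact: d2.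
have := @second_difference R (fun s => f (y + s *: w)) (fun s => g (y + s *: w))
  (fun s => 'D_w g (y + s *: w)) B.
rewrite scale1r scaleN1r scale0r addr0; apply.
- move=> s s1; have := is_derive_line (d1 s s1).
  by rewrite (derive_partial w (d1 s s1)).
- by move=> s s1; apply: is_derive_line; exact: dg.
- move=> s s1; apply: le_trans (hB s s1).
  rewrite (derive_partial w (dg s s1)); apply: ler_sum => i _.
  rewrite derive_lincomb; last by move=> j; exact: d2.
  by rewrite mulr_sumr; apply: ler_sum => j _; rewrite mulrA.
Qed.

Section Jet.
Variable d : nat.
Implicit Types (lam : 'rV[R]_d) (x y C Q : R).

Definition jet_step lam x y : 'rV[R]_(1 + (d + d)) :=
  row_mx 0 (row_mx (x *: lam) (y *: lam)).

Lemma sum_jet (G : 'I_(1 + (d + d)) -> R) :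
  \sum_i G i = G (lshift (d + d) 0) + \sum_k G (rshift 1 (lshift d k)) +
    \sum_k G (velocity_index k).
Proof. by rewrite big_split_ord/= big_ord1 big_split_ord/= addrA. Qed.

Lemma jet_step0 lam x y : jet_step lam x y 0 (lshift (d + d) 0) = 0.
Proof. by rewrite /jet_step row_mxEl mxE. Qed.

Lemma jet_step1 lam x y k : jet_step lam x y 0 (rshift 1 (lshift d k)) = x * lam 0 k.
Proof. by rewrite /jet_step row_mxEr row_mxEl mxE. Qed.

Lemma jet_step2 lam x y k : jet_step lam x y 0 (velocity_index k) = y * lam 0 k.
Proof. by rewrite /jet_step /velocity_index !row_mxEr mxE. Qed.

Lemma jet_step_norm lam x y :
  \sum_i `|jet_step lam x y 0 i| = (\sum_k `|lam 0 k|) * (`|x| + `|y|).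
Proof.
rewrite sum_jet jet_step0 normr0 add0r mulrDr !mulr_suml; congr (_ + _);
  apply: eq_bigr => k _; by rewrite ?jet_step1 ?jet_step2 normrM mulrC.
Qed.

Lemma sum_sum_mul n (a : 'I_n -> R) D :
  \sum_k \sum_l a k * a l * D = (\sum_k a k) ^+ 2 * D.
Proof.
rewrite expr2 mulr_suml mulr_suml; apply: eq_bigr => k _.
by rewrite mulr_sumr mulr_suml.
Qed.

Lemma quadratic_jet_step (M : 'I_(1 + (d + d)) -> 'I_(1 + (d + d)) -> R) lam x y C :
  (forall i j, `|M i j| <= C) ->
  \sum_i \sum_j jet_step lam x y 0 i * jet_step lam x y 0 j * M i j <=
  y ^+ 2 * (\sum_k \sum_l M (velocity_index k) (velocity_index l) * lam 0 k * lam 0 l) +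
  C * (\sum_k `|lam 0 k|) ^+ 2 * (2 * `|x * y| + x ^+ 2).
Proof.
move=> MC.
pose p k : 'I_(1 + (d + d)) := rshift 1 (lshift d k); pose v k := @velocity_index d k.
have inner i : \sum_j jet_step lam x y 0 i * jet_step lam x y 0 j * M i j =
    jet_step lam x y 0 i * \sum_l lam 0 l * (x * M i (p l) + y * M i (v l)).
  rewrite sum_jet jet_step0 mulr0 mul0r add0r mulr_sumr -big_split/=.
  by apply: eq_bigr => l _; rewrite jet_step1 jet_step2 /p /v; ring.
under eq_bigr do rewrite inner.
rewrite sum_jet jet_step0 mul0r add0r -big_split/=.
have -> : C * (\sum_k `|lam 0 k|) ^+ 2 * (2 * `|x * y| + x ^+ 2) =
    \sum_k \sum_l `|lam 0 k| * `|lam 0 l| * (C * (2 * `|x * y| + x ^+ 2)).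
  by rewrite sum_sum_mul; ring.
rewrite mulr_sumr -big_split/=; apply: ler_sum => k _.
rewrite jet_step1 jet_step2 !mulr_sumr -!big_split/=; apply: ler_sum => l _.
rewrite -/(p k) -/(v k) -/(v l).
set a := lam 0 k; set b := lam 0 l.
have h : `|a * b * (x ^+ 2 * M (p k) (p l) + x * y * M (p k) (v l) + x * y * M (v k) (p l))|
    <= `|a| * `|b| * (C * (2 * `|x * y| + x ^+ 2)).
  rewrite !normrM ler_wpM2l ?mulr_ge0//.
  have -> : C * (2 * (`|x| * `|y|) + x ^+ 2) =
    x ^+ 2 * C + `|x * y| * C + `|x * y| * C by rewrite normrM; ring.
  apply: (le_trans (ler_normD _ _)); apply: lerD; last by rewrite normrM ler_wpM2l.
  apply: (le_trans (ler_normD _ _)); apply: lerD; last by rewrite normrM ler_wpM2l.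
  by rewrite normrM (ger0_norm (sqr_ge0 x)) ler_wpM2l ?sqr_ge0.
apply: le_trans (lerD (lexx _) (le_trans (ler_norm _) h)).
by rewrite le_eqVlt; apply/orP; left; apply/eqP; ring.
Qed.

(* The remainder is controlled by the Lipschitz constant of the second derivatives. *)
Lemma jet_second_difference (f : 'rV[R]_(1 + (d + d)) -> R)
    (B : set 'rV[R]_(1 + (d + d))) (z : 'rV[R]_(1 + (d + d))) lam x y C :
  0 <= C ->
  (forall s, -1 <= s <= 1 -> B (z + s *: jet_step lam x y)) ->
  (forall z, B z -> differentiable f z) ->
  (forall z j, B z -> differentiable ('D_(delta_mx 0 j) f) z) ->
  (forall z i j, B z -> `|word_der [:: i; j] f z| <= C) ->
  (forall z z' i j, B z -> B z' ->
     `|word_der [:: i; j] f z' - word_der [:: i; j] f z| <= C * \sum_l `|z' 0 l - z 0 l|) ->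
  f (z + jet_step lam x y) + f (z - jet_step lam x y) - 2 * f z <=
  y ^+ 2 * (\sum_k \sum_l word_der [:: velocity_index k; velocity_index l] f z
     * lam 0 k * lam 0 l) +
  C * (\sum_k `|lam 0 k|) ^+ 2 * (2 * `|x * y| + x ^+ 2) +
  C * ((\sum_k `|lam 0 k|) * (`|x| + `|y|)) ^+ 3.
Proof.
move=> C0 Bs d1 d2 hC hL.
have Bz : B z by have := Bs 0; rewrite scale0r addr0; apply; rewrite lerN10 ler01.
apply: second_difference_rV => [s /Bs/d1//|s j /Bs Bz'|s s1]; first exact: d2.
apply: le_trans (lerD (quadratic_jet_step lam x y (fun i j => hC z i j Bz)) (lexx _)).
rewrite -lerBlDl -sumrB; set w := jet_step lam x y.
have -> : C * ((\sum_k `|lam 0 k|) * (`|x| + `|y|)) ^+ 3 =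
    \sum_i \sum_j `|w 0 i| * `|w 0 j| * (C * \sum_l `|w 0 l|).
  by rewrite sum_sum_mul jet_step_norm; ring.
apply: ler_sum => i _; rewrite -sumrB; apply: ler_sum => j _.
rewrite -mulrBr; apply: (le_trans (ler_norm _)); rewrite normrM normrM ler_wpM2l ?mulr_ge0//.
apply: (le_trans (hL _ _ i j Bz (Bs s s1))); rewrite ler_wpM2l//.
apply: ler_sum => l _; rewrite !mxE addrAC subrr add0r normrM ler_piMl//.
by rewrite ler_norml.
Qed.

(** Write [b] for the bump at [t]. Each second difference has positions at most [A b] and velocities
    at most [2 w A b]. The mixed terms give [4 w b^2] for each of cosine and sine, and the position
    terms give [b^2 <= w b^2] in total, whence 9. The remainder is cubic in [3 A w b], which gives
    27 for each, hence 54; of its factor [b^3] only [b^2] is kept, in order to factor out the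
    squared bump. *)
Lemma bump_pair_difference (f : 'rV[R]_(1 + (d + d)) -> R)
    (B : set 'rV[R]_(1 + (d + d))) (z : 'rV[R]_(1 + (d + d))) lam A c k w t C L :
  0 <= C -> 0 <= A -> 1 <= w -> `|2 * k ^+ 2 * (t - c)| <= w ->
  \sum_k `|lam 0 k| <= L ->
  (forall x y s, `|x| <= A -> `|y| <= 2 * w * A -> -1 <= s <= 1 ->
     B (z + s *: jet_step lam x y)) ->
  (forall z, B z -> differentiable f z) ->
  (forall z j, B z -> differentiable ('D_(delta_mx 0 j) f) z) ->
  (forall z i j, B z -> `|word_der [:: i; j] f z| <= C) ->
  (forall z z' i j, B z -> B z' ->
     `|word_der [:: i; j] f z' - word_der [:: i; j] f z| <= C * \sum_l `|z' 0 l - z 0 l|) ->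
  forall p q, p = jet_step lam (A * cos_bump c k w t) (A * dcos_bump c k w t) ->
  q = jet_step lam (A * sin_bump c k w t) (A * dsin_bump c k w t) ->
  (f (z + p) + f (z - p) - 2 * f z) + (f (z + q) + f (z - q) - 2 * f z) <=
  A ^+ 2 * bump c k t ^+ 2 * ((w ^+ 2 + (2 * k ^+ 2 * (t - c)) ^+ 2) *
    (\sum_k \sum_l word_der [:: velocity_index k; velocity_index l] f z
       * lam 0 k * lam 0 l) +
    (9 * C * L ^+ 2 * w + 54 * C * L ^+ 3 * A * w ^+ 3)).
Proof.
move=> C0 A0 w1 kw hlam BB d1 d2 hC hL p q -> ->.
have w0 : 0 <= w := le_trans ler01 w1.
set S := \sum_k `|lam 0 k| in hlam.
have S0 : 0 <= S by apply: sumr_ge0.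
have L0 : 0 <= L := le_trans S0 hlam.
have b0 := ltW (bump_gt0 c k t); have b1 := bump_le1 c k t.
have k1 := cos_bump_le c k w t; have k2 := sin_bump_le c k w t.
have k3 := dcos_bump_le w0 kw; have k4 := dsin_bump_le w0 kw.
set Q := (X in _ <= _ * (_ * X + _)).
have bound x y : `|x| <= bump c k t -> `|y| <= 2 * w * bump c k t ->
    f (z + jet_step lam (A * x) (A * y)) + f (z - jet_step lam (A * x) (A * y)) - 2 * f z <=
    A ^+ 2 * y ^+ 2 * Q + A ^+ 2 * C * L ^+ 2 * (4 * w * bump c k t ^+ 2 + x ^+ 2) +
    27 * C * L ^+ 3 * A ^+ 3 * w ^+ 3 * bump c k t ^+ 2.
  move: (bump c k t) b0 b1 => b b0 b1 hx hy.
  have hx' : `|A * x| <= A.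
    by rewrite normrM (ger0_norm A0) ler_piMr// (le_trans hx).
  have wA0 : 0 <= 2 * w * A by rewrite !mulr_ge0.
  have hy' : `|A * y| <= 2 * w * A.
    rewrite normrM (ger0_norm A0) mulrC ler_wpM2r// (le_trans hy)//.
    by rewrite ler_piMr// mulr_ge0.
  have h := @jet_second_difference f B z lam (A * x) (A * y) C C0
    (fun s => BB _ _ s hx' hy') d1 d2 hC hL.
  apply: (le_trans h); rewrite -/S -/Q; apply: lerD; first apply: lerD.
  - by rewrite exprMn.
  - have -> : `|A * x * (A * y)| = A ^+ 2 * (`|x| * `|y|).
      by rewrite !normrM (ger0_norm A0); ring.
    rewrite exprMn (_ : A ^+ 2 * C * L ^+ 2 * _ =
      C * L ^+ 2 * (2 * (A ^+ 2 * (b * (2 * w * b))) + A ^+ 2 * x ^+ 2)); last by ring.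
    have A20 := sqr_ge0 A.
    have p0 : 0 <= C * S ^+ 2 by apply: mulr_ge0 => //; exact: sqr_ge0.
    have p1 : 0 <= 2 * (A ^+ 2 * (`|x| * `|y|)) + A ^+ 2 * x ^+ 2.
      apply: addr_ge0; last by apply: mulr_ge0 => //; exact: sqr_ge0.
      by apply: mulr_ge0 => //; apply: mulr_ge0 => //; exact: mulr_ge0.
    apply: ler_pM => //.
      by rewrite ler_wpM2l// lerXn2r.
    by rewrite lerD2r ler_wpM2l// ler_wpM2l// ler_pM.
  - have h1 : S * (`|A * x| + `|A * y|) <= L * (3 * A * w * b).
      apply: ler_pM; rewrite ?addr_ge0// !normrM (ger0_norm A0) -mulrDr.
      rewrite (_ : 3 * A * w * b = A * (3 * w * b)); last by ring.
      rewrite ler_wpM2l//; apply: (le_trans (lerD hx hy)).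
      have hbw : b <= w * b by rewrite ler_peMl.
      by clear -hbw; lra.
    have h2 : (S * (`|A * x| + `|A * y|)) ^+ 3 <= (L * (3 * A * w * b)) ^+ 3.
      by rewrite lerXn2r ?nnegrE ?mulr_ge0 ?addr_ge0.
    apply: (@le_trans _ _ (C * (L * (3 * A * w * b)) ^+ 3)); first by rewrite ler_wpM2l.
    rewrite (_ : C * (L * (3 * A * w * b)) ^+ 3 =
      27 * C * L ^+ 3 * A ^+ 3 * w ^+ 3 * b ^+ 2 * b); last by ring.
    by rewrite ler_piMr// !mulr_ge0 ?exprn_ge0.
have h1 := bound _ _ k1 k3; have h2 := bound _ _ k2 k4.
apply: (le_trans (lerD h1 h2)).
have e1 := sum_sqr_bump c k w t; have e2 := sum_sqr_dbump c k w t.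
move: (bump c k t) b0 b1 e1 e2 => b b0 b1 e1 e2.
have -> : A ^+ 2 * b ^+ 2 * ((w ^+ 2 + (2 * k ^+ 2 * (t - c)) ^+ 2) * Q +
    (9 * C * L ^+ 2 * w + 54 * C * L ^+ 3 * A * w ^+ 3)) =
  A ^+ 2 * (dcos_bump c k w t ^+ 2 + dsin_bump c k w t ^+ 2) * Q +
  A ^+ 2 * C * L ^+ 2 * (9 * w * b ^+ 2) + 54 * C * L ^+ 3 * A ^+ 3 * w ^+ 3 * b ^+ 2.
  by rewrite e2; ring.
have h3 : A ^+ 2 * C * L ^+ 2 * (8 * w * b ^+ 2 +
     (cos_bump c k w t ^+ 2 + sin_bump c k w t ^+ 2)) <=
    A ^+ 2 * C * L ^+ 2 * (9 * w * b ^+ 2).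
  have ACL : 0 <= A ^+ 2 * C * L ^+ 2 := mulr_ge0 (mulr_ge0 (sqr_ge0 A) C0) (sqr_ge0 L).
  rewrite e1 ler_wpM2l//.
  have : b ^+ 2 <= w * b ^+ 2 by rewrite ler_peMl ?sqr_ge0.
  by lra.
rewrite -subr_ge0 in h3; rewrite -subr_ge0; apply: (le_trans h3).
by rewrite le_eqVlt; apply/orP; left; apply/eqP; ring.
Qed.

End Jet.
End Pointwise.

(** * The bumps as smooth nets *)

Section BumpNets.
Context {R : realType} {rho : gauge R}.
Local Notation K := (gnum rho).
Local Notation small := ((0 : R)^'+).

Lemma derive_row1 (f : R -> R) df (x : 'rV[R]_1) i : is_derive (x 0 0) 1 f df ->
  differentiable (fun y : 'rV[R]_1 => f (y 0 0)) x /\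
  'D_(delta_mx 0 i) (fun y : 'rV[R]_1 => f (y 0 0)) x = df.
Proof.
move=> fd; split.
  apply: (@differentiable_comp _ _ _ _ (fun y : 'rV[R]_1 => y 0 0 : R) f).
    exact: differentiable_coord.
  by apply/derivable1_diffP; case: fd.
case: fd => _ <-; rewrite /derive; apply: (congr1 (fun q => lim (q @ 0^'))).
by apply/funext => h /=; rewrite !mxE ord1.
Qed.

(** The exponential of a moderate net may fail to be moderate, hence the restriction to non-positive
    points. A representative of such a point exceeds 0 by less than 1 for [e] small, which gives the
    bound [expR 1]. *)
Lemma snet_expR : snet [set y : 'rV[K]_1 | y 0 0 <=~ 0] (fun=> setT)
  (fun e (y : 'rV[R]_1) => expR (y 0 0)).
Proof.
have t : tame [set y : 'rV[K]_1 | y 0 0 <=~ 0] (fun=> setT)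
    (fun e (y : 'rV[R]_1) => expR (y 0 0)).
  split=> [e _ x _|y ye y0 hy].
    by have [] := derive_row1 0 (is_derive_expR (x 0 0)).
  apply: (moderate_le (moderate_cst (rho := rho) (expR 1))).
  have := (gle_ev (hy 0) (represents0 (rho := rho))).1 y0 1 ltr01.
  apply: filterS2 (ev_powR_le (rho := rho) ltr01 ltr01) => e r1 h.
  rewrite !ger0_norm ?expR_ge0// ler_expR; lra.
have D i : (fun e : R => 'D_(delta_mx 0 i) (fun y : 'rV[R]_1 => expR (y 0 0))) =
    (fun e y => expR (y 0 0)).
  apply/funext => e; apply/funext => x.
  by have [] := derive_row1 i (is_derive_expR (x 0 0)).
by elim=> [|m IH]; split=> // i; rewrite D.
Qed.

(** Cosine and sine are treated in one induction on the order, since differentiation exchanges them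
    up to a sign. *)
Lemma snet_trig (X : set 'rV[K]_1) :
  snet X (fun=> setT) (fun e (y : 'rV[R]_1) => cos (y 0 0)) /\
  snet X (fun=> setT) (fun e (y : 'rV[R]_1) => sin (y 0 0)).
Proof.
have tc : tame X (fun=> setT) (fun e (y : 'rV[R]_1) => cos (y 0 0)).
  split=> [e _ x _|y ye y0 hy].
    by have [] := derive_row1 0 (is_derive_cos (x 0 0)).
  apply: (moderate_le (moderate_cst (rho := rho) 1)); apply: nearW => e.
  by rewrite normr1 cos_abs_le1.
have ts : tame X (fun=> setT) (fun e (y : 'rV[R]_1) => sin (y 0 0)).
  split=> [e _ x _|y ye y0 hy].
    by have [] := derive_row1 0 (is_derive_sin (x 0 0)).
  apply: (moderate_le (moderate_cst (rho := rho) 1)); apply: nearW => e.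
  by rewrite normr1 sin_abs_le1.
have Dc i : (fun e : R => 'D_(delta_mx 0 i) (fun y : 'rV[R]_1 => cos (y 0 0))) =
    (fun e y => -1 * sin (y 0 0)).
  apply/funext => e; apply/funext => x; rewrite mulN1r.
  by have [] := derive_row1 i (is_derive_cos (x 0 0)).
have Ds i : (fun e : R => 'D_(delta_mx 0 i) (fun y : 'rV[R]_1 => sin (y 0 0))) =
    (fun e y => cos (y 0 0)).
  apply/funext => e; apply/funext => x.
  by have [] := derive_row1 i (is_derive_sin (x 0 0)).
have oT (e : R) : 0 < e <= 1 -> open (setT : set 'rV[R]_1) by move=> _; exact: openT.
have XT : X `<=` strong_interior (fun=> setT) by move=> x _ xe _; exact: nearW.
suff h m : smooth_net X (fun=> setT) m (fun e (y : 'rV[R]_1) => cos (y 0 0)) /\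
    smooth_net X (fun=> setT) m (fun e (y : 'rV[R]_1) => sin (y 0 0)).
  by split=> m; have [] := h m.
elim: m => [|m [IHc IHs]]; first by split.
split; split=> // i; rewrite ?Dc ?Ds//.
by apply: smooth_netM => //; apply: smooth_net_cst; exact: moderate_cst.
Qed.

Section Row1.
Variable X : set 'rV[K]_1.
Let oT (e : R) : 0 < e <= 1 -> open (setT : set 'rV[R]_1). Proof. by move=> _; exact: openT. Qed.
Let XT : X `<=` strong_interior (fun=> setT).
Proof. by move=> x _ xe _; exact: nearW. Qed.

Lemma snet_comp1 (Y : set 'rV[K]_1) (G : R -> 'rV[R]_1 -> R) (F : R -> R -> R) :
  snet X (fun=> setT) G ->
  (forall x xe, X x -> vrepresents x xe -> Y (const_mx (gclass (fun e => G e (xe e))))) ->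
  snet Y (fun=> setT) (fun e y => F e (y 0 0)) -> snet X (fun=> setT) (fun e x => F e (G e x)).
Proof.
move=> sG GY sF.
have := @snet_comp _ _ 1 1 X (fun=> setT) Y (fun=> setT) (fun e x => const_mx (G e x))
  (fun e y => F e (y 0 0)) oT XT.
move=> /(_ _ _ _ sF) h.
have -> : (fun e x => F e (G e x)) = fun e x => F e ((const_mx (G e x) : 'rV[R]_1) 0 0).
  by apply/funext => e; apply/funext => x; rewrite mxE.
apply: h => //.
  move=> j; rewrite (_ : (fun e x => _) = G)//.
  by apply/funext => e; apply/funext => x; rewrite mxE.
move=> x xe Xx hx; exists (const_mx (gclass (fun e => G e (xe e)))); first exact: GY Xx hx.
move=> i; rewrite mxE; have := represents_gclass (rho := rho) (snet_mod sG Xx hx).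
by congr (represents _ _); apply/funext => e; rewrite mxE.
Qed.

Lemma snet_affine (c k : R -> R) : moderate rho c -> moderate rho k ->
  snet X (fun=> setT) (fun e x => k e * (x 0 0 - c e)).
Proof.
move=> mc mk m; apply: smooth_netM => //; first exact: smooth_net_cst.
apply: smooth_netD => //; first exact: smooth_net_coord.
exact: (smooth_net_cst _ _ m (moderateN mc)).
Qed.

Lemma snet_bump (c k : R -> R) : moderate rho c -> moderate rho k ->
  snet X (fun=> setT) (fun e x => bump (c e) (k e) (x 0 0)).
Proof.
move=> mc mk; have sa := snet_affine mc mk.
have sG : snet X (fun=> setT) (fun e x => -1 * ((k e * (x 0 0 - c e)) * (k e * (x 0 0 - c e)))).
  move=> m; apply: smooth_netM => //; first by apply: smooth_net_cst => //; exact: moderate_cst.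
  by apply: smooth_netM => //; exact: sa.
rewrite (_ : (fun e x => _) = fun e (x : 'rV[R]_1) =>
    expR (-1 * ((k e * (x 0 0 - c e)) * (k e * (x 0 0 - c e))))).
  apply: (snet_comp1 (F := fun=> expR) sG _ snet_expR) => x xe Xx hx /=; rewrite mxE.
  have h := represents_gclass (rho := rho) (snet_mod sG Xx hx).
  apply/(gle_ev h (represents0 (rho := rho))) => N N0; apply: nearW => e.
  have := sqr_ge0 (k e * (xe e 0 0 - c e)); have := powR_ge0 (rho e) N.
  by rewrite expr2; lra.
by apply/funext => e; apply/funext => x; rewrite /bump; congr expR; ring.
Qed.

Lemma snet_cos_bump (c k w : R -> R) : moderate rho c -> moderate rho k -> moderate rho w ->
  snet X (fun=> setT) (fun e x => cos_bump (c e) (k e) (w e) (x 0 0)).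
Proof.
move=> mc mk mw m; apply: smooth_netM => //; first exact: snet_bump.
by apply: (snet_comp1 (F := fun=> cos) (snet_affine mc mw) _ (snet_trig setT).1).
Qed.

Lemma snet_sin_bump (c k w : R -> R) : moderate rho c -> moderate rho k -> moderate rho w ->
  snet X (fun=> setT) (fun e x => sin_bump (c e) (k e) (w e) (x 0 0)).
Proof.
move=> mc mk mw m; apply: smooth_netM => //; first exact: snet_bump.
by apply: (snet_comp1 (F := fun=> sin) (snet_affine mc mw) _ (snet_trig setT).2).
Qed.

End Row1.

Lemma word_der_scale n (g : 'rV[R]_n -> R) (c : R) s :
  (forall s x, differentiable (word_der s g) x) ->
  word_der s (fun x => c * g x) = fun x => c * word_der s g x.
Proof.
move=> dg; elim: s => //= i s ->; apply/funext => x.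
by rewrite (@deriveMs _ _ (fun=> c))// derive_cst mulr0 addr0.
Qed.

(** Comes from [1 + y <= exp y] at [y = 1 / ((n + 1) rho)], raised to the power [n + 1]: this gives
    one power of [rho] more than [n], and it absorbs the constant [(n + 1)^(n + 1)]. *)
Lemma expR_tail (E : R) : 0 < E ->
  \forall e \near small, expR (- rho e `^ (-1)) <= rho e `^ E.
Proof.
move=> E0; pose n := (Num.truncn E).+1.
have En : E <= n%:R by rewrite ltW// truncnS_gt.
near=> e.
have r0 : 0 < rho e by near: e; exact: gauge_gt0.
apply: (@le_trans _ _ (rho e `^ n%:R)); last by near: e; exact: le_gauge_powR.
apply: (@le_trans _ _ (n.+1%:R ^+ n.+1 * rho e `^ (n%:R + 1))); last first.
  by near: e; apply: powR_absorb; rewrite exprn_ge0.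
have -> : rho e `^ (n%:R + 1) = rho e ^+ n.+1 by rewrite natr1 powR_mulrn// ltW.
rewrite powRN powRr1 ?(ltW r0)// -exprMn.
have h : (rho e)^-1 = n.+1%:R * ((n.+1%:R * rho e)^-1).
  by rewrite invfM mulrA divff ?mul1r// pnatr_eq0.
rewrite expRN {1}h expRM_natl -exprVn lerXn2r ?nnegrE ?invr_ge0 ?expR_ge0 ?mulr_ge0 ?(ltW r0)//.
rewrite -[leRHS]invrK lef_pV2 ?posrE ?expR_gt0 ?invr_gt0 ?mulr_gt0 ?ltr0n//.
by apply: le_trans (expR_ge1Dx _); rewrite lerDr.
Unshelve. all: by end_near. Qed.

End BumpNets.

Lemma Rintegral_second_difference (R : realType) (x y : R) (G0 G1 G2 G3 G4 : R -> R) :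
  {within `[x, y], continuous G0} -> {within `[x, y], continuous G1} ->
  {within `[x, y], continuous G2} -> {within `[x, y], continuous G3} ->
  {within `[x, y], continuous G4} ->
  let I G := \int[lebesgue_measure]_(t in `[x, y]) (G t : R) in
  {within `[x, y], continuous
     (fun t => (G1 t + G2 t - 2 * G0 t) + (G3 t + G4 t - 2 * G0 t))} /\
  I (fun t => (G1 t + G2 t - 2 * G0 t) + (G3 t + G4 t - 2 * G0 t)) =
  (I G1 + I G2 - 2 * I G0) + (I G3 + I G4 - 2 * I G0).
Proof.
move=> c0 c1 c2 c3 c4 I.
have cD (f g : R -> R) : {within `[x, y], continuous f} -> {within `[x, y], continuous g} ->
    {within `[x, y], continuous (fun t => f t + g t)}.
  by move=> cf cg t; apply: continuousD; [exact: cf|exact: cg].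
have cB (f g : R -> R) : {within `[x, y], continuous f} -> {within `[x, y], continuous g} ->
    {within `[x, y], continuous (fun t => f t - g t)}.
  by move=> cf cg t; apply: continuousB; [exact: cf|exact: cg].
have cZ : {within `[x, y], continuous (fun t => 2 * G0 t)}.
  rewrite (_ : (fun t => 2 * G0 t) = fun t => G0 t + G0 t); first exact: cD.
  by apply/funext => t; rewrite mulr_natl mulr2n.
have iD (f g : R -> R) : {within `[x, y], continuous f} -> {within `[x, y], continuous g} ->
    I (fun t => f t + g t) = I f + I g.
  by move=> cf cg; apply: RintegralD => //; exact: integrable_itv.
have iB (f g : R -> R) : {within `[x, y], continuous f} -> {within `[x, y], continuous g} ->
    I (fun t => f t - g t) = I f - I g.
  by move=> cf cg; apply: RintegralB => //; exact: integrable_itv.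
have iZ : I (fun t => 2 * G0 t) = 2 * I G0.
  by apply: RintegralZl => //; exact: integrable_itv.
have c12 := cB _ _ (cD _ _ c1 c2) cZ; have c34 := cB _ _ (cD _ _ c3 c4) cZ.
split; first exact: cD.
rewrite (iD _ _ c12 c34) (iB _ _ (cD _ _ c1 c2) cZ) (iB _ _ (cD _ _ c3 c4) cZ).
by rewrite (iD _ _ c1 c2) (iD _ _ c3 c4) iZ.
Qed.

(** * The Legendre form along a minimizer *)

Section Legendre.
Context {R : realType} {rho : gauge R}.
Local Notation K := (gnum rho).
Local Notation small := ((0 : R)^'+).
Local Notation mu := (@lebesgue_measure R).
Context {a b : K} {ae be : R -> R}.
Hypotheses (ha : represents a ae) (hb : represents b be).
Hypothesis ab : forall e, ae e <= be e.
Context {gap : R}.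
Hypotheses (gap0 : 0 < gap)
  (hgap : \forall e \near small, ae e + rho e `^ gap <= be e).
Context {d : nat} {F : K -> 'rV[K]_d -> 'rV[K]_d -> K}
  {OmF : R -> set 'rV[R]_(1 + (d + d))} {Fe : R -> 'rV[R]_(1 + (d + d)) -> 'rV[R]_1}.
Hypothesis hF : defines (slab a b (d + d)) OmF Fe (of_lagrangian F).
Context {Ou : R -> set 'rV[R]_1} {ue : R -> 'rV[R]_1 -> 'rV[R]_d} {u : K -> 'rV[K]_d}.
Hypothesis hu : defines (slab a b 0) Ou ue (of_curve u).
Hypothesis hmin : local_minimizer a b (action_functional a b F) (u a) (u b) u.
Context {lam : R -> 'rV[R]_d}.
Hypothesis mlam : forall k, moderate rho (fun e => lam e 0 k).

Definition step (A : R -> R) (g : R -> 'rV[R]_1 -> R) (e : R) (x : 'rV[R]_1) : 'rV[R]_d :=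
  (A e * g e x) *: lam e.

Lemma snet_step A g j : moderate rho A -> snet (slab a b 0) (fun=> setT) g ->
  snet (slab a b 0) (fun=> setT) (fun e x => step A g e x 0 j).
Proof.
move=> mA sg m; rewrite (_ : (fun e x => _) = fun e x => (A e * lam e 0 j) * g e x).
  have oT (e : R) : 0 < e <= 1 -> open (setT : set 'rV[R]_1) by move=> _; exact: openT.
  have XT : slab a b 0 `<=` strong_interior (fun=> setT) by move=> x _ xe _; exact: nearW.
  apply: smooth_netM => //.
  by apply: smooth_net_cst; exact: moderateM.
by apply/funext => e; apply/funext => x; rewrite /step mxE; ring.
Qed.

Lemma setT_strong : slab a b 0 `<=` strong_interior (fun=> setT).
Proof. by move=> x _ xe _; exact: nearW. Qed.

(** The derivatives of [g] times the components of [lam], up to the order [m] of the norm, are at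
    most [rho^-L] on the interval, so that an amplitude [rho^q] with [q >= N + L] brings them below
    [rho^N]. The threshold depends on [g]: the profile has to be fixed before its amplitude. *)
Lemma minimizer_step g : snet (slab a b 0) (fun=> setT) g ->
  negligible rho (fun e => g e (const_mx (ae e))) ->
  negligible rho (fun e => g e (const_mx (be e))) ->
  exists2 q0, 0 < q0 & forall q (sg : R), q0 <= q -> `|sg| = 1 -> forall P, 0 < P ->
    \forall e \near small,
      \int[mu]_(t in `[ae e, be e]) (Fe e (rjet (ue e) (const_mx t)) 0 0 : R) <=
      \int[mu]_(t in `[ae e, be e])
         (Fe e (rjet (fun x => ue e x + step (fun e => sg * rho e `^ q) g e x) (const_mx t)) 0 0 : R)
        + rho e `^ P.
Proof.
move=> sng ga gb.
have [m [N [N0 hmN]]] := minimizer_perturb ha hb ab gap0 hgap hF hu hmin.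
have oT (e : R) : 0 < e <= 1 -> open (setT : set 'rV[R]_1) by move=> _; exact: openT.
have sgl j : snet (slab a b 0) (fun=> setT) (fun e x => g e x * lam e 0 j).
  move=> k; apply: smooth_netM => //; first exact: setT_strong.
  exact: smooth_net_cst.
have [||L L0 hL] := @common_power R ('I_m.+1 * 'I_d)%type (fun i L e => forall t, ae e <= t <= be e ->
    `|word_der (nseq i.1 0) (fun x => g e x * lam e 0 i.2) (const_mx t)| <= rho e `^ (- L)).
- apply: filterS (ev_gauge01 (rho := rho)) => e /andP[r0 r1] i M M' MM' h t tab.
  by apply: (le_trans (h t tab)); apply: ger_powR; rewrite ?lerN2// r0 ltW.
- by move=> i; have := curve_bound ha hb ab setT_strong (snet_word (nseq i.1 0) (sgl i.2)); apply.
exists (N + L); first exact: addr_gt0.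
move=> q sg qNL sg1 P P0.
have mA : moderate rho (fun e => sg * rho e `^ q).
  by apply: moderateM; [exact: moderate_cst|exact: moderate_powR].
have neg te j : negligible rho (fun e => g e (const_mx (te e))) ->
    negligible rho (fun e => step (fun e => sg * rho e `^ q) g e (const_mx (te e)) 0 j).
  move=> h; have := negligibleMl (moderateM mA (mlam j)) h.
  by congr negligible; apply/funext => e; rewrite /step mxE; ring.
apply: hmN => //.
- by move=> j; exact: snet_step.
- by move=> j; exact: neg.
- by move=> j; exact: neg.
move=> n j nm; near=> e => t tab.
have e01 : 0 < e <= 1 by near: e; exact: ev_le1.
have r0 : 0 < rho e by near: e; exact: gauge_gt0.
have hLe : forall (i : 'I_m.+1 * 'I_d) t, ae e <= t <= be e ->
    `|word_der (nseq i.1 0) (fun x => g e x * lam e 0 i.2) (const_mx t)| <= rho e `^ (- L).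
  by near: e.
rewrite (_ : (fun x => _) = fun x => (sg * rho e `^ q) * (g e x * lam e 0 j)); last first.
  by apply/funext => x; rewrite /step mxE; ring.
rewrite word_der_scale; last by move=> s x; exact: snet_diff (snet_word s (sgl j)) e01 I.
rewrite normrM normrM sg1 mul1r (ger0_norm (powR_ge0 _ _)).
have := hLe (Ordinal (nm : (n < m.+1)%N), j) t tab => /= h.
apply: (@le_trans _ _ (rho e `^ q * rho e `^ (- L))); first by rewrite ler_wpM2l ?powR_ge0.
rewrite -powRD ?(gt_eqF r0) ?implybT//; near: e; apply: le_gauge_powR.
by rewrite lerBrDr.
Unshelve. all: by end_near. Qed.

Lemma rjet_step (A : R -> R) (g : R -> 'rV[R]_1 -> R) e t (g' : R -> R -> R) dg : 0 < e <= 1 -> Ou e (const_mx t) ->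
  (forall x, g e x = g' e (x 0 0)) -> is_derive t 1 (g' e) dg ->
  rjet (fun x => ue e x + step A g e x) (const_mx t) =
  rjet (ue e) (const_mx t) + jet_step (lam e) (A e * g' e t) (A e * dg).
Proof.
move=> e01 Ot gg' hdg.
have [du _ _] := hu; have [opn smo] := du e e01.
have E : g e = fun x : 'rV[R]_1 => g' e (x 0 0) by apply/funext.
have t00 : t = (const_mx t : 'rV[R]_1) 0 0 by rewrite mxE.
rewrite t00 in hdg; have [dgx Dgx] := derive_row1 0 hdg.
have dAg : differentiable (fun x => A e * g e x) (const_mx t).
  by apply: (@differentiableM _ _ (fun=> A e)) => //; rewrite E.
have dst : differentiable (fun x => step A g e x) (const_mx t) by exact: differentiableZl.
have duet : differentiable (ue e) (const_mx t) := smo [::] _ Ot.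
rewrite /rjet /jet_step !add_row_mx addr0; congr (row_mx _ (row_mx _ _)).
  by rewrite /step gg' mxE.
rewrite /= (_ : (fun x => ue e x + step A g e x) = ue e + step A g e)//.
rewrite deriveD; [|exact: diff_derivable..]; congr (_ + _).
apply/rowP => j; rewrite -derive_coord// [RHS]mxE.
rewrite (_ : (fun y => _) = fun y => lam e 0 j * (A e * g e y)); last first.
  by apply/funext => y; rewrite /step mxE mulrC.
rewrite (@deriveMs _ _ (fun=> lam e 0 j))// derive_cst mulr0 addr0.
rewrite (@deriveMs _ _ (fun=> A e))//; last by rewrite E.
by rewrite derive_cst mulr0 addr0 E Dgx mulrC.
Qed.

Lemma jets_in_box : exists2 M, 0 < M & \forall e \near small, forall t, ae e <= t <= be e ->
  box rho ae be (d + d) M e (rjet (ue e) (const_mx t)).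
Proof.
have [||L L0 hL] := @common_power R 'I_(1 + (d + d)) (fun i L e => forall t, ae e <= t <= be e ->
    `|rjet (ue e) (const_mx t) 0 i| <= rho e `^ (- L)).
- apply: filterS (ev_gauge01 (rho := rho)) => e /andP[r0 r1] i M M' MM' h t tab.
  by apply: (le_trans (h t tab)); apply: ger_powR; rewrite ?lerN2// r0 ltW.
- move=> i; have := curve_bound ha hb ab (jet_dom_strong ha hb ab gap0 hgap hF hu)
    (snet_jet ha hb ab gap0 hgap hF hu i); apply.
exists L => //; apply: filterS hL => e hLe t tab; split=> [|i]; last exact: hLe.
have h : ae e <= rjet (ue e) (const_mx t) 0 (lshift (d + d) 0) <= be e.
  by rewrite /rjet row_mxEl mxE.
by rewrite (_ : 0 = lshift (d + d) (0 : 'I_1)); [exact: h|exact: val_inj].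
Qed.

Local Notation f e := (fun y => Fe e y 0 0).

Definition legendre_form (e : R) (x : 'rV[R]_1) : R :=
  \sum_k \sum_l word_der [:: velocity_index k; velocity_index l] (f e) (rjet (ue e) x)
     * lam e 0 k * lam e 0 l.

Lemma snet_legendre_form : snet (slab a b 0) (jet_dom (OmF := OmF) (Ov := Ou) (ve := ue)) legendre_form.
Proof.
move=> m.
have oJ := jet_dom_open hF hu; have sJ := jet_dom_strong ha hb ab gap0 hgap hF hu.
have [_ _ sF _] := (definesE _ _ _ _).1 hF.
apply: smooth_net_sum => // k; apply: smooth_net_sum => // l.
apply: smooth_netM => //; last exact: smooth_net_cst.
apply: smooth_netM => //; last exact: smooth_net_cst.
have := snet_jet_comp ha hb ab gap0 hgap hF hu
  (snet_word [:: velocity_index k; velocity_index l] (sF 0)).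
exact.
Qed.

End Legendre.

Section LegendreNet.
Context {R : realType} {rho : gauge R}.
Local Notation K := (gnum rho).
Local Notation small := ((0 : R)^'+).
Local Notation mu := (@lebesgue_measure R).
Context {a b : K} {ae be : R -> R}.
Hypotheses (ha : represents a ae) (hb : represents b be).
Hypothesis ab : forall e, ae e <= be e.
Context {gap : R}.
Hypotheses (gap0 : 0 < gap)
  (hgap : \forall e \near small, ae e + rho e `^ gap <= be e).
Context {d : nat} {F : K -> 'rV[K]_d -> 'rV[K]_d -> K}
  {OmF : R -> set 'rV[R]_(1 + (d + d))} {Fe : R -> 'rV[R]_(1 + (d + d)) -> 'rV[R]_1}.
Hypothesis hF : defines (slab a b (d + d)) OmF Fe (of_lagrangian F).
Context {Ou : R -> set 'rV[R]_1} {ue : R -> 'rV[R]_1 -> 'rV[R]_d} {u : K -> 'rV[K]_d}.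
Hypothesis hu : defines (slab a b 0) Ou ue (of_curve u).
Hypothesis hmin : local_minimizer a b (action_functional a b F) (u a) (u b) u.
Context {lam : R -> 'rV[R]_d}.
Hypothesis mlam : forall k, moderate rho (fun e => lam e 0 k).
Local Notation f e := (fun y => Fe e y 0 0).
Local Notation LF := (legendre_form (Fe := Fe) (ue := ue) (lam := lam)).

Lemma lagrangian_bounds M : 0 < M -> exists2 N, 0 < N & \forall e \near small,
  (forall z i j, box rho ae be (d + d) M e z -> `|word_der [:: i; j] (f e) z| <= rho e `^ (- N)) /\
  (forall z z' i j, box rho ae be (d + d) M e z -> box rho ae be (d + d) M e z' ->
     `|word_der [:: i; j] (f e) z' - word_der [:: i; j] (f e) z|
       <= rho e `^ (- N) * \sum_l `|z' 0 l - z 0 l|).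
Proof.
move=> M0; have [_ XO sF _] := (definesE _ _ _ _).1 hF.
have [||N N0 hN] := @common_power R ('I_(1 + (d + d)) * 'I_(1 + (d + d)))%type
  (fun i N e => forall z, box rho ae be (d + d) M e z ->
     `|word_der [:: i.1; i.2] (f e) z| <= rho e `^ (- N)).
- apply: filterS (ev_gauge01 (rho := rho)) => e /andP[r0 r1] i M' N' MN h z zB.
  by apply: (le_trans (h z zB)); apply: ger_powR; rewrite ?lerN2// r0 ltW.
- by move=> i; have := box_bound ha hb ab M0 (snet_word [:: i.1; i.2] (sF 0)); apply.
have [||L L0 hL] := @common_power R ('I_(1 + (d + d)) * 'I_(1 + (d + d)))%type
  (fun i N e => forall z z', box rho ae be (d + d) M e z -> box rho ae be (d + d) M e z' ->
     `|word_der [:: i.1; i.2] (f e) z' - word_der [:: i.1; i.2] (f e) z|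
       <= rho e `^ (- N) * \sum_l `|z' 0 l - z 0 l|).
- apply: filterS (ev_gauge01 (rho := rho)) => e /andP[r0 r1] i M' N' MN h z z' zB zB'.
  apply: (le_trans (h z z' zB zB')); rewrite ler_wpM2r ?sumr_ge0//.
  by apply: ger_powR; rewrite ?lerN2// r0 ltW.
- by move=> i; have := box_lipschitz ha hb ab M0 XO (snet_word [:: i.1; i.2] (sF 0)); apply.
exists (N + L); first exact: addr_gt0.
have h1 := @le_gauge_powR R rho (- (N + L)) (- N).
have h2 := @le_gauge_powR R rho (- (N + L)) (- L).
rewrite lerN2 lerDl (ltW L0) in h1; rewrite lerN2 lerDr (ltW N0) in h2.
near=> e.
have k1 : rho e `^ (- N) <= rho e `^ (- (N + L)) by near: e; exact: h1.
have k2 : rho e `^ (- L) <= rho e `^ (- (N + L)) by near: e; exact: h2.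
have hNe : forall (i : 'I_(1 + (d + d)) * 'I_(1 + (d + d))) z, box rho ae be (d + d) M e z ->
     `|word_der [:: i.1; i.2] (f e) z| <= rho e `^ (- N) by near: e.
have hLe : forall (i : 'I_(1 + (d + d)) * 'I_(1 + (d + d))) z z',
     box rho ae be (d + d) M e z -> box rho ae be (d + d) M e z' ->
     `|word_der [:: i.1; i.2] (f e) z' - word_der [:: i.1; i.2] (f e) z|
       <= rho e `^ (- L) * \sum_l `|z' 0 l - z 0 l| by near: e.
split=> [z i j zB|z z' i j zB zB'].
  exact: le_trans (hNe (i, j) z zB) k1.
apply: (le_trans (hLe (i, j) z z' zB zB')).
by rewrite ler_wpM2r// sumr_ge0.
Unshelve. all: by end_near. Qed.

Lemma jet_continuous Ov ve v : defines (slab a b 0) Ov ve (of_curve v) ->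
  \forall e \near small, {within `[ae e, be e],
    continuous (fun t => Fe e (rjet (ve e) (const_mx t)) 0 0 : R)}.
Proof.
move=> hv; have [_ _ sF _] := (definesE _ _ _ _).1 hF.
exact: (curve_continuous ha hb ab (jet_dom_strong ha hb ab gap0 hgap hF hv)
  (snet_jet_comp ha hb ab gap0 hgap hF hv (sF 0))).
Qed.

Lemma step_continuous A g : moderate rho A -> snet (slab a b 0) (fun=> setT) g ->
  \forall e \near small, {within `[ae e, be e],
    continuous (fun t => Fe e (rjet (fun x => ue e x + step (lam := lam) A g e x) (const_mx t)) 0 0 : R)}.
Proof.
move=> mA sg.
have sh j : snet (slab a b 0) (fun=> setT) (fun e x => step (lam := lam) A g e x 0 j).
  exact: snet_step.
have hv := definesD hu (defines_curve_of sh).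
exact: (jet_continuous (v := fun t => u t + curve_of (rho := rho) (step (lam := lam) A g) t) hv).
Qed.

(** Carries the sign of the form from one point to a neighbourhood whose radius is a power of
    [rho]. *)
Lemma legendre_form_lipschitz : exists2 N, 0 < N & \forall e \near small,
  forall s t, ae e <= s <= be e -> ae e <= t <= be e ->
  `|LF e (const_mx t) - LF e (const_mx s)| <= rho e `^ (- N) * `|t - s|.
Proof.
have [M M0 hM] := itv_box ha hb.
have [N N0 hN] := box_lipschitz ha hb ab M0 (jet_dom_strong ha hb ab gap0 hgap hF hu)
  (snet_legendre_form ha hb ab gap0 hgap hF hu mlam).
exists N => //; apply: filterS2 (hM M (lexx M)) hN => e hB hN' s t /hB sB /hB tB.
have := hN' _ _ sB tB; rewrite (_ : \sum_i _ = `|t - s|)// big_ord1.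
by rewrite !mxE.
Qed.

Lemma legendre_form_bound (e C L : R) t :
  (forall i j, `|word_der [:: i; j] (f e) (rjet (ue e) (const_mx t))| <= C) ->
  \sum_k `|lam e 0 k| <= L -> LF e (const_mx t) <= C * L ^+ 2.
Proof.
move=> hC hL; have C0 : 0 <= C := le_trans (normr_ge0 _) (hC (lshift _ 0) (lshift _ 0)).
have S0 : 0 <= \sum_k `|lam e 0 k| by apply: sumr_ge0.
apply: (@le_trans _ _ (C * (\sum_k `|lam e 0 k|) ^+ 2)); last first.
  by rewrite ler_wpM2l// lerXn2r ?nnegrE// (le_trans S0).
rewrite mulrC -sum_sum_mul /legendre_form; apply: ler_sum => k _; apply: ler_sum => l _.
apply: (le_trans (ler_norm _)); rewrite !normrM -mulrA mulrC.
apply: ler_wpM2l; first by rewrite mulr_ge0.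
exact: hC.
Qed.

End LegendreNet.

Lemma jet_stepN (R : realType) d (lam : 'rV[R]_d) x y :
  jet_step lam (- x) (- y) = - jet_step lam x y.
Proof. by rewrite /jet_step !opp_row_mx oppr0 !scaleNr. Qed.

Section UniformExponent.
Context {R : realType} {rho : gauge R}.
Local Notation K := (gnum rho).
Local Notation small := ((0 : R)^'+).
Local Notation mu := (@lebesgue_measure R).
Context {a b : K} {ae be : R -> R}.
Hypotheses (ha : represents a ae) (hb : represents b be).
Hypothesis ab : forall e, ae e <= be e.
Context {gap : R}.
Hypotheses (gap0 : 0 < gap)
  (hgap : \forall e \near small, ae e + rho e `^ gap <= be e).

(** The centre is [te] clamped to [[ae + rho^D, be - rho^D]], an interval that is not empty for [e]
    small because [D >= gap + 1]. *)
Lemma bump_centre te D : moderate rho te -> (forall e, ae e <= te e <= be e) ->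
  gap + 1 <= D -> exists2 c, moderate rho c &
    \forall e \near small, [/\ ae e + rho e `^ D <= c e, c e + rho e `^ D <= be e &
      `|c e - te e| <= rho e `^ D].
Proof.
move=> mt tab gD.
pose c e := Num.max (ae e + rho e `^ D) (Num.min (be e - rho e `^ D) (te e)).
have h : \forall e \near small, [/\ ae e + rho e `^ D <= c e, c e + rho e `^ D <= be e &
      `|c e - te e| <= rho e `^ D].
  near=> e.
  have h1 : ae e + rho e `^ gap <= be e by near: e.
  have h2 : 2 * rho e `^ (gap + 1) <= rho e `^ gap by near: e; exact: powR2_small.
  have h3 : rho e `^ D <= rho e `^ (gap + 1) by near: e; exact: le_gauge_powR.
  have /andP[h4 h5] := tab e; have h6 := powR_ge0 (rho e) D.
  rewrite /c /Num.max /Num.min; move: (rho e `^ D) h3 h6 => s h3 h6.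
  by split; repeat case: ifPn; rewrite -?leNgt ?ler_norml => *; lra.
exists c => //.
have := moderateD (represents_moderate (represents_abs (represents_gclass (rho := rho) mt)))
  (moderate_powR (rho := rho) D).
move/moderate_le; apply; apply: filterS h => e [_ _ h].
rewrite [leRHS]ger0_norm ?addr_ge0 ?powR_ge0//.
by rewrite -[c e](subrK (te e)) addrC; apply: (le_trans (ler_normD _ _)); rewrite lerD2l.
Unshelve. all: by end_near. Qed.

(** With width parameter [k = rho^-(D + 1)], a distance [rho^D] from the centre gives
    [|t - c| k >= 1/rho], and [expR_tail] applies. *)
Lemma bump_tail (c : R -> R) D E : 0 < E ->
  \forall e \near small, forall t, rho e `^ D <= `|t - c e| ->
    bump (c e) (rho e `^ (- (D + 1))) t <= rho e `^ E.
Proof.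
move=> E0; near=> e => t tc.
have r0 : 0 < rho e by near: e; exact: gauge_gt0.
apply: (@le_trans _ _ (expR (- rho e `^ (-1)))); last by near: e; exact: expR_tail.
rewrite /bump ler_expR lerN2 -real_normK ?num_real// normrM (ger0_norm (powR_ge0 _ _)).
have h : rho e `^ (-1) <= `|t - c e| * rho e `^ (- (D + 1)).
  have -> : rho e `^ (-1) = rho e `^ D * rho e `^ (- (D + 1)).
    by rewrite -powRD ?(gt_eqF r0) ?implybT//; congr (_ `^ _); lra.
  by rewrite ler_wpM2r ?powR_ge0.
have h1 : 1 <= rho e `^ (-1).
  by rewrite -[leLHS](powRr0 (rho e)); near: e; apply: le_gauge_powR; exact: lerN10.
apply: (le_trans h); rewrite expr2 ler_peMl ?mulr_ge0 ?powR_ge0//.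
exact: le_trans h1 h.
Unshelve. all: by end_near. Qed.

Context {d : nat} {F : K -> 'rV[K]_d -> 'rV[K]_d -> K}
  {OmF : R -> set 'rV[R]_(1 + (d + d))} {Fe : R -> 'rV[R]_(1 + (d + d)) -> 'rV[R]_1}.
Hypothesis hF : defines (slab a b (d + d)) OmF Fe (of_lagrangian F).
Context {Ou : R -> set 'rV[R]_1} {ue : R -> 'rV[R]_1 -> 'rV[R]_d} {u : K -> 'rV[K]_d}.
Hypothesis hu : defines (slab a b 0) Ou ue (of_curve u).
Hypothesis hmin : local_minimizer a b (action_functional a b F) (u a) (u b) u.
Context {lam : R -> 'rV[R]_d}.
Hypothesis mlam : forall k, moderate rho (fun e => lam e 0 k).
Local Notation f e := (fun y => Fe e y 0 0).
Local Notation LF := (legendre_form (Fe := Fe) (ue := ue) (lam := lam)).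

Lemma curve_in_dom : \forall e \near small, forall t, ae e <= t <= be e -> Ou e (const_mx t).
Proof.
have [_ XO _] := hu; have [M M0 hM] := itv_box ha hb.
by apply: filterS2 (hM M (lexx M)) (box_Om ha hb ab M0 XO) => e hB hO t /hB/hO.
Qed.

(** Collects all the bounds under a single exponent, so that the final estimate at a fixed [e] only
    sees one constant [L = rho^-N]. The set [B] stands for a box around the jets of [u], enlarged to
    contain steps of size at most 1. *)
Lemma uniform_exponent : exists2 N, 0 < N & \forall e \near small,
  [/\ \sum_k `|lam e 0 k| <= rho e `^ (- N), `|be e - ae e| <= rho e `^ (- N),
     (forall s t, ae e <= s <= be e -> ae e <= t <= be e ->
        `|LF e (const_mx t) - LF e (const_mx s)| <= rho e `^ (- N) * `|t - s|) &
     exists2 B : set 'rV[R]_(1 + (d + d)),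
       (forall t (y : 'rV[R]_(1 + (d + d))), ae e <= t <= be e -> y 0 (lshift (d + d) 0) = 0 ->
          (forall i, `|y 0 i| <= 1) -> B (rjet (ue e) (const_mx t) + y)) &
       [/\ forall z, B z -> differentiable (f e) z,
          forall z j, B z -> differentiable ('D_(delta_mx 0 j) (f e)) z,
          forall z i j, B z -> `|word_der [:: i; j] (f e) z| <= rho e `^ (- N) &
          forall z z' i j, B z -> B z' ->
            `|word_der [:: i; j] (f e) z' - word_der [:: i; j] (f e) z| <=
              rho e `^ (- N) * \sum_l `|z' 0 l - z 0 l|]].
Proof.
have [M M0 hM] := jets_in_box ha hb ab gap0 hgap hF hu.
have M10 : 0 < M + 1 by rewrite addr_gt0.
have [N1 N10 hN1] := lagrangian_bounds ha hb ab hF M10.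
have m2 : moderate rho (fun e => \sum_k `|lam e 0 k|).
  apply: moderate_sum => k; apply: (moderate_le (mlam k)).
  by apply: nearW => e; rewrite normr_id.
have /moderateP[N2 N20 hN2] := m2.
have /moderateP[N3 N30 hN3] := represents_moderate (representsB hb ha).
have [N4 N40 hN4] := legendre_form_lipschitz ha hb ab gap0 hgap hF hu mlam.
have [N NE] : exists N, N = N1 + N2 + N3 + N4 by eexists.
have [_ XF sF _] := (definesE _ _ _ _).1 hF.
have hO := box_Om ha hb ab M10 XF.
exists N; first by rewrite NE !addr_gt0.
near=> e.
have e01 : 0 < e <= 1 by near: e; exact: ev_le1.
have l1 : rho e `^ (- N1) <= rho e `^ (- N) by near: e; apply: le_gauge_powR; lra.
have l2 : rho e `^ (- N2) <= rho e `^ (- N) by near: e; apply: le_gauge_powR; lra.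
have l3 : rho e `^ (- N3) <= rho e `^ (- N) by near: e; apply: le_gauge_powR; lra.
have l4 : rho e `^ (- N4) <= rho e `^ (- N) by near: e; apply: le_gauge_powR; lra.
split.
- by apply: le_trans l2; apply: (le_trans (ler_norm _)); near: e.
- by apply: le_trans l3; near: e.
- move=> s t sab tab; apply: (@le_trans _ _ (rho e `^ (- N4) * `|t - s|)).
    by move: s t sab tab; near: e.
  by rewrite ler_wpM2r.
(* The jets lie in the box of exponent [M], and a step of size 1 stays in that of exponent [M + 1]
   because [1 + rho^-M <= rho^-(M + 1)] for [e] small. *)
exists (box rho ae be (d + d) (M + 1) e).
  move=> t y tab y0 y1.
  have [zab zM] : box rho ae be (d + d) M e (rjet (ue e) (const_mx t)).
    by move: t tab; near: e.
  have hM1 : 1 + rho e `^ (- M) <= rho e `^ (- (M + 1)) by near: e; exact: add1_powR_small.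
  split=> [|i].
    have : ae e <= (rjet (ue e) (const_mx t) + y) 0 (lshift (d + d) 0) <= be e.
      by rewrite mxE y0 addr0 /rjet row_mxEl mxE.
    by rewrite (_ : 0 = lshift (d + d) (0 : 'I_1)); last exact: val_inj.
  have := zM i; have := y1 i; rewrite !mxE => ? ?.
  apply: le_trans hM1; rewrite addrC; apply: (le_trans (ler_normD _ _)).
  exact: lerD.
have hOe : box rho ae be (d + d) (M + 1) e `<=` OmF e by near: e.
have [b1 b2] : (forall z i j, box rho ae be (d + d) (M + 1) e z ->
     `|word_der [:: i; j] (f e) z| <= rho e `^ (- N1)) /\
  (forall z z' i j, box rho ae be (d + d) (M + 1) e z -> box rho ae be (d + d) (M + 1) e z' ->
     `|word_der [:: i; j] (f e) z' - word_der [:: i; j] (f e) z|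
       <= rho e `^ (- N1) * \sum_l `|z' 0 l - z 0 l|) by near: e.
split.
- by move=> z zB; exact: snet_diff (sF 0) e01 (hOe z zB).
- by move=> z j zB; exact: snet_diff (snetD1 j (sF 0)) e01 (hOe z zB).
- by move=> z i j zB; exact: le_trans (b1 z i j zB) l1.
- move=> z z' i j zB zB'; apply: (le_trans (b2 z z' i j zB zB')).
  by rewrite ler_wpM2r ?sumr_ge0.
Unshelve. all: by end_near. Qed.

End UniformExponent.

(* The inequalities between the scales of the perturbation A exp(-((t - c) k)^2) cos(w (t - c))
   which make the integral of the second difference smaller than -4 p; the Lagrangian is
   controlled by L, and n0 is the size of the supposed negative value of the Legendre form. *)
Definition scales (R : realType) (L k w A delta eta tau n0 p : R) :=
  [/\ 1 <= w, A * L <= 1, 2 * w * A * L <= 1, 2 * k ^+ 2 * L <= w & k^-1 <= delta] /\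
  [/\ eta <= 1, 36 * (L ^+ 3 * w) <= eta * w ^+ 2, 216 * (L ^+ 4 * A * w ^+ 3) <= eta * w ^+ 2,
      2 * (L * delta) <= eta & 2 * eta <= n0] /\
  4 * p < A ^+ 2 * w ^+ 2 * (eta * expR (-1) ^+ 2 / k - (2 * L ^+ 3 + 1) * tau ^+ 2 * L).

(** * Choice of the exponents *)

Lemma powR_absorb_le (R : realType) (rho : gauge R) (c x y : R) : 0 <= c -> y + 1 <= x ->
  \forall e \near (0 : R)^'+, c * rho e `^ x <= rho e `^ y.
Proof.
move=> c0 yx; apply: filterS2 (powR_absorb (rho := rho) y c0) (le_gauge_powR rho yx) => e h1 h2.
by apply: le_trans h1; rewrite ler_wpM2l.
Qed.

(** The order of the quantifiers is that of the proof: [D] and [W] determine the profiles, the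
    minimizer answers with a threshold [q0] for the amplitude, and only then are the amplitude [q],
    the tail [T] and the precision [P] chosen. *)
Lemma scales_exist (R : realType) (rho : gauge R) (N N0 gap : R) : 0 < N -> 0 < N0 -> 0 < gap ->
  exists D W, [/\ 0 < W, gap + 1 <= D & forall q0, 0 <= q0 ->
    exists q T P, [/\ q0 <= q, 0 < T, 0 < P & \forall e \near (0 : R)^'+,
      scales (rho e `^ (- N)) (rho e `^ (- (D + 1))) (rho e `^ (- W)) (rho e `^ q)
        (rho e `^ D) (rho e `^ (N0 + 1)) (rho e `^ T) (rho e `^ N0) (rho e `^ P)]].
Proof.
move=> N_gt0 N0_gt0 gap_gt0.
(* [D] exceeds [N + N0 + 1], so that [2 L delta] stays below [eta = rho^(N0 + 1)], and it exceeds
   [gap] to leave room for the centre. [W] exceeds [2 (D + 1) + N], so that [w] dominates [2 k^2 L],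
   and [3 N + N0 + 1], so that [36 L^3 w] stays below [eta w^2]. *)
have [D DE] : exists D, D = N + N0 + gap + 2 by eexists.
have [W WE] : exists W, W = 2 * D + 4 * N + N0 + 8 by eexists.
exists D, W; split; [by rewrite WE DE; lra|by rewrite DE; lra|move=> q0 q00].
have [n1 n1E] : exists n1, n1 = N0 + 1 by eexists.
have [D1 D1E] : exists D1, D1 = D + 1 by eexists.
(* [q] is at least [q0] and makes [A] small enough for the cubic remainder. [H] is the exponent in a
   lower bound of [eta exp(-1)^2 / k], one unit absorbing the constant [exp(-1)^2 / 4]. [T] makes
   the tail at most a quarter of that quantity, and [rho^X = A^2 w^2 rho^H] is the size of the final
   gain. *)
have [q qE] : exists q, q = q0 + 4 * N + 2 * W + N0 + 10 by eexists.
have [H HE] : exists H, H = n1 + 1 + D1 by eexists.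
have [T TE] : exists T, T = 2 * N + H by eexists.
have [X XE] : exists X, X = q + q + - W + - W + H by eexists.
exists q, T, (X + 3); split; [by lra|by lra|by lra|].
rewrite -n1E -D1E.
have F1 : \forall e \near (0 : R)^'+, 2 * rho e `^ (- D1 + - D1 + - N) <= rho e `^ (- W).
  by apply: powR_absorb_le; lra.
have F2 : \forall e \near (0 : R)^'+, 2 * rho e `^ (- N + D) <= rho e `^ n1.
  by apply: powR_absorb_le; lra.
have F2b : \forall e \near (0 : R)^'+, 2 * rho e `^ n1 <= rho e `^ N0.
  by apply: powR_absorb_le; lra.
have F3 : \forall e \near (0 : R)^'+,
    36 * rho e `^ (- N + - N + - N + - W) <= rho e `^ (n1 + - W + - W).
  by apply: powR_absorb_le; lra.
have F4 : \forall e \near (0 : R)^'+,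
    216 * rho e `^ (- N + - N + - N + - N + q + - W + - W + - W) <= rho e `^ (n1 + - W + - W).
  by apply: powR_absorb_le; lra.
have F5 : \forall e \near (0 : R)^'+, 2 * rho e `^ (- W + q + - N) <= rho e `^ 0.
  by apply: powR_absorb_le; lra.
have F5b : \forall e \near (0 : R)^'+, 1 * rho e `^ (q + - N) <= rho e `^ 0.
  by apply: powR_absorb_le; lra.
have F6 : \forall e \near (0 : R)^'+, rho e < expR (-1) ^+ 2 / 4.
  by apply: gauge_lt; rewrite divr_gt0// exprn_gt0// expR_gt0.
have F7 : \forall e \near (0 : R)^'+, 8 * rho e `^ (X + 3) <= rho e `^ X.
  by apply: powR_absorb_le; lra.
have F8 : \forall e \near (0 : R)^'+, 3 * rho e `^ (- N + - N + - N + T + T + - N) <= rho e `^ H.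
  by apply: powR_absorb_le; lra.
have F9 : \forall e \near (0 : R)^'+, 1 * rho e `^ n1 <= rho e `^ 0.
  by apply: powR_absorb_le; lra.
have F10 : \forall e \near (0 : R)^'+, rho e `^ 0 <= rho e `^ (- N + - N + - N).
  by apply: le_gauge_powR; lra.
have F11 : \forall e \near (0 : R)^'+, 1 * rho e `^ D1 <= rho e `^ D.
  by apply: powR_absorb_le; lra.
have F12 : \forall e \near (0 : R)^'+, rho e `^ 0 <= rho e `^ (- W).
  by apply: le_gauge_powR; lra.
clear - F1 F2 F2b F3 F4 F5 F5b F6 F7 F8 F9 F10 F11 F12 XE HE.
near=> e.
have r0 : 0 < rho e by near: e; exact: gauge_gt0.
have pM x y : rho e `^ x * rho e `^ y = rho e `^ (x + y).
  by rewrite -powRD// (gt_eqF r0) implybT.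
have f1 : 2 * rho e `^ (- D1 + - D1 + - N) <= rho e `^ (- W) by near: e.
have f2 : 2 * rho e `^ (- N + D) <= rho e `^ n1 by near: e.
have f2b : 2 * rho e `^ n1 <= rho e `^ N0 by near: e.
have f3 : 36 * rho e `^ (- N + - N + - N + - W) <= rho e `^ (n1 + - W + - W) by near: e.
have f4 : 216 * rho e `^ (- N + - N + - N + - N + q + - W + - W + - W)
  <= rho e `^ (n1 + - W + - W) by near: e.
have f5 : 2 * rho e `^ (- W + q + - N) <= rho e `^ 0 by near: e.
have f5b : 1 * rho e `^ (q + - N) <= rho e `^ 0 by near: e.
have f6 : rho e < expR (-1) ^+ 2 / 4 by near: e.
have f7 : 8 * rho e `^ (X + 3) <= rho e `^ X by near: e.
have f8 : 3 * rho e `^ (- N + - N + - N + T + T + - N) <= rho e `^ H by near: e.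
have f9 : 1 * rho e `^ n1 <= rho e `^ 0 by near: e.
have f10 : rho e `^ 0 <= rho e `^ (- N + - N + - N) by near: e.
have f11 : 1 * rho e `^ D1 <= rho e `^ D by near: e.
have f12 : rho e `^ 0 <= rho e `^ (- W) by near: e.
rewrite powRr0 in f5 f5b f9 f10 f12; rewrite !mul1r in f5b f9 f11.
have kV : (rho e `^ (- D1))^-1 = rho e `^ D1 by rewrite powRN invrK.
split; [split|split; [split|]] => //.
- by rewrite pM.
- by rewrite -!mulrA !pM addrA.
- by rewrite -mulrA expr2 !pM.
- by rewrite kV.
- have -> : 36 * (rho e `^ (- N) ^+ 3 * rho e `^ (- W)) =
    36 * (rho e `^ (- N) * rho e `^ (- N) * rho e `^ (- N) * rho e `^ (- W)) by ring.
  by rewrite expr2 (mulrA (rho e `^ n1)) !pM.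
- have -> : 216 * (rho e `^ (- N) ^+ 4 * rho e `^ q * rho e `^ (- W) ^+ 3) =
    216 * (rho e `^ (- N) * rho e `^ (- N) * rho e `^ (- N) * rho e `^ (- N) * rho e `^ q *
           rho e `^ (- W) * rho e `^ (- W) * rho e `^ (- W)) by ring.
  by rewrite expr2 (mulrA (rho e `^ n1)) !pM.
- by rewrite pM.
rewrite kV.
set Z := rho e `^ q ^+ 2 * rho e `^ (- W) ^+ 2.
have ZE : Z = rho e `^ (q + q + - W + - W) by rewrite /Z !expr2 !mulrA !pM.
have Z0 : 0 < Z by rewrite ZE powR_gt0.
have h1 : (2 * rho e `^ (- N) ^+ 3 + 1) * rho e `^ T ^+ 2 * rho e `^ (- N) <= rho e `^ H.
  apply: le_trans f8; rewrite -!pM.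
  have -> : 3 * (rho e `^ (- N) * rho e `^ (- N) * rho e `^ (- N) * rho e `^ T * rho e `^ T * rho e `^ (- N))
    = (3 * rho e `^ (- N) ^+ 3) * rho e `^ T ^+ 2 * rho e `^ (- N) by ring.
  rewrite -!pM in f10; rewrite ler_wpM2r ?powR_ge0// ler_wpM2r ?sqr_ge0//.
  by rewrite !exprS expr0 mulr1 mulrA; lra.
have h2 : 4 * rho e `^ H <= rho e `^ n1 * expR (-1) ^+ 2 * rho e `^ D1.
  have -> : 4 * rho e `^ H = rho e `^ n1 * (4 * rho e) * rho e `^ D1.
    by rewrite HE -!pM powRr1 ?ltW//; ring.
  by rewrite ler_wpM2r ?powR_ge0// ler_wpM2l ?powR_ge0//; lra.
have h3 : Z * (3 * rho e `^ H) <= Z * (rho e `^ n1 * expR (-1) ^+ 2 * rho e `^ D1 - 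
     (2 * rho e `^ (- N) ^+ 3 + 1) * rho e `^ T ^+ 2 * rho e `^ (- N)).
  by rewrite (ler_wpM2l (ltW Z0))//; lra.
apply: lt_le_trans h3; rewrite mulrCA ZE pM -XE.
have := powR_gt0 X r0; lra.
Unshelve. all: by end_near. Qed.

(** * The contradiction at a fixed parameter *)

Section LegendreAtParameter.
Context {R : realType} {rho : gauge R}.
Local Notation K := (gnum rho).
Local Notation small := ((0 : R)^'+).
Local Notation mu := (@lebesgue_measure R).
Context {a b : K} {ae be : R -> R}.
Hypotheses (ha : represents a ae) (hb : represents b be).
Hypothesis ab : forall e, ae e <= be e.
Context {gap : R}.
Hypotheses (gap0 : 0 < gap)
  (hgap : \forall e \near small, ae e + rho e `^ gap <= be e).
Context {d : nat} {F : K -> 'rV[K]_d -> 'rV[K]_d -> K}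
  {OmF : R -> set 'rV[R]_(1 + (d + d))} {Fe : R -> 'rV[R]_(1 + (d + d)) -> 'rV[R]_1}.
Hypothesis hF : defines (slab a b (d + d)) OmF Fe (of_lagrangian F).
Context {Ou : R -> set 'rV[R]_1} {ue : R -> 'rV[R]_1 -> 'rV[R]_d} {u : K -> 'rV[K]_d}.
Hypothesis hu : defines (slab a b 0) Ou ue (of_curve u).
Hypothesis hmin : local_minimizer a b (action_functional a b F) (u a) (u b) u.
Context {lam : R -> 'rV[R]_d}.
Hypothesis mlam : forall k, moderate rho (fun e => lam e 0 k).
Local Notation f e := (fun y => Fe e y 0 0).
Local Notation LF := (legendre_form (Fe := Fe) (ue := ue) (lam := lam)).
Local Notation gcos c k w := (fun e (x : 'rV[R]_1) => cos_bump (c e) (k e) (w e) (x 0 0)).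
Local Notation gsin c k w := (fun e (x : 'rV[R]_1) => sin_bump (c e) (k e) (w e) (x 0 0)).
Local Notation G A g e t :=
  (Fe e (rjet (fun x => ue e x + step (lam := lam) A g e x) (const_mx t)) 0 0).
Local Notation G0 e t := (Fe e (rjet (ue e) (const_mx t)) 0 0).

Lemma jet_step_le1 e A w C x y : 0 <= C -> 0 <= A -> \sum_k `|lam e 0 k| <= C -> A * C <= 1 ->
  2 * w * A * C <= 1 -> `|x| <= A -> `|y| <= 2 * w * A -> forall i, `|jet_step (lam e) x y 0 i| <= 1.
Proof.
move=> C0 A0 lC AC wAC xA yA i.
have lk k : `|lam e 0 k| <= C.
  by apply: le_trans lC; rewrite (bigD1 k)//= lerDl sumr_ge0.
case: (split_ordP i) => j ->.
  by rewrite /jet_step row_mxEl mxE normr0.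
case: (split_ordP j) => l ->; rewrite /jet_step row_mxEr ?row_mxEl ?row_mxEr mxE normrM.
  by apply: le_trans AC; apply: ler_pM.
by apply: le_trans wAC; apply: ler_pM.
Qed.

Lemma pair_difference_le e t (A c k w : R -> R) C (B : set 'rV[R]_(1 + (d + d))) : 0 < e <= 1 -> Ou e (const_mx t) ->
  0 <= C -> 0 <= A e -> 1 <= w e -> `|2 * k e ^+ 2 * (t - c e)| <= w e ->
  \sum_k `|lam e 0 k| <= C -> A e * C <= 1 -> 2 * w e * A e * C <= 1 ->
  (forall y : 'rV[R]_(1 + (d + d)), y 0 (lshift (d + d) 0) = 0 ->
     (forall i, `|y 0 i| <= 1) -> B (rjet (ue e) (const_mx t) + y)) ->
  [/\ forall z, B z -> differentiable (f e) z,
      forall z j, B z -> differentiable ('D_(delta_mx 0 j) (f e)) z,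
      forall z i j, B z -> `|word_der [:: i; j] (f e) z| <= C &
      forall z z' i j, B z -> B z' ->
        `|word_der [:: i; j] (f e) z' - word_der [:: i; j] (f e) z| <=
          C * \sum_l `|z' 0 l - z 0 l|] ->
  (G (fun e => 1 * A e) (gcos c k w) e t + G (fun e => -1 * A e) (gcos c k w) e t - 2 * G0 e t) +
  (G (fun e => 1 * A e) (gsin c k w) e t + G (fun e => -1 * A e) (gsin c k w) e t - 2 * G0 e t) <=
  A e ^+ 2 * bump (c e) (k e) t ^+ 2 *
    ((w e ^+ 2 + (2 * k e ^+ 2 * (t - c e)) ^+ 2) * LF e (const_mx t) +
     (9 * C * C ^+ 2 * w e + 54 * C * C ^+ 3 * A e * w e ^+ 3)).
Proof.
move=> e01 Ot C0 A0 w1 kw lC AC wAC hB [d1 d2 b1 b2].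
have hc := is_derive_cos_bump (c e) (k e) (w e) t.
have hs := is_derive_sin_bump (c e) (k e) (w e) t.
have rc A' := rjet_step hu (lam := lam) A' (g := gcos c k w)
  (g' := fun e t => cos_bump (c e) (k e) (w e) t) e01 Ot (fun=> erefl) hc.
have rs A' := rjet_step hu (lam := lam) A' (g := gsin c k w)
  (g' := fun e t => sin_bump (c e) (k e) (w e) t) e01 Ot (fun=> erefl) hs.
rewrite !rc !rs !mul1r !mulN1r !mulNr !jet_stepN.
have := @bump_pair_difference _ _ (f e) B (rjet (ue e) (const_mx t)) (lam e) (A e) (c e) (k e) (w e) t C C
  C0 A0 w1 kw lC _ d1 d2 b1 b2 _ _ erefl erefl.
apply; move=> x y s xA yA /andP[s0 s1]; apply: hB => [|i].
  by rewrite mxE jet_step0 mulr0.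
rewrite mxE normrM -[leRHS]mulr1 ler_pM//; first by rewrite ler_norml s0.
exact: (jet_step_le1 C0 A0 lC AC wAC xA yA).
Qed.

Lemma bump_negligible (c : R -> R) D (g : R -> R -> R) (x : R -> R) :
  (forall e t, `|g e t| <= bump (c e) (rho e `^ (- (D + 1))) t) ->
  (\forall e \near small, rho e `^ D <= `|x e - c e|) ->
  negligible rho (fun e => g e (x e)).
Proof.
move=> hg hx; apply/negligibleP => E E0; apply: filterS2 (bump_tail (rho := rho) c D E0) hx => e hE hxe.
exact: le_trans (hg e (x e)) (hE _ hxe).
Qed.


(** The factors [1 * A e] and [-1 * A e] match the sign [sg] in [minimizer_step], whose four
    inequalities bound the integral of this function from below. *)
Definition pair_difference A c k w e t :=
  (G (fun e => 1 * A e) (gcos c k w) e t + G (fun e => -1 * A e) (gcos c k w) e t - 2 * G0 e t) +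
  (G (fun e => 1 * A e) (gsin c k w) e t + G (fun e => -1 * A e) (gsin c k w) e t - 2 * G0 e t).

(** An argument in the reals, at one parameter. If the form at [t0] were below [- n0], it would be
    below [- eta] within [delta] of the centre; [bump_integral_le] then bounds the integral from
    above, and the last clause of [scales] puts this bound below [- 4 p]. *)
Lemma legendre_at e t0 (A c k w : R -> R) L delta eta tau n0 p : 0 < e <= 1 ->
  (forall t, ae e <= t <= be e -> Ou e (const_mx t)) ->
  0 <= L -> 0 <= A e -> 0 < k e -> 0 <= delta -> 0 <= eta -> 0 <= tau ->
  scales L (k e) (w e) (A e) delta eta tau n0 p ->
  ae e <= t0 <= be e -> ae e + delta <= c e -> c e + delta <= be e -> `|c e - t0| <= delta ->
  (forall t, delta <= `|t - c e| -> bump (c e) (k e) t <= tau) ->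
  \sum_k `|lam e 0 k| <= L -> `|be e - ae e| <= L ->
  (forall s t, ae e <= s <= be e -> ae e <= t <= be e ->
        `|LF e (const_mx t) - LF e (const_mx s)| <= L * `|t - s|) ->
  (exists2 B : set 'rV[R]_(1 + (d + d)),
       (forall t (y : 'rV[R]_(1 + (d + d))), ae e <= t <= be e -> y 0 (lshift (d + d) 0) = 0 ->
          (forall i, `|y 0 i| <= 1) -> B (rjet (ue e) (const_mx t) + y)) &
       [/\ forall z, B z -> differentiable (f e) z,
          forall z j, B z -> differentiable ('D_(delta_mx 0 j) (f e)) z,
          forall z i j, B z -> `|word_der [:: i; j] (f e) z| <= L &
          forall z z' i j, B z -> B z' ->
            `|word_der [:: i; j] (f e) z' - word_der [:: i; j] (f e) z| <=
              L * \sum_l `|z' 0 l - z 0 l|]) ->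
  {within `[ae e, be e], continuous (pair_difference A c k w e)} ->
  - (4 * p) <= \int[mu]_(t in `[ae e, be e]) pair_difference A c k w e t ->
  - n0 <= LF e (const_mx t0).
Proof.
move=> e01 hO L0 A0 k0 del0 eta0 tau0 [[w1 AL wAL kw kd] [[eta1 hE1 hE2 hdel hn] hp]].
move=> tab ac cbe ct tl lC bC lip [B hB dB] cS hS.
rewrite leNgt; apply/negP => lt.
have abL : be e - ae e <= L := le_trans (ler_norm _) bC.
have w0 : 0 <= w e := le_trans ler01 w1.
have k20 : 0 <= 2 * k e ^+ 2 by rewrite mulr_ge0 ?sqr_ge0.
have kabw : 2 * k e ^+ 2 * (be e - ae e) <= w e by apply: le_trans kw; rewrite ler_wpM2l.
have L30 : 0 <= L ^+ 3 by exact: exprn_ge0.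
(* The remainder of [bump_pair_difference] with both constants equal to [L]. The numbers 36 and 216
   in [scales] are four times 9 and 54, so that each term is at most a quarter of [eta w^2]. *)
pose E := 9 * L * L ^+ 2 * w e + 54 * L * L ^+ 3 * A e * w e ^+ 3.
have E0 : 0 <= E by rewrite /E addr_ge0 ?mulr_ge0 ?exprn_ge0.
have Ew : E <= eta * w e ^+ 2 / 2.
  have -> : E = 9 * (L ^+ 3 * w e) + 54 * (L ^+ 4 * A e * w e ^+ 3) by rewrite /E; ring.
  by move: (L ^+ 3 * _) (_ * w e ^+ 3) (eta * _) hE1 hE2 => x y z; lra.
have := @bump_integral_le R (ae e) (be e) (c e) (k e) (w e) (A e) (L ^+ 3) E eta delta tau
  (fun t => LF e (const_mx t)) (pair_difference A c k w e) cS k0.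
move=> /(_ _ _ kd w0 kabw L30 _ tau0); rewrite eta0 eta1 E0 Ew.
have h1 : ae e <= c e - (k e)^-1 by move: ac kd; lra.
have h2 : c e + (k e)^-1 <= be e by move: cbe kd; lra.
move=> /(_ h1 h2 isT isT).
(* One factor [L] bounds the second derivatives of the Lagrangian, the two others bound [lam]. *)
have q1 t : ae e <= t <= be e -> LF e (const_mx t) <= L ^+ 3.
  move=> tx; rewrite exprS; apply: legendre_form_bound lC => i j.
  have [_ _ dB2 _] := dB; apply: dB2; rewrite -[rjet _ _]addr0; apply: hB => //.
    by rewrite mxE.
  by move=> l; rewrite mxE normr0.
(* Both [t] and [t0] lie within [delta] of the centre. The form starts below [- n0 <= - 2 eta] and
   rises by at most [2 L delta <= eta]. *)
have q2 t : ae e <= t <= be e -> `|t - c e| <= delta -> LF e (const_mx t) <= - eta.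
  move=> tx tc; have := lip t0 t tab tx; rewrite ler_norml => /andP[_].
  have tt0 : `|t - t0| <= 2 * delta.
    by rewrite -[t - t0](subrKA (c e)); apply: (le_trans (ler_normD _ _)); move: tc ct; lra.
  have : L * `|t - t0| <= L * (2 * delta) by rewrite ler_wpM2l.
  rewrite [L * (2 * _)]mulrCA; move: lt; move: (LF e (const_mx t)) (LF e (const_mx t0)) => x y lt.
  by move: (L * delta) (L * _) hdel => z x'; lra.
move=> /(_ q1 q2 (fun t _ => tl t)).
have pw t : ae e <= t <= be e -> pair_difference A c k w e t <= A e ^+ 2 * bump (c e) (k e) t ^+ 2 *
     ((w e ^+ 2 + (2 * k e ^+ 2 * (t - c e)) ^+ 2) * LF e (const_mx t) + E).
  move=> tx; apply: (pair_difference_le (B := B)) => //.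
  - exact: hO.
  - rewrite normrM (ger0_norm k20); apply: le_trans kabw; rewrite ler_wpM2l//.
    by rewrite ler_norml; lra.
  - by move=> y; exact: hB.
move=> /(_ pw); apply/negP; rewrite -ltNge.
apply: lt_le_trans hS; rewrite ltrNr; apply: (lt_le_trans hp).
rewrite -[leRHS]mulrN ler_wpM2l ?mulr_ge0 ?sqr_ge0//.
have : (2 * L ^+ 3 + 1) * tau ^+ 2 * (be e - ae e) <= (2 * L ^+ 3 + 1) * tau ^+ 2 * L.
  by rewrite ler_wpM2l// mulr_ge0 ?sqr_ge0// addr_ge0// mulr_ge0.
by lra.
Qed.

End LegendreAtParameter.

Lemma second_difference_ge (R : realType) (I0 I1 I2 I3 I4 p : R) :
  I0 <= I1 + p -> I0 <= I2 + p -> I0 <= I3 + p -> I0 <= I4 + p ->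
  - (4 * p) <= (I1 + I2 - 2 * I0) + (I3 + I4 - 2 * I0).
Proof. lra. Qed.

(** * Assembly of the perturbation and conclusion *)

Section LegendreMain.
Context {R : realType} {rho : gauge R}.
Local Notation K := (gnum rho).
Local Notation small := ((0 : R)^'+).
Local Notation mu := (@lebesgue_measure R).
Context {a b : K} {ae be : R -> R}.
Hypotheses (ha : represents a ae) (hb : represents b be).
Hypothesis ab : forall e, ae e <= be e.
Context {gap : R}.
Hypotheses (gap0 : 0 < gap)
  (hgap : \forall e \near small, ae e + rho e `^ gap <= be e).
Context {d : nat} {F : K -> 'rV[K]_d -> 'rV[K]_d -> K}
  {OmF : R -> set 'rV[R]_(1 + (d + d))} {Fe : R -> 'rV[R]_(1 + (d + d)) -> 'rV[R]_1}.
Hypothesis hF : defines (slab a b (d + d)) OmF Fe (of_lagrangian F).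
Context {Ou : R -> set 'rV[R]_1} {ue : R -> 'rV[R]_1 -> 'rV[R]_d} {u : K -> 'rV[K]_d}.
Hypothesis hu : defines (slab a b 0) Ou ue (of_curve u).
Hypothesis hmin : local_minimizer a b (action_functional a b F) (u a) (u b) u.
Context {lam : R -> 'rV[R]_d}.
Hypothesis mlam : forall k, moderate rho (fun e => lam e 0 k).
Local Notation f e := (fun y => Fe e y 0 0).
Local Notation LF := (legendre_form (Fe := Fe) (ue := ue) (lam := lam)).
Local Notation gcos c k w := (fun e (x : 'rV[R]_1) => cos_bump (c e) (k e) (w e) (x 0 0)).
Local Notation gsin c k w := (fun e (x : 'rV[R]_1) => sin_bump (c e) (k e) (w e) (x 0 0)).
Local Notation G A g e t :=
  (Fe e (rjet (fun x => ue e x + step (lam := lam) A g e x) (const_mx t)) 0 0).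
Local Notation G0 e t := (Fe e (rjet (ue e) (const_mx t)) 0 0).

(** The perturbations are the same wherever the form may be negative, so that one choice tests all
    [e] at once: the finitely many asymptotic statements hold together for [e] small, and
    [legendre_at] concludes at each such [e]. *)
Lemma legendre_net te N0 : moderate rho te -> (forall e, ae e <= te e <= be e) -> 0 < N0 ->
  \forall e \near small, - rho e `^ N0 <= LF e (const_mx (te e)).
Proof.
move=> mt tab N00.
have [N Np hN] := uniform_exponent ha hb ab gap0 hgap hF hu mlam.
have [D [W [W0 gD hscales]]] := scales_exist rho Np N00 gap0.
have [c mc hc] := bump_centre hgap mt tab gD.
have [k kE] : exists k : R -> R, k = fun e => rho e `^ (- (D + 1)) by eexists.
have [w wE] : exists w : R -> R, w = fun e => rho e `^ (- W) by eexists.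
have mk : moderate rho k by rewrite kE; exact: moderate_powR.
have mw : moderate rho w by rewrite wE; exact: moderate_powR.
have sc := snet_cos_bump (slab a b 0) mc mk mw.
have ss := snet_sin_bump (slab a b 0) mc mk mw.
have ca : \forall e \near small, rho e `^ D <= `|ae e - c e|.
  apply: filterS hc => e [h _ _].
  by rewrite distrC; apply: le_trans (ler_norm _); rewrite lerBrDl.
have cb : \forall e \near small, rho e `^ D <= `|be e - c e|.
  by apply: filterS hc => e [_ h _]; apply: le_trans (ler_norm _); rewrite lerBrDl.
have gx (g : R -> R -> R -> R -> R) (x : R -> R) :
    (forall c k w t, `|g c k w t| <= bump c k t) ->
    (\forall e \near small, rho e `^ D <= `|x e - c e|) ->
    negligible rho (fun e => g (c e) (k e) (w e) ((const_mx (x e) : 'rV[R]_1) 0 0)).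
  move=> hg hx.
  have := @bump_negligible R rho c D (fun e t => g (c e) (k e) (w e) t) x.
  rewrite (_ : (fun e => g _ _ _ (const_mx _ 0 0)) = fun e => g (c e) (k e) (w e) (x e)).
    by apply=> // e t; apply: (le_trans (hg _ _ _ _)); rewrite kE.
  by apply/funext => e; rewrite mxE.
have [q1 q10 h1] := minimizer_step ha hb ab gap0 hgap hF hu hmin mlam sc
  (gx _ _ cos_bump_le ca) (gx _ _ cos_bump_le cb).
have [q2 q20 h2] := minimizer_step ha hb ab gap0 hgap hF hu hmin mlam ss
  (gx _ _ sin_bump_le ca) (gx _ _ sin_bump_le cb).
(* The cosine and the sine profile each have their own threshold; [q1 + q2] is above both, so that
   they share one amplitude, as the cancellation of the cross terms requires. *)
have [|q [T [P [q12 T0 P0 hsc]]]] := hscales (q1 + q2); first by rewrite addr_ge0 ?ltW.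
have q1q : q1 <= q by apply: le_trans q12; rewrite lerDl ltW.
have q2q : q2 <= q by apply: le_trans q12; rewrite lerDr ltW.
have n1 : `|1 : R| = 1 by rewrite normr1.
have nN1 : `|-1 : R| = 1 by rewrite normrN1.
have m1 := h1 q 1 q1q n1 _ P0; have m2 := h1 q (-1) q1q nN1 _ P0.
have m3 := h2 q 1 q2q n1 _ P0; have m4 := h2 q (-1) q2q nN1 _ P0.
have mA sg : moderate rho (fun e => sg * rho e `^ q).
  exact: moderateM (moderate_cst _) (moderate_powR _).
have c0 := jet_continuous ha hb ab gap0 hgap hF hu.
have c1 := step_continuous ha hb ab gap0 hgap hF hu mlam (mA 1) sc.
have c2 := step_continuous ha hb ab gap0 hgap hF hu mlam (mA (-1)) sc.
have c3 := step_continuous ha hb ab gap0 hgap hF hu mlam (mA 1) ss.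
have c4 := step_continuous ha hb ab gap0 hgap hF hu mlam (mA (-1)) ss.
have hpd : \forall e \near small,
    {within `[ae e, be e], continuous (pair_difference (Fe := Fe) (ue := ue) (lam := lam)
       (fun e => rho e `^ q) c k w e)} /\
    - (4 * rho e `^ P) <= \int[mu]_(t in `[ae e, be e])
       pair_difference (Fe := Fe) (ue := ue) (lam := lam) (fun e => rho e `^ q) c k w e t.
  move: m1; apply: filter_app; move: m2; apply: filter_app.
  move: m3; apply: filter_app; move: m4; apply: filter_app.
  move: c0; apply: filter_app; move: c1; apply: filter_app; move: c2; apply: filter_app.
  apply: filterS2 c3 c4 => e k3 k4 k2 k1 k0 i4 i3 i2 i1.
  have [cS IS] := Rintegral_second_difference k0 k1 k2 k3 k4.
  split; first exact: cS.
  rewrite (IS : Rintegral mu `[ae e, be e] (pair_difference (Fe := Fe) (ue := ue) (lam := lam)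
    (fun e => rho e `^ q) c k w e) = _).
  exact: (second_difference_ge i1 i2 i3 i4).
have hO := curve_in_dom ha hb ab hu.
have tl := bump_tail (rho := rho) c D T0.
move: hN; apply: filter_app; move: hc; apply: filter_app; move: hsc; apply: filter_app.
move: hpd; apply: filter_app; move: hO; apply: filter_app; move: tl; apply: filter_app.
apply: filterS2 (@ev_le1 R) (gauge_gt0 rho).
move=> e e01 r0 tle hOe [cS hS] sce [ac cbe ct] [lC bC lip hB].
have scE : scales (rho e `^ (- N)) (k e) (w e) (rho e `^ q) (rho e `^ D) (rho e `^ (N0 + 1))
  (rho e `^ T) (rho e `^ N0) (rho e `^ P) by rewrite kE wE.
apply: (legendre_at hu (A := fun e => rho e `^ q) (c := c) (k := k) (w := w)
  (L := rho e `^ (- N)) (delta := rho e `^ D) (tau := rho e `^ T)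
  (eta := rho e `^ (N0 + 1)) (p := rho e `^ P)) => //; rewrite ?powR_ge0//.
- by rewrite kE powR_gt0.
- by rewrite kE.
Qed.

End LegendreMain.

(** The right endpoint is replaced by the maximum of the two representatives, so that the endpoints
    are in order for every [e], while the gap of size [rho^gap] holds for [e] small. *)
Lemma glt_representatives (R : realType) (rho : gauge R) (a b : gnum rho) : a <~ b ->
  exists ae be, [/\ represents a ae, represents b be, forall e, ae e <= be e &
    exists2 gap, 0 < gap & \forall e \near (0 : R)^'+, ae e + rho e `^ gap <= be e].
Proof.
move=> hab; have ha := represents_grep a; have hb := represents_grep b.
have [N N0 hN] := (glt_ev ha hb).1 hab.
exists (grep a), (fun e => Num.max (grep a e) (grep b e)); split => //.
- apply: (represents_congr hb); apply/negligibleP => M M0.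
  apply: filterS hN => e h; rewrite (max_idPr _) ?subrr ?normr0 ?powR_ge0//.
  by apply: le_trans h; rewrite lerDl powR_ge0.
- by move=> e; rewrite le_max lexx.
by exists N => //; apply: filterS hN => e h; rewrite le_max h orbT.
Qed.

(** An instance of [gderivative_rep] at the jet of [u]. That jet need not be sharply interior when
    [t] is not, which is where the limits at the boundary of the slab come in. *)
Lemma velocity_hessian_rep (R : realType) (rho : gauge R) d (a b : gnum rho) ae be gap F OmF Fe
    Ou ue (u : gnum rho -> 'rV[gnum rho]_d) i j t te :
  represents a ae -> represents b be -> (forall e, ae e <= be e) ->
  0 < gap -> (\forall e \near (0 : R)^'+, ae e + rho e `^ gap <= be e) ->
  defines (slab a b (d + d)) OmF Fe (of_lagrangian F) ->
  defines (slab a b 0) Ou ue (of_curve u) -> gitv a b t -> represents t te ->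
  represents (velocity_hessian a b F i j t (u t) (curve_derivative a b 1 u t))
    (fun e => word_der [:: velocity_index i; velocity_index j] (fun y => Fe e y 0 0)
       (rjet (ue e) (const_mx (te e)))).
Proof.
move=> ha hb ab gap0 hgap hF hu tab ht.
have hX := slab_const tab; have hx := vrepresents_const ht.
have Xj := jet_in (v := u) hX; have hj := jet_represents ha hb ab gap0 hgap hu hX hx.
rewrite mxE in Xj hj.
have h := gderivative_rep ha hb ab gap0 hgap hF [:: velocity_index i; velocity_index j] Xj hj 0.
rewrite /velocity_hessian lagrangian_domainE.
apply: (represents_congr h); apply/negligibleP => N N0.
apply: filterS (defines_deriv [:: velocity_index i; velocity_index j] hF Xj hj) => e ->.
by rewrite subrr normr0 powR_ge0.
Qed.

Theorem theorem46 (R : realType) (rho : gauge R) (d : nat) (a b : gnum rho)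
    (hab : a <~ b)
    (F : gnum rho -> 'rV[gnum rho]_d -> 'rV[gnum rho]_d -> gnum rho)
    (hF : GCinf_lagrangian a b F)
    (u : gnum rho -> 'rV[gnum rho]_d) (hu : GCinf_curve a b u)
    (hmin : local_minimizer a b (action_functional a b F) (u a) (u b) u)
    (t : gnum rho) (ht : gitv a b t) (lambda : 'rV[gnum rho]_d) :
  0 <=~ \sum_(i < d) \sum_(j < d)
    velocity_hessian a b F i j t (u t) (curve_derivative a b 1 u t) *
    lambda 0 i * lambda 0 j.
Proof.
have [ae [be [ha hb ab [gap gap0 hgap]]]] := glt_representatives hab.
have [_ [OmF [Fe]]] := hF; rewrite lagrangian_domainE => dF.
have [_ [Ou [ue du]]] := hu.
(* The clamped representative lies in [[ae e, be e]] for every [e], as [legendre_net] requires of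
   its test points. *)
have hte := represents_clamp ha hb ab ht (represents_grep t).
have tab e := clamp_itv ab e (grep t e).
pose lam e : 'rV[R]_d := \row_i grep (lambda 0 i) e.
have hlam i : represents (lambda 0 i) (fun e => lam e 0 i).
  by rewrite (_ : (fun e => _) = grep (lambda 0 i)); [exact: represents_grep|apply/funext => e; rewrite mxE].
have hq : represents (\sum_(i < d) \sum_(j < d)
    velocity_hessian a b F i j t (u t) (curve_derivative a b 1 u t) * lambda 0 i * lambda 0 j)
    (fun e => legendre_form (Fe := Fe) (ue := ue) (lam := lam) e
       (const_mx (clamp ae be e (grep t e)))).
  apply: represents_sum => i; apply: represents_sum => j.
  apply: (representsM (representsM _ (hlam i)) (hlam j)).
  exact: (velocity_hessian_rep i j ha hb ab gap0 hgap dF du ht hte).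
apply/(gle_ev0 hq) => N0 N00.
have mlam i : moderate rho (fun e => lam e 0 i) := represents_moderate (hlam i).
exact: (legendre_net ha hb ab gap0 hgap dF du hmin mlam (represents_moderate hte) tab N00).
Qed.
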